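(* Let $n\ge 3$, $s\in(0,1)$, and let $\Omega\subset\mathbb{R}^n$ be a domain. Let $u\in C(\mathbb{R}^n)\cap L^1_{\omega_s}(\mathbb{R}^n)$ be such that for some $\eta_0>0$, $\mathcal{K}^s u\ge \eta_0$ in $\Omega$ in the viscosity sense. Assume there exists $K>0$ such that for every $x\in\Omega$ at which $u$ can be touched from above by a $C^2$-function, $$\mathcal{I}^s u(x,y+z)+\mathcal{I}^s u(x,y-z)-2\,\mathcal{I}^s u(x,y)\le 2K|z|^{2s}\qquad\text{for a.e. } y,z\in\mathbb{R}^n.$$ Let $x\in\Omega$ be such that $u$ can be touched from above by a $C^2$-function at $x$. Then $$\eta_0\le\mathcal{K}^su(x)\le K\cdot\frac{\omega_{n-1}}4\cdot\frac{C_{n,s}}{1-s}\cdot\Big(\frac{2(n-1)}n\Big)^{s/2}=c_{K,s}\,m_*^s,$$ where $$c_{K,s}=K\cdot\frac{\omega_{n-1}}{4n^s}\cdot\frac{C_{n,s}}{1-s},\qquad m_*=\sqrt{2n(n-1)}.$$ Moreover, this inequality is stable as $s\to1$ and converges to the local compatibility condition: the right-hand side $c_{K,s}m_*^s$ converges to $m_*K$ as $s\to1$, which is the upper bound in the local condition $\eta_0\le\inf_{A\in\mathcal{A}_2}\operatorname{tr}(AD^2u(x)A)\le m_*K$.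
   Context: $\mathcal{S}^n_+$ is the set of symmetric positive definite real $n\times n$ matrices, and $\omega_{n-1}=\mathcal{H}^{n-1}(\mathbb{S}^{n-1})$ is the surface measure of the unit sphere of $\mathbb{R}^n$. With $\sigma_1(\zeta)=\sum_i\zeta_i$, $\sigma_2(\zeta)=\sum_{i<j}\zeta_i\zeta_j$, $\Gamma_2=\{\zeta\in\mathbb{R}^n:\sigma_1(\zeta)>0,\ \sigma_2(\zeta)>0\}$ and $\lambda_i(A)$ the eigenvalues of $A$ with multiplicity, $$\mathcal{A}_2=\Big\{A\in\mathcal{S}^n_+:\ \lambda_i(A)^2=\sum_{j\ne i}\zeta_j\ (i=1,\dots,n)\ \text{for some }\zeta\in\Gamma_2\text{ with }\sigma_2(\zeta)=1\Big\}.$$ $L^1_{\omega_s}(\mathbb{R}^n)$ is the set of $u$ with $\int_{\mathbb{R}^n}\frac{|u(y)|}{1+|y|^{n+2s}}\,dy<\infty$. Let $C_{n,s}=\dfrac{4^s s\,\Gamma(\frac{n+2s}{2})}{\pi^{n/2}\Gamma(1-s)}$, $\delta u(x,y)=u(x+y)+u(x-y)-2u(x)$, and $$\mathcal{K}^su(x)=\frac{C_{n,s}}2\inf_{A\in\mathcal{A}_2}\int_{\mathbb{R}^n}\frac{\delta u(x,Ay)}{|y|^{n+2s}}\,dy,\qquad \mathcal{I}^su(x,y)=(1-s)\int_{-\infty}^\infty\frac{\delta u(x,ry)}{|r|^{1+2s}}\,dr.$$ $u$ can be touched from above by a $C^2$-function at $x\in\Omega$ if there are an open neighborhood $N\subset\Omega$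 of $x$ and $\psi\in C^2(N)$ with $\psi(x)=u(x)$ and $\psi(y)>u(y)$ for all $y\in N\setminus\{x\}$. $\mathcal{K}^su\ge\eta_0$ in $\Omega$ in the viscosity sense means: for all such $x,N,\psi$, the function $v$ equal to $\psi$ in $N$ and to $u$ in $\mathbb{R}^n\setminus N$ satisfies $\mathcal{K}^sv(x)\ge\eta_0$. (It is known that then $\mathcal{K}^su(x)\ge\eta_0$ holds classically at every such $x$.) Under the hypotheses, the values of $\mathcal{I}^su(x,\cdot)$ in the second-difference inequality are finite for a.e. $y,z$. The local compatibility condition concerns $C^2$ functions $u$ on $\Omega$ with $D^2u\le KI$ and $\inf_{A\in\mathcal{A}_2}\operatorname{tr}(AD^2u(x)A)\ge\eta_0$ in $\Omega$. *)

(* Defs.v *)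
From HB Require Import structures.
From mathcomp Require Import all_boot all_order all_algebra.
From mathcomp Require Import all_classical all_reals all_analysis.

Set Implicit Arguments.
Unset Strict Implicit.
Unset Printing Implicit Defensive.

Import Order.TTheory GRing.Theory Num.Theory.
Import numFieldNormedType.Exports.

Local Open Scope classical_set_scope.
Local Open Scope ring_scope.

(* Points of R^n are row vectors 'rV[R]_n, so the matrix-vector product A y is
   y *m A^T.  The norm that MathComp-Analysis puts on 'rV[R]_n is the sup norm:
   it is only used through its topology, and the Euclidean norm is [enorm]. *)

Definition enorm (R : realType) (n : nat) (y : 'rV[R]_n) : R :=
  Num.sqrt (\sum_(i < n) y ord0 i ^+ 2).

Section borel_rV.
Context {R : realType} (n : nat).

Let coor : 'I_n -> 'rV[R]_n -> measurableTypeR R := fun i y => y ord0 i.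

Let rV_set0 : g_sigma_preimage coor set0.
Proof. exact: sigma_algebra0. Qed.

Let rV_setC A : g_sigma_preimage coor A -> g_sigma_preimage coor (~` A).
Proof. exact: sigma_algebraC. Qed.

Let rV_bigcup (F : (set 'rV[R]_n)^nat) :
  (forall i, g_sigma_preimage coor (F i)) ->
  g_sigma_preimage coor (\bigcup_i F i).
Proof. exact: sigma_algebra_bigcup. Qed.

(* The product (= Borel) sigma-algebra of R^n. *)
HB.instance Definition _ := @isMeasurable.Build default_measure_display
  'rV[R]_n (g_sigma_preimage coor) rV_set0 rV_setC rV_bigcup.

Lemma measurable_coor (i : 'I_n) :
  measurable_fun [set: 'rV[R]_n] (fun y : 'rV[R]_n => y ord0 i).
Proof.
move=> _ Y mY; rewrite setTI; apply: sub_sigma_algebra => /=.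
rewrite -bigcup_seq/=; exists i => /=; first by rewrite mem_index_enum.
by exists Y => //; rewrite setTI.
Qed.

Lemma measurable_fun_rVP d (T : measurableType d) (f : T -> 'rV[R]_n) :
  (forall i, measurable_fun [set: T] (fun x => f x ord0 i)) ->
  measurable_fun [set: T] f.
Proof.
move=> mf.
have sub : g_sigma_preimage (fun i => coor i \o f) `<=` measurable.
  apply: smallest_sub; first exact: sigma_algebra_measurable.
  by rewrite -bigcup_seq; apply: bigcup_sub => i _ A [B mB <-]; exact: mf.
by move=> _ A mA; apply: sub; rewrite g_sigma_preimage_comp; exists A.
Qed.

End borel_rV.

Fact sigma_finite_prod d1 d2 (T1 : measurableType d1) (T2 : measurableType d2)
  (R : realType) (m1 : {sigma_finite_measure set T1 -> \bar R})
  (m2 : {sigma_finite_measure set T2 -> \bar R}) :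
  sigma_finite [set: T1 * T2] (m1 \x m2)%E.
Proof.
have /sigma_finiteP[F [TF ndF Foo]] := sigma_finiteT m1.
have /sigma_finiteP[G [TG ndG Goo]] := sigma_finiteT m2.
exists (fun k => F k `*` G k).
  rewrite -setXTT TF TG predeqE => -[x y]; split.
    move=> [/= [i _ Fix] [j _ Gjy]]; exists (maxn i j) => //; split.
    - by move: x Fix; exact/subsetPset/ndF/leq_maxl.
    - by move: y Gjy; exact/subsetPset/ndG/leq_maxr.
  by move=> [k _ []/= ? ?]; split; exists k.
move=> k; have [? ?] := Foo k; have [? ?] := Goo k.
split; first exact: measurableX.
by rewrite product_measure1E// lte_mul_pinfty// ge0_fin_numE.
Qed.

Section lebesgue_rV.
Context {R : realType}.

Definition rV_cons (n : nat) (p : measurableTypeR R * 'rV[R]_n) : 'rV[R]_n.+1 :=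
  \row_(i < n.+1) if unlift ord0 i is Some j then p.2 ord0 j else p.1.

Lemma measurable_rV_cons (n : nat) : measurable_fun setT (@rV_cons n).
Proof.
apply: measurable_fun_rVP => i; rewrite /rV_cons.
under eq_fun do rewrite mxE.
case: unliftP => [j _|_]; last exact: measurable_fst.
exact: (measurableT_comp (measurable_coor j) measurable_snd).
Qed.

Section step.
Variables (n : nat) (mu : {sigma_finite_measure set 'rV[R]_n -> \bar R}).

Definition lebesgue_rV_step : set 'rV[R]_n.+1 -> \bar R :=
  pushforward (@lebesgue_measure R \x mu)%E (@rV_cons n).

Let step0 : lebesgue_rV_step set0 = 0%E.
Proof. by rewrite /lebesgue_rV_step /pushforward preimage_set0 measure0. Qed.

Let step_ge0 A : (0 <= lebesgue_rV_step A)%E.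
Proof. by rewrite /lebesgue_rV_step /pushforward measure_ge0. Qed.

Let step_sigma_additive : semi_sigma_additive lebesgue_rV_step.
Proof.
have mcons A : measurable A -> measurable (@rV_cons n @^-1` A).
  by move=> mA; rewrite -[X in measurable X]setTI; exact: measurable_rV_cons.
move=> F mF tF mUF; rewrite /lebesgue_rV_step /pushforward preimage_bigcup.
apply: measure_semi_sigma_additive.
- by move=> k; exact: mcons.
- apply/trivIsetP => /= i j _ _ ij; rewrite -preimage_setI.
  by move/trivIsetP : tF => /(_ _ _ _ _ ij) ->//; rewrite preimage_set0.
- by rewrite -preimage_bigcup; exact: mcons.
Qed.

HB.instance Definition _ := isMeasure.Build _ _ _
  lebesgue_rV_step step0 step_ge0 step_sigma_additive.

Let step_sigma_finite : sigma_finite setT lebesgue_rV_step.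
Proof.
have [F TF Ffin] := sigma_finite_prod (@lebesgue_measure R) mu.
pose g (v : 'rV[R]_n.+1) : measurableTypeR R * 'rV[R]_n :=
  (v ord0 ord0, \row_(j < n) v ord0 (lift ord0 j)).
have mg : measurable_fun setT g.
  apply/measurable_fun_prod; first exact: measurable_coor.
  apply: measurable_fun_rVP => i /=.
  by under eq_fun do rewrite mxE; exact: measurable_coor.
have gK p : g (rV_cons p) = p.
  case: p => t y; rewrite /g /rV_cons; congr pair; first by rewrite mxE unlift_none.
  by apply/rowP => j; rewrite !mxE liftK.
exists (fun k => g @^-1` F k).
  by rewrite -preimage_bigcup -TF preimage_setT.
move=> k; have [mF Fk] := Ffin k; split.
  by rewrite -[X in measurable X]setTI; exact: mg.
rewrite /lebesgue_rV_step /pushforward.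
suff -> : @rV_cons n @^-1` (g @^-1` F k) = F k by [].
by apply/seteqP; split => p /=; rewrite gK.
Qed.

HB.instance Definition _ :=
  Measure_isSigmaFinite.Build _ _ _ lebesgue_rV_step step_sigma_finite.

End step.

(* n-dimensional Lebesgue measure on the Borel sets of R^n, as the product
   measure of 1-dimensional Lebesgue measure with (n-1)-dimensional one. *)
Fixpoint lebesgue_rV (n : nat) : {sigma_finite_measure set 'rV[R]_n -> \bar R} :=
  match n with
  | 0%N => @dirac _ 'rV[R]_0 0 R
  | m.+1 => lebesgue_rV_step (lebesgue_rV m)
  end.

End lebesgue_rV.

Section hausdorff.
Context {R : realType}.
Implicit Types (d n : nat).

(* The diameter of the empty set is -oo here; [gauge] gives it weight 0. *)
Definition ediam n (U : set 'rV[R]_n) : \bar R :=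
  ereal_sup [set r | exists x y, [/\ U x, U y & r = (enorm (x - y))%:E]].

Definition gauge d n (U : set 'rV[R]_n) : \bar R :=
  (if U == set0 then 0 else ediam U ^+ d)%E.

Definition hausdorff_delta d n (delta : R) (E : set 'rV[R]_n) : \bar R :=
  ereal_inf [set (\sum_(0 <= k <oo) gauge d (U k))%E | U in
    [set U : (set 'rV[R]_n)^nat |
      E `<=` \bigcup_k U k /\ forall k, (ediam (U k) <= delta%:E)%E]].

Definition hausdorff_unnormalized d n (E : set 'rV[R]_n) : \bar R :=
  ereal_sup [set hausdorff_delta d delta E | delta in [set delta | 0 < delta]].

Definition unit_cube d : set 'rV[R]_d :=
  [set y | forall i, 0 <= y ord0 i <= 1].

(* The d-dimensional Hausdorff measure of a subset of R^n, with the usual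
   normalization: in R^d it is Lebesgue measure, that is, the unit cube of R^d
   has measure 1. *)
Definition hausdorff d n (E : set 'rV[R]_n) : \bar R :=
  (((fine (hausdorff_unnormalized d (@unit_cube d)))^-1)%:E
     * hausdorff_unnormalized d E)%E.

Definition unit_sphere n : set 'rV[R]_n := [set y | enorm y = 1].

(* omega n is the omega_{n-1} of the mathematical notation. *)
Definition omega n : R := fine (hausdorff n.-1 (@unit_sphere n)).

End hausdorff.

Section constants.
Context {R : realType}.

Definition Gamma (z : R) : R :=
  \int[lebesgue_measure]_(t in `]0, +oo[) (t `^ (z - 1) * expR (- t)).

Definition Cns (n : nat) (s : R) : R :=
  4 `^ s * s * Gamma ((n%:R + 2 * s) / 2) / (pi `^ (n%:R / 2) * Gamma (1 - s)).

Definition c_Ks (n : nat) (K s : R) : R :=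
  K * (omega n / (4 * n%:R `^ s)) * (Cns n s / (1 - s)).

Definition m_star (n : nat) : R := Num.sqrt (2 * n%:R * (n%:R - 1)).

End constants.

Section A2.
Context {R : realType} (n : nat).
Implicit Types (zeta lambda : 'I_n -> R) (A B : 'M[R]_n).

Definition sigma1 zeta : R := \sum_(i < n) zeta i.

Definition sigma2 zeta : R :=
  \sum_(i < n) \sum_(j < n | (i < j)%N) zeta i * zeta j.

Definition Gamma2 : set ('I_n -> R) :=
  [set zeta | 0 < sigma1 zeta /\ 0 < sigma2 zeta].

Definition sym_posdef A : Prop :=
  A^T = A /\
  forall v : 'rV[R]_n, v != 0 -> 0 < (v *m A *m v^T) ord0 ord0.

(* lambda lists the eigenvalues of A with their (algebraic) multiplicities. *)
Definition eigenvalues_of A lambda : Prop :=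
  char_poly A = \prod_(i < n) ('X - (lambda i)%:P).

Definition A2 : set 'M[R]_n :=
  [set A | sym_posdef A /\
    exists lambda, eigenvalues_of A lambda /\
    exists zeta, [/\ Gamma2 zeta, sigma2 zeta = 1 &
      forall i, lambda i ^+ 2 = \sum_(j < n | j != i) zeta j]].

Definition loewner_le A B : Prop :=
  forall v : 'rV[R]_n,
    (v *m A *m v^T) ord0 ord0 <= (v *m B *m v^T) ord0 ord0.

End A2.

Section operators.
Context {R : realType} (n : nat).
Implicit Types (u psi f : 'rV[R]_n -> R) (x y : 'rV[R]_n).
Implicit Types (N Omega : set 'rV[R]_n) (s K eta : R).

Definition domain Omega : Prop :=
  [/\ open Omega, connected Omega & Omega !=set0].

Definition L1_omega s u : Prop :=
  measurable_fun setT u /\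
  (\int[lebesgue_rV n]_y
     (`|u y| / (1 + enorm y `^ (n%:R + 2 * s)))%:E < +oo)%E.

Definition second_diff u x y : R := u (x + y) + u (x - y) - 2 * u x.

Definition Kop s u x : \bar R :=
  ((Cns n s / 2)%:E * ereal_inf
     [set \int[lebesgue_rV n]_y
        (second_diff u x (y *m A^T) / enorm y `^ (n%:R + 2 * s))%:E
     | A in @A2 R n])%E.

Definition Iop s u x y : \bar R :=
  ((1 - s)%:E * \int[lebesgue_measure]_r
     (second_diff u x (r *: y) / `|r| `^ (1 + 2 * s))%:E)%E.

Definition partial (i : 'I_n) f : 'rV[R]_n -> R :=
  'D_(delta_mx ord0 i : 'rV[R]_n) f.

(* Meant for an open set N: only the values of f on N matter. *)
Definition C2_on N f : Prop :=
  forall x, N x ->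
  [/\ {for x, continuous f},
      forall i, derivable f x (delta_mx ord0 i : 'rV[R]_n) /\
                {for x, continuous (partial i f)} &
      forall i j, derivable (partial i f) x (delta_mx ord0 j : 'rV[R]_n) /\
                  {for x, continuous (partial j (partial i f))}].

Definition hessian f x : 'M[R]_n :=
  \matrix_(i, j) partial j (partial i f) x.

Definition local_op f x : \bar R :=
  ereal_inf [set (\tr (A *m hessian f x *m A))%:E | A in @A2 R n].

Definition touches_from_above Omega u x N psi : Prop :=
  [/\ open N /\ N `<=` Omega, N x, C2_on N psi, psi x = u x &
      forall y, N y -> y != x -> u y < psi y].

Definition touchable Omega u x : Prop :=
  Omega x /\ exists N psi, touches_from_above Omega u x N psi.

(* [patch u N psi] is psi in N and u outside N. *)
Definition viscosity_ge s Omega u eta : Prop :=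
  forall x N psi, Omega x -> touches_from_above Omega u x N psi ->
    (eta%:E <= Kop s (patch u N psi) x)%E.

Definition second_diff_ineq s K u x : Prop :=
  \forall p \ae (lebesgue_rV n \x lebesgue_rV n)%E,
    (Iop s u x (p.1 + p.2) + Iop s u x (p.1 - p.2) - 2%:E * Iop s u x p.1
       <= (2 * K * enorm p.2 `^ (2 * s))%:E)%E.

End operators.

(* Main.v *)
From HB Require Import structures.
Require Import Defs.
From mathcomp Require Import all_boot all_order all_algebra.
From mathcomp Require Import all_classical all_reals all_analysis.
From mathcomp Require Import measurable_realfun ring lra.

Set Implicit Arguments.
Unset Strict Implicit.
Unset Printing Implicit Defensive.

Import Order.TTheory GRing.Theory Num.Theory.
Import numFieldNormedType.Exports.

Local Open Scope classical_set_scope.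
Local Open Scope ring_scope.

(* Lower bound: a C^2 function touching u from above at x may be replaced by a
   paraboloid near x.  Testing the viscosity inequality with this paraboloid on
   the ball of radius r and letting r tend to 0 gives, for every A in A2, that
   the positive part of the integrand has a finite integral, which exceeds the
   integral of the negative part by at least 2 eta0 / C_{n,s}.

   Upper bound: take A = lambda I in A2, with lambda^2 = sqrt(2(n-1)/n).  For
   f >= 0 even with f 0 = 0, put J f z = \int f(r z) / |r|^(1+2s) dr; scaling and
   Tonelli give, with p = n + 2s,
     \int_{|z| <= rho} J f z dz = rho^p (2/p) \int f(w) / |w|^p dw.
   Apply this to the positive and negative parts of the second difference, with
   integrals P and Q: integrating the second-difference inequality over
   |z| <= 1, and then over |y| <= eps, gives
     (1-s) ((1-eps)^p P - (1+eps)^p Q) <= K n |B| / 2 + (1-s) eps^(2s) P,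
   and eps -> 0 bounds P - Q.

   The surface measure of the sphere is n |B|: the Hausdorff measure on the
   sphere and the cone measure of the ball are both invariant under reflections,
   hence proportional (Christensen), and the ratio is found by comparing a small
   cap, seen as a graph over a flat disc, with the cone over it. *)

(** * Lebesgue measure on R^n *)

(** If the second-difference inequality could be used at [y = 0], where the line integral vanishes,
    it would say [I^s u(x,z) <= K |z|^(2s)], and one integration over the unit ball would suffice.
    It holds only almost everywhere, so [y] is averaged over a small ball, which costs the term
    [eps^(2s) P]. Letting [eps] tend to 0 and subtracting require [P] and [Q] to be finite. This
    comes from the lower bound: the paraboloid controls the positive part near [x], [L1_omega]
    controls it far away, and the viscosity inequality then controls the negative part. Among
    multiples of the identity [lambda] is forced: [zeta = (c, ..., c)] with [sigma2 zeta = 1] gives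
    [c^2 = 2/(n(n-1))], and [lambda^2 = (n-1) c]. By homogeneity it enters the bound as
    [lambda^(2s) = (2(n-1)/n)^(s/2)]. Of the normalizing constant of Hausdorff measure only
    positivity and finiteness are used. As [s -> 1], the pole disappears through
    [(1-s) Gamma(1-s) = Gamma(2-s)], and [n |B|] cancels [pi^(n/2)] against [Gamma(n/2+1)]. *)

Section measurability.
Context {R : realType}.

Lemma measurable_coor_comp d (T : measurableType d) n (f : T -> 'rV[R]_n)
    (i : 'I_n) :
  measurable_fun setT f -> measurable_fun setT (fun x => f x ord0 i).
Proof. exact: (measurableT_comp (measurable_coor i)). Qed.

Lemma measurable_rVD d (T : measurableType d) n (f g : T -> 'rV[R]_n) :
  measurable_fun setT f -> measurable_fun setT g ->
  measurable_fun setT (fun x => f x + g x).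
Proof.
move=> mf mg; apply: measurable_fun_rVP => i.
under eq_fun do rewrite mxE.
by apply: measurable_funD; exact: measurable_coor_comp.
Qed.

Lemma measurable_rVN d (T : measurableType d) n (f : T -> 'rV[R]_n) :
  measurable_fun setT f -> measurable_fun setT (fun x => - f x).
Proof.
move=> mf; apply: measurable_fun_rVP => i.
under eq_fun do rewrite mxE.
by apply: measurableT_comp => //; exact: measurable_coor_comp.
Qed.

Lemma measurable_rVB d (T : measurableType d) n (f g : T -> 'rV[R]_n) :
  measurable_fun setT f -> measurable_fun setT g ->
  measurable_fun setT (fun x => f x - g x).
Proof. by move=> mf mg; apply: measurable_rVD => //; exact: measurable_rVN. Qed.

Lemma measurable_rV_shift n (a : 'rV[R]_n) : measurable_fun setT (fun y : 'rV[R]_n => y + a).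
Proof. exact: measurable_rVD. Qed.

Lemma measurable_rVZ d (T : measurableType d) n (a : T -> R)
    (f : T -> 'rV[R]_n) :
  measurable_fun setT a -> measurable_fun setT f ->
  measurable_fun setT (fun x => a x *: f x).
Proof.
move=> ma mf; apply: measurable_fun_rVP => i.
under eq_fun do rewrite mxE.
by apply: measurable_funM => //; exact: measurable_coor_comp.
Qed.

Lemma measurable_mulmxr d (T : measurableType d) n (A : 'M[R]_n)
    (f : T -> 'rV[R]_n) :
  measurable_fun setT f -> measurable_fun setT (fun x => f x *m A).
Proof.
move=> mf; apply: measurable_fun_rVP => i.
under eq_fun do rewrite mxE.
apply: measurable_sum => j.
by apply: measurable_funM => //; exact: measurable_coor_comp.
Qed.

Lemma measurable_enorm d (T : measurableType d) n (f : T -> 'rV[R]_n) :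
  measurable_fun setT f -> measurable_fun setT (fun x => enorm (f x)).
Proof.
move=> mf; apply: (measurableT_comp (continuous_measurable_fun _)).
  by move=> x; exact: sqrt_continuous.
apply: measurable_sum => j.
by apply: measurable_funX; exact: measurable_coor_comp.
Qed.

Lemma measurable_powRl d (T : measurableType d) (f : T -> R) (p : R) :
  measurable_fun setT f -> measurable_fun setT (fun x => f x `^ p).
Proof. by move=> mf; exact: (measurableT_comp (measurable_powR p)). Qed.

Lemma measurable_setle d (T : measurableType d) (f g : T -> R) :
  measurable_fun setT f -> measurable_fun setT g ->
  measurable [set x | f x <= g x].
Proof.
move=> mf mg; have := measurable_fun_ler mf mg.
move=> /(_ measurableT [set true]); rewrite setTI; exact.
Qed.

Lemma measurable_setlt d (T : measurableType d) (f g : T -> R) :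
  measurable_fun setT f -> measurable_fun setT g ->
  measurable [set x | f x < g x].
Proof.
move=> mf mg; have := measurable_fun_ltr mf mg.
move=> /(_ measurableT [set true]); rewrite setTI; exact.
Qed.

End measurability.

Section transport.
Context d1 d2 (X : measurableType d1) (Y : measurableType d2) (R : realType).
Variables (m1 : {measure set X -> \bar R}) (m2 : {measure set Y -> \bar R}).

(** With this, a change of variables only has to compute measures of preimages: the pushforward of
    [m1] and the multiple [c m2] agree on measurable sets, hence give the same integrals. *)
Lemma ge0_integral_transport (phi : X -> Y) (c : R) (f : Y -> \bar R) :
  0 <= c -> measurable_fun setT phi ->
  (forall A, measurable A -> m1 (phi @^-1` A) = (c%:E * m2 A)%E) ->
  measurable_fun setT f -> (forall y, 0 <= f y)%E ->
  (\int[m1]_x f (phi x) = c%:E * \int[m2]_y f y)%E.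
Proof.
move=> c0 mphi m12 mf f0.
transitivity (\int[pushforward m1 phi]_y f y)%E.
  by rewrite (ge0_integral_pushforward mphi).
transitivity (\int[mscale (NngNum c0) m2]_y f y)%E.
  apply: (@eq_measure_integral _ _ _ _ _
    (measure_function_pushforward__canonical__measure_function_Measure
       m1 mphi)) => A mA _ /=.
  exact: m12.
by rewrite ge0_integral_mscale.
Qed.

End transport.

Section sigma_finite_alias.
Context d (T : measurableType d) (R : realType) (m : {measure set T -> \bar R}).
Hypothesis msf : sigma_finite setT m.

(** The proof of sigma-finiteness is a parameter of the alias, so that a measure shown to be
    sigma-finite only in the course of an argument can still be handed to Tonelli's theorem. *)
Definition sigma_finite_alias of sigma_finite setT m : set T -> \bar R := m.

HB.instance Definition _ := Measure.copy (sigma_finite_alias msf) m.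
HB.instance Definition _ :=
  Measure_isSigmaFinite.Build _ _ _ (sigma_finite_alias msf) msf.

End sigma_finite_alias.

(** * Translation invariance and uniqueness of the invariant measure *)

Section lebesgue_rV_translation.
Context {R : realType}.
Local Notation leb := (@lebesgue_measure R).

Lemma lebesgue_measure_translation (a : R) (A : set (measurableTypeR R)) :
  measurable A -> leb ((fun x => x + a) @^-1` A) = leb A.
Proof.
move=> mA; apply/esym.
have ma : measurable_fun setT (fun x : measurableTypeR R => x + a : measurableTypeR R).
  exact: measurable_funD.
apply: (@lebesgue_measure_unique R
  (measure_function_pushforward__canonical__measure_function_Measure leb ma)) => //.
move=> _ [[b c]] _ <- /=; rewrite /pushforward.
have -> : (fun x : R => x + a) @^-1` `]b, c] = `]b - a, c - a]%classic.
  by apply/seteqP; split => x /=; rewrite !in_itv/= ltrBlDr lerBrDr.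
rewrite !lebesgue_measure_itv/= !lte_fin ltrD2r.
by case: ifPn => // _; rewrite -!EFinB opprB addrA subrK.
Qed.

Lemma lebesgue_rVSE n (A : set 'rV[R]_n.+1) :
  lebesgue_rV n.+1 A = (leb \x lebesgue_rV n)%E (@rV_cons R n @^-1` A).
Proof. by []. Qed.

Lemma rV_consD n (t a : R) (y b : 'rV[R]_n) :
  rV_cons (t + a, y + b) = rV_cons (t, y) + rV_cons (a, b).
Proof.
apply/rowP => i; rewrite !mxE; case: unliftP => [j _|_] //=.
by rewrite mxE.
Qed.

Lemma rV_consZ n (c t : R) (y : 'rV[R]_n) :
  rV_cons (c * t, c *: y) = c *: rV_cons (t, y).
Proof.
apply/rowP => i; rewrite !mxE; case: unliftP => [j _|_] //=.
by rewrite mxE.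
Qed.

Definition rV_tail n (v : 'rV[R]_n.+1) : 'rV[R]_n :=
  \row_(j < n) v ord0 (lift ord0 j).

Lemma rV_cons_tail n (v : 'rV[R]_n.+1) : rV_cons (v ord0 ord0, rV_tail v) = v.
Proof.
apply/rowP => i; rewrite !mxE; case: unliftP => [j ->|->] //=.
by rewrite mxE.
Qed.

Lemma rV_cons0 n (t : R) (y : 'rV[R]_n) : rV_cons (t, y) ord0 ord0 = t.
Proof. by rewrite mxE unlift_none. Qed.

Lemma rV_consS n (t : R) (y : 'rV[R]_n) j :
  rV_cons (t, y) ord0 (lift ord0 j) = y ord0 j.
Proof. by rewrite mxE liftK. Qed.

Lemma rV_tail_cons n (t : R) (y : 'rV[R]_n) : rV_tail (rV_cons (t, y)) = y.
Proof. by apply/rowP => j; rewrite mxE rV_consS. Qed.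

Lemma measurable_rV_tail n : measurable_fun setT (@rV_tail n).
Proof.
apply: measurable_fun_rVP => i /=.
under eq_fun do rewrite mxE; exact: measurable_coor.
Qed.

(** Uniqueness of product measures reduces the claim to rectangles, on which the first coordinate
    and the remaining ones are translated separately. *)
Lemma lebesgue_rV_translation n (a : 'rV[R]_n) (A : set 'rV[R]_n) :
  measurable A -> lebesgue_rV n ((fun y => y + a) @^-1` A) = lebesgue_rV n A.
Proof.
elim: n a A => [|n ih] a A mA.
  by congr (lebesgue_rV _ _); apply/funext => y /=; rewrite (thinmx0 a) addr0.
rewrite !lebesgue_rVSE.
pose sh (p : measurableTypeR R * 'rV[R]_n) : measurableTypeR R * 'rV[R]_n :=
  (p.1 + a ord0 ord0, p.2 + rV_tail a).
have msh : measurable_fun setT sh.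
  apply/measurable_fun_pair.
    by apply: measurable_funD => //; exact: measurable_fst.
  by apply: measurable_rVD => //; exact: measurable_snd.
have -> : @rV_cons R n @^-1` ((fun y => y + a) @^-1` A) =
          sh @^-1` (@rV_cons R n @^-1` A).
  apply/funext => -[t y] /=.
  by rewrite /sh /= rV_consD rV_cons_tail.
apply/esym.
apply: (@product_measure_unique _ _ _ _ _ leb (lebesgue_rV n)
  (measure_function_pushforward__canonical__measure_function_Measure
    (leb \x lebesgue_rV n)%E msh)); last first.
  by rewrite -[X in measurable X]setTI; exact: measurable_rV_cons.
move=> B C mB mC /=; rewrite /pushforward.
have -> : sh @^-1` (B `*` C) =
  ((fun t => t + a ord0 ord0) @^-1` B) `*` ((fun y => y + rV_tail a) @^-1` C).
  by apply/seteqP; split.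
rewrite product_measure1E//.
- apply/esym; congr (_ * _)%E; last exact/esym/ih.
  exact/esym/(@lebesgue_measure_translation (a ord0 ord0) B mB).
- rewrite -[X in measurable X]setTI.
  have ma : measurable_fun setT (fun x : measurableTypeR R => x + a ord0 ord0 : measurableTypeR R).
    exact: measurable_funD.
  exact: ma.
- rewrite -[X in measurable X]setTI.
  exact: (measurable_rV_shift (rV_tail a)).
Qed.

Lemma measurable_forall_coor n (P : 'I_n -> set R) :
  (forall i, measurable (P i : set (measurableTypeR R))) ->
  measurable [set y : 'rV[R]_n | forall i, P i (y ord0 i)].
Proof.
move=> mP; have -> : [set y : 'rV[R]_n | forall i, P i (y ord0 i)] =
    \bigcap_(i in [set: 'I_n]) [set y | P i (y ord0 i)].
  by apply/seteqP; split => y /= h i; [move=> _; exact: h|exact: h].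
apply: fin_bigcap_measurable => // i _.
by rewrite -[X in measurable X]setTI; exact: (measurable_coor i measurableT (mP i)).
Qed.

Definition rV_box n (r : R) : set 'rV[R]_n := [set y | forall i, `|y ord0 i| <= r].

Lemma measurable_rV_box n r : measurable (@rV_box n r).
Proof.
have -> : @rV_box n r = [set y | forall i, `[- r, r]%classic (y ord0 i)].
  by apply/seteqP; split => y /= h i; have := h i; rewrite in_itv/= ler_norml.
by apply: (@measurable_forall_coor n (fun=> `[- r, r]%classic)) => i; exact: measurable_itv.
Qed.

Lemma rV_box_cover n (y : 'rV[R]_n) : exists k : nat, rV_box k%:R y.
Proof.
have [k hk] : exists k : nat, \sum_(i < n) `|y ord0 i| <= k%:R.
  exists (Num.bound (\sum_(i < n) `|y ord0 i|)).
  by apply/ltW/archi_boundP/sumr_ge0.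
exists k => i; apply: le_trans hk.
by rewrite (bigD1 i)//= lerDl sumr_ge0.
Qed.

Definition rV_cube n (r : R) : set 'rV[R]_n := [set y | forall i, 0 <= y ord0 i <= r].

Lemma measurable_rV_cube n r : measurable (@rV_cube n r).
Proof.
have -> : @rV_cube n r = [set y | forall i, `[0, r]%classic (y ord0 i)].
  by apply/seteqP; split => y /= h i; have := h i; rewrite in_itv.
by apply: (@measurable_forall_coor n (fun=> `[0, r]%classic)) => i; exact: measurable_itv.
Qed.

Lemma measurable_unit_cube n : measurable (@unit_cube R n).
Proof. exact: (@measurable_rV_cube n 1). Qed.

Lemma lebesgue_rV_cube n (r : R) : 0 <= r ->
  lebesgue_rV n (@rV_cube n r) = (r ^+ n)%:E.
Proof.
move=> r0; elim: n => [|n ih].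
  rewrite /= /dirac indicE mem_set//=.
  by move=> [].
rewrite lebesgue_rVSE.
have -> : @rV_cons R n @^-1` @rV_cube n.+1 r = `[0, r]%classic `*` @rV_cube n r.
  apply/seteqP; split => -[t y] /=.
    move=> h; split; first by have := h ord0; rewrite rV_cons0 in_itv.
    by move=> j; have := h (lift ord0 j); rewrite rV_consS.
  rewrite in_itv/= => -[t01 y01] i.
  by case: (unliftP ord0 i) => [j ->|->]; rewrite ?rV_consS ?rV_cons0.
rewrite product_measure1E//; last exact: measurable_rV_cube.
rewrite [X in (X * _)%E](_ : _ = r%:E) ?ih ?exprS ?EFinM//.
apply: (etrans (lebesgue_measure_itv _)); rewrite /= lte_fin.
by case: ltgtP r0 => [_ _|//|<- _] //; rewrite sube0.
Qed.

Lemma lebesgue_rV_unit_cube n : lebesgue_rV n (@unit_cube R n) = 1%E.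
Proof. by rewrite -[LHS]/(lebesgue_rV n (rV_cube 1)) lebesgue_rV_cube// expr1n. Qed.

(* Haar uniqueness: Fubini applied to 1_A(x + y) 1_I(y), I the unit cube,
   with each of the two invariances used once. *)
Lemma translation_invariant_unique n (m : {measure set 'rV[R]_n -> \bar R}) :
  (forall (a : 'rV[R]_n) (A : set 'rV[R]_n), measurable A -> m ((fun y => y + a) @^-1` A) = m A) ->
  (forall k : nat, m (rV_box k%:R) < +oo)%E ->
  exists2 c : R, 0 <= c &
    forall A, measurable A -> m A = (c%:E * lebesgue_rV n A)%E.
Proof.
move=> minv mfin.
have msf : sigma_finite setT m.
  exists (fun k => rV_box k%:R).
    by apply/seteqP; split => // y _; have [k hk] := rV_box_cover y; exists k.
  by move=> k; split; [exact: measurable_rV_box|exact: mfin].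
pose m' : {sigma_finite_measure set 'rV[R]_n -> \bar R} :=
  sigma_finite_alias msf.
pose I := @unit_cube R n.
(* The constant will be the measure of [-I] rather than that of [I]: for fixed [y], the condition
   [y - x \in I] puts [x] in a translate of [-I]. *)
pose J := [set y : 'rV[R]_n | I (- y)].
have mI : measurable I := @measurable_unit_cube n.
have mJ : measurable J.
  rewrite -[X in measurable X]setTI.
  by apply: (measurable_rVN (@measurable_id _ _ setT)).
have mJfin : (m J < +oo)%E.
  apply: le_lt_trans (mfin 1%N); apply: le_measure; rewrite ?inE//.
    exact: measurable_rV_box.
  move=> y /= + i => /(_ i); rewrite mxE => /andP[h1 h2].
  by rewrite ler_norml; lra.
have mJE : m J = (fine (m J))%:E by rewrite fineK// ge0_fin_numE.
exists (fine (m J)); first exact: fine_ge0.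
move=> A mA.
have msum : measurable_fun setT (fun p : 'rV[R]_n * 'rV[R]_n => p.1 + p.2).
  by apply: measurable_rVD; [exact: measurable_fst|exact: measurable_snd].
have mdif : measurable_fun setT (fun p : 'rV[R]_n * 'rV[R]_n => p.2 - p.1).
  by apply: measurable_rVB; [exact: measurable_snd|exact: measurable_fst].
pose f (p : 'rV[R]_n * 'rV[R]_n) : \bar R := (\1_A (p.1 + p.2) * \1_I p.2)%:E.
pose g (p : 'rV[R]_n * 'rV[R]_n) : \bar R := (\1_A p.2 * \1_I (p.2 - p.1))%:E.
have mf : measurable_fun setT f.
  apply/measurable_EFinP; apply: measurable_funM.
    exact: (measurableT_comp (measurable_indic mA) msum).
  exact: (measurableT_comp (measurable_indic mI) measurable_snd).
have mg : measurable_fun setT g.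
  apply/measurable_EFinP; apply: measurable_funM.
    exact: (measurableT_comp (measurable_indic mA) measurable_snd).
  exact: (measurableT_comp (measurable_indic mI) mdif).
have f0 p : (0 <= f p)%E by rewrite lee_fin mulr_ge0.
have g0 p : (0 <= g p)%E by rewrite lee_fin mulr_ge0.
have Lf y : (\int[m']_x f (x, y) = m A * (\1_I y)%:E)%E.
  rewrite /f /=; under eq_integral do rewrite EFinM.
  rewrite ge0_integralZr//.
  - congr (_ * _)%E.
    have mA' : measurable ((fun x => x + y) @^-1` A).
      rewrite -[X in measurable X]setTI.
      exact: (measurable_rV_shift y).
    rewrite -(minv y A mA).
    have := @integral_indic _ _ _ m' setT measurableT _ mA'.
    by rewrite setIT => <-.
  - apply/measurable_EFinP.
    apply: (measurableT_comp (measurable_indic mA)).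
    exact: (measurable_rV_shift y).
have Rg y : (\int[m']_x g (x, y) = (\1_A y)%:E * m J)%E.
  rewrite /g /=; under eq_integral do rewrite EFinM.
  have mJ' : measurable ((fun x => x + - y) @^-1` J).
    rewrite -[X in measurable X]setTI.
    exact: (measurable_rV_shift (- y)).
  have mi : measurable_fun setT (fun x : 'rV[R]_n => \1_I (y - x) : R).
    apply: (measurableT_comp (measurable_indic mI)).
    exact: (measurable_rVB (@measurable_cst _ _ _ _ setT y) (@measurable_id _ _ setT)).
  rewrite ge0_integralZl//.
  - congr (_ * _)%E.
    rewrite -(minv (- y) J mJ).
    have := @integral_indic _ _ _ m' setT measurableT _ mJ'.
    rewrite setIT => <-; apply: eq_integral => x _; congr (_%:E).
    by rewrite !indicE; congr (_%:R); congr nat_of_bool; apply/idP/idP;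
      rewrite !inE /J /=; rewrite opprB addrC.
  - exact/measurable_EFinP.
have fg x : (\int[lebesgue_rV n]_y f (x, y) = \int[lebesgue_rV n]_y g (x, y))%E.
  rewrite -[RHS]mul1e.
  rewrite -(@ge0_integral_transport _ _ _ _ _ (lebesgue_rV n) (lebesgue_rV n)
     (fun y => y + x) 1 (fun y => g (x, y)))//.
  - by apply: eq_integral => y _; rewrite /f /g /= addrK addrC.
  - exact: (measurable_rV_shift x).
  - by move=> B mB; rewrite mul1e; exact: lebesgue_rV_translation.
  - exact: (measurableT_comp mg (measurable_pair1 x)).
have E1 := @fubini_tonelli _ _ _ _ _ m' (lebesgue_rV n) f mf f0.
have E2 := @fubini_tonelli _ _ _ _ _ m' (lebesgue_rV n) g mg g0.
have E3 : (\int[lebesgue_rV n]_y \int[m']_x g (x, y) = lebesgue_rV n A * m J)%E.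
  under eq_integral do rewrite Rg.
  rewrite ge0_integralZr//; last exact/measurable_EFinP/measurable_indic.
  by rewrite integral_indic// setIT.
have E4 : (\int[lebesgue_rV n]_y \int[m']_x f (x, y) = m A)%E.
  under eq_integral do rewrite Lf.
  rewrite ge0_integralZl//; last exact/measurable_EFinP/measurable_indic.
  by rewrite integral_indic// setIT [X in (_ * X)%E]lebesgue_rV_unit_cube mule1.
rewrite -E4 -E1; under eq_integral do rewrite fg.
by rewrite E2 E3 mJE muleC.
Qed.

End lebesgue_rV_translation.

(** * The Euclidean norm *)

Lemma cvg_rsum {R : realType} (T : Type) (F : set_system T) {FF : Filter F} n
    (f : 'I_n -> T -> R) (l : 'I_n -> R) :
  (forall i, f i x @[x --> F] --> l i) ->
  \sum_i f i x @[x --> F] --> \sum_i l i.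
Proof. by move=> h; apply: cvg_big => // p; exact: add_continuous. Qed.

Section enorm_theory.
Context {R : realType} {n : nat}.
Implicit Types (x y : 'rV[R]_n).

Definition edot x y : R := \sum_(i < n) x ord0 i * y ord0 i.

Lemma enorm_sqr y : enorm y ^+ 2 = edot y y.
Proof. by rewrite sqr_sqrtr// sumr_ge0// => i _; rewrite sqr_ge0. Qed.

Lemma enorm_ge0 y : 0 <= enorm y. Proof. exact: sqrtr_ge0. Qed.

Lemma edotC x y : edot x y = edot y x.
Proof. by apply: eq_bigr => i _; rewrite mulrC. Qed.

Lemma edotDl x y z : edot (x + y) z = edot x z + edot y z.
Proof. by rewrite -big_split; apply: eq_bigr => i _; rewrite mxE mulrDl. Qed.

Lemma edotZl a x y : edot (a *: x) y = a * edot x y.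
Proof. by rewrite mulr_sumr; apply: eq_bigr => i _; rewrite mxE mulrA. Qed.

Lemma edotDr x y z : edot x (y + z) = edot x y + edot x z.
Proof. by rewrite edotC edotDl !(edotC _ x). Qed.

Lemma edotZr a x y : edot x (a *: y) = a * edot x y.
Proof. by rewrite edotC edotZl edotC. Qed.

Lemma edotBl x y z : edot (x - y) z = edot x z - edot y z.
Proof. by rewrite -scaleN1r edotDl edotZl mulN1r. Qed.

Lemma edotBr x y z : edot x (y - z) = edot x y - edot x z.
Proof. by rewrite edotC edotBl !(edotC _ x). Qed.

Lemma edotE x y : edot x y = (x *m y^T) ord0 ord0.
Proof. by rewrite mxE; apply: eq_bigr => i _; rewrite mxE. Qed.

Lemma edot_ge0 y : 0 <= edot y y.
Proof. by rewrite sumr_ge0// => i _; rewrite -expr2 sqr_ge0. Qed.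

Lemma edot_eq0 y : edot y y = 0 -> y = 0.
Proof.
move=> /eqP; rewrite psumr_eq0; last by move=> i _; rewrite -expr2 sqr_ge0.
move=> /allP h; apply/rowP => i; rewrite mxE; apply/eqP.
by have := h i (mem_index_enum _); rewrite /= mulf_eq0 orbb.
Qed.

Lemma enorm_eq0 y : (enorm y == 0) = (y == 0).
Proof.
apply/eqP/eqP => [h|->]; first by apply: edot_eq0; rewrite -enorm_sqr h expr0n.
by rewrite /enorm big1 ?sqrtr0// => i _; rewrite mxE expr0n.
Qed.

Lemma enorm0 : enorm (0 : 'rV[R]_n) = 0.
Proof. by apply/eqP; rewrite enorm_eq0. Qed.

Lemma enorm_gt0 y : (0 < enorm y) = (y != 0).
Proof. by rewrite lt_def enorm_ge0 andbT enorm_eq0. Qed.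

Lemma enormE y : enorm y = Num.sqrt (edot y y).
Proof. by rewrite -enorm_sqr sqrtr_sqr ger0_norm// enorm_ge0. Qed.

Lemma enormZ a y : enorm (a *: y) = `|a| * enorm y.
Proof.
by rewrite enormE edotZl edotZr mulrA -expr2 sqrtrM ?sqr_ge0// sqrtr_sqr -enormE.
Qed.

Lemma enormN y : enorm (- y) = enorm y.
Proof. by rewrite -scaleN1r enormZ normrN1 mul1r. Qed.

Lemma Cauchy_Schwarz x y : edot x y <= enorm x * enorm y.
Proof.
have [->|y0] := eqVneq y 0.
  rewrite enorm0 mulr0 /edot big1// => i _; by rewrite mxE mulr0.
have ny0 : 0 < enorm y by rewrite enorm_gt0.
(* The squared norm of [|y| x - |x| y] expands to [2 |x| |y| (|x| |y| - x.y)]. *)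
have := edot_ge0 (enorm y *: x + (- (enorm x)) *: y).
rewrite !(edotDl, edotDr, edotZl, edotZr) -!enorm_sqr (edotC y x) => h.
have [->|nx0] := eqVneq x 0.
  rewrite enorm0 mul0r /edot big1// => i _; by rewrite mxE mul0r.
rewrite -enorm_gt0 in nx0.
have p : 0 < 2 * (enorm x * enorm y) by rewrite !mulr_gt0.
rewrite -(ler_pM2l p) -subr_ge0; apply: le_trans h _.
by rewrite le_eqVlt; apply/orP; left; apply/eqP; ring.
Qed.

Lemma enormD x y : enorm (x + y) <= enorm x + enorm y.
Proof.
rewrite -(@ler_pXn2r _ 2)// ?nnegrE ?enorm_ge0 ?addr_ge0 ?enorm_ge0//.
rewrite sqrrD !enorm_sqr edotDl !edotDr (edotC y x).
have := Cauchy_Schwarz x y; lra.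
Qed.

Lemma enormBC x y : enorm (x - y) = enorm (y - x).
Proof. by rewrite -enormN opprB. Qed.

Lemma coor_le_enorm y i : `|y ord0 i| <= enorm y.
Proof.
rewrite -sqrtr_sqr ler_sqrt; last by rewrite sumr_ge0// => j _; rewrite sqr_ge0.
by rewrite (bigD1 i)//= lerDl sumr_ge0// => j _; rewrite sqr_ge0.
Qed.

Lemma enorm_le_sum y : enorm y <= \sum_(i < n) `|y ord0 i|.
Proof.
have s0 : 0 <= \sum_(i < n) `|y ord0 i| by rewrite sumr_ge0.
rewrite -(@ler_pXn2r _ 2)// ?nnegrE ?enorm_ge0// enorm_sqr expr2 mulr_suml.
apply: ler_sum => i _; rewrite -expr2 -real_normK ?num_real// expr2.
by rewrite ler_wpM2l// (bigD1 i)//= lerDl sumr_ge0.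
Qed.

Lemma enorm_le_sup y (r : R) : 0 <= r -> (forall i, `|y ord0 i| <= r) ->
  enorm y <= Num.sqrt n%:R * r.
Proof.
move=> r0 h; rewrite -(@ler_pXn2r _ 2)// ?nnegrE ?enorm_ge0 ?mulr_ge0 ?sqrtr_ge0//.
rewrite enorm_sqr exprMn sqr_sqrtr// mulr_natl.
rewrite -[in leRHS](card_ord n) -sumr_const; apply: ler_sum => i _.
by rewrite -expr2 -real_normK ?num_real// lerXn2r ?nnegrE.
Qed.

Lemma enorm_mulmx_le (A : 'M[R]_n) : exists2 a : R, 0 < a &
  forall y, enorm (y *m A) <= a * enorm y.
Proof.
exists (1 + \sum_(i < n) \sum_(j < n) `|A j i|).
  by rewrite ltr_pwDl// sumr_ge0// => i _; rewrite sumr_ge0.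
move=> y; apply: le_trans (enorm_le_sum _) _.
rewrite mulrDl mul1r -[leLHS]add0r lerD ?enorm_ge0// mulr_suml.
apply: ler_sum => i _; rewrite mxE mulr_suml.
apply: le_trans (ler_norm_sum _ _ _) _; apply: ler_sum => j _.
by rewrite normrM mulrC ler_wpM2l// coor_le_enorm.
Qed.

Lemma continuous_enorm : continuous (@enorm R n).
Proof.
move=> y; apply: (@continuous_comp _ _ _ (fun y : 'rV[R]_n => \sum_(i < n) y ord0 i ^+ 2) Num.sqrt); last exact: sqrt_continuous.
apply: (@cvg_rsum _ _ (nbhs y)) => i; apply: (@continuous_comp _ _ _ (fun y : 'rV[R]_n => y ord0 i) (fun t => t ^+ 2)).
  exact: coord_continuous.
exact: exprn_continuous.
Qed.

Definition eball x (r : R) : set 'rV[R]_n := [set y | enorm (y - x) < r].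

Lemma open_eball x r : open (eball x r).
Proof.
have -> : eball x r = (fun y => enorm (y - x)) @^-1` [set t | t < r] by [].
apply: open_comp; last exact: open_lt.
move=> y _; apply: (@continuous_comp _ _ _ (fun y : 'rV[R]_n => y - x)).
  by apply: (@cvgB _ _ _ (nbhs y) _ id (cst x)); [exact: cvg_id|exact: cvg_cst].
exact: continuous_enorm.
Qed.

(** The topology is that of the sup norm; the Euclidean ball lies in the sup ball of the same
    radius, because each coordinate is bounded by [enorm]. *)
Lemma nbhs_eball x (N : set 'rV[R]_n) : open N -> N x ->
  exists2 r : R, 0 < r & eball x r `<=` N.
Proof.
move=> oN Nx; have /nbhs_ballP[r /= r0 rN] := open_nbhs_nbhs (conj oN Nx).
exists r => // y yr; apply: rN; split=> // i j; rewrite (ord1 i).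
apply: le_lt_trans yr; rewrite enormBC; apply: le_trans (coor_le_enorm _ j).
by rewrite !mxE.
Qed.

Lemma measurable_eball x r : measurable (eball x r).
Proof.
apply: measurable_setlt => //; apply: measurable_enorm.
by apply: measurable_rVB.
Qed.

End enorm_theory.

(** * Linear changes of variables *)

Section lebesgue_rV_linear.
Context {R : realType} (n : nat).
Local Notation leb := (@lebesgue_rV R n).

Lemma rV_box_fin (r : R) : (leb (rV_box r) < +oo)%E.
Proof.
have [r0|r0] := leP 0 r; last first.
  (* For [r < 0] the box is empty unless [n = 0], when it is the whole one-point space; a cube
     bounds it in both cases. *)
  apply: (@le_lt_trans _ _ (leb (rV_cube 1))).
    apply: le_measure; rewrite ?inE//; [exact: measurable_rV_box|exact: measurable_rV_cube|].
    move=> y /= h i; have := h i; have := normr_ge0 (y ord0 i); lra.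
  by rewrite lebesgue_rV_cube// ltry.
have h : leb ((fun y => y + (- (const_mx r : 'rV[R]_n))) @^-1` rV_box r) = leb (rV_box r).
  by apply: lebesgue_rV_translation; exact: measurable_rV_box.
rewrite -h; apply: (@le_lt_trans _ _ (leb (rV_cube (2 * r)))); last first.
  by rewrite lebesgue_rV_cube ?mulr_ge0// ltry.
apply: le_measure; rewrite ?inE//.
- rewrite -[X in measurable X]setTI.
  apply: (measurable_rV_shift _) => //.
  exact: measurable_rV_box.
- exact: measurable_rV_cube.
- move=> y /= h' i; have := h' i; rewrite !mxE ler_norml; lra.
Qed.

Lemma measurable_fun_mulmxr (M : 'M[R]_n) :
  measurable_fun setT (fun y : 'rV[R]_n => y *m M).
Proof. exact: measurable_mulmxr. Qed.

(** The pushforward by an invertible linear map is again translation invariant and finite on boxes,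
    so uniqueness yields the factor. Where its value matters it is read off from one test set: a
    cube for dilations, the unit ball for isometries. *)
Lemma lebesgue_rV_mulmxr (M M' : 'M[R]_n) : M *m M' = 1%:M ->
  exists2 c : R, 0 <= c & forall A, measurable A ->
    leb ((fun y => y *m M) @^-1` A) = (c%:E * leb A)%E.
Proof.
move=> MM'.
have mM := measurable_fun_mulmxr M.
apply: (@translation_invariant_unique R n
 (measure_function_pushforward__canonical__measure_function_Measure leb mM)).
  move=> a A mA /=; rewrite /pushforward.
  have M'M : M' *m M = 1%:M by exact: mulmx1C.
  rewrite -[RHS](@lebesgue_rV_translation _ _ (a *m M')).
    congr (leb _); apply/funext => y /=.
    by rewrite mulmxDl -mulmxA M'M mulmx1.
  by rewrite -[X in measurable X]setTI; exact: mM.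
move=> k /=; rewrite /pushforward.
have [b b0 hb] := enorm_mulmx_le M'.
apply: (@le_lt_trans _ _ (leb (rV_box (b * (Num.sqrt n%:R * k%:R))))); last exact: rV_box_fin.
apply: le_measure; rewrite ?inE//.
- by rewrite -[X in measurable X]setTI; apply: mM => //; exact: measurable_rV_box.
- exact: measurable_rV_box.
- move=> y /= h i; apply: le_trans (coor_le_enorm _ _) _.
  have -> : y = (y *m M) *m M' by rewrite -mulmxA MM' mulmx1.
  apply: le_trans (hb _) _; rewrite ler_pM2l//.
  exact: enorm_le_sup.
Qed.

Lemma lebesgue_rVZ (c : R) (A : set 'rV[R]_n) : 0 < c -> measurable A ->
  leb ((fun y => c *: y) @^-1` A) = ((c^-1 ^+ n)%:E * leb A)%E.
Proof.
move=> c0 mA.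
have [|k k0 hk] := @lebesgue_rV_mulmxr (c%:M) (c^-1%:M).
  by rewrite -scalar_mxM mulfV// gt_eqF.
have hk' (B : set 'rV[R]_n) : measurable B -> leb ((fun y => c *: y) @^-1` B) = (k%:E * leb B)%E.
  by move=> /hk <-; congr (leb _); apply/funext => y /=; rewrite mul_mx_scalar.
rewrite hk'//; congr (_%:E * _)%E.
have := hk' (rV_cube c) (measurable_rV_cube c).
rewrite [leb (rV_cube _)]lebesgue_rV_cube ?(ltW c0)//.
have -> : (fun y : 'rV[R]_n => c *: y) @^-1` rV_cube c = rV_cube 1.
  apply/seteqP; split => y /= h i; have := h i; rewrite mxE.
    by rewrite pmulr_rge0// -{2}(mulr1 c) ler_pM2l.
  by move=> /andP[h1 h2]; rewrite pmulr_rge0// h1 -{2}(mulr1 c) ler_pM2l.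
rewrite [leb _]lebesgue_rV_cube// expr1n -EFinM => -[] h.
by rewrite exprVn; apply: (mulIf (expf_neq0 n (lt0r_neq0 c0))); rewrite -h mulVf// expf_neq0// gt_eqF.
Qed.

Definition vball : R := fine (leb (eball 0 1)).

Lemma eball_fin x (r : R) : (leb (eball x r) < +oo)%E.
Proof.
apply: (@le_lt_trans _ _ (leb (rV_box (r + enorm x)))); last exact: rV_box_fin.
apply: le_measure; rewrite ?inE//; [exact: measurable_eball|exact: measurable_rV_box|].
move=> y /= h i; apply: le_trans (coor_le_enorm _ _) _.
rewrite -[y](subrK x); apply: le_trans (enormD _ _) _.
by rewrite lerD2r ltW.
Qed.

Lemma vballE : leb (eball 0 1) = vball%:E.
Proof. by rewrite fineK// ge0_fin_numE// eball_fin. Qed.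

Lemma vball_gt0 : 0 < vball.
Proof.
rewrite -lte_fin -vballE.
pose r := (Num.sqrt n%:R + 1 : R)^-1.
have r0 : 0 < r by rewrite invr_gt0 ltr_wpDl// sqrtr_ge0.
apply: (@lt_le_trans _ _ (leb (rV_cube r))).
  by rewrite [leb _]lebesgue_rV_cube ?lte_fin ?exprn_gt0// ltW.
apply: le_measure; rewrite ?inE//; [exact: measurable_rV_cube|exact: measurable_eball|].
move=> y h; rewrite /eball /= subr0; apply: (@le_lt_trans _ _ (Num.sqrt n%:R * r)).
  apply: enorm_le_sup; first exact: ltW.
  by move=> i; have /andP[h1 h2] := h i; rewrite ger0_norm.
by rewrite ltr_pdivrMr ?mul1r ?ltrDl// ltr_wpDl// sqrtr_ge0.
Qed.

Lemma lebesgue_rV_eball x (r : R) : 0 < r -> leb (eball x r) = (r ^+ n * vball)%:E.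
Proof.
move=> r0.
have -> : eball x r = (fun y => y + (- x)) @^-1` ((fun y => r^-1 *: y) @^-1` eball 0 1).
  rewrite /eball; apply/seteqP; split => y /=; rewrite subr0 enormZ ger0_norm ?invr_ge0 ?(ltW r0)//.
    by rewrite ltr_pdivrMl// mulr1.
  by rewrite ltr_pdivrMl// mulr1.
rewrite [LHS]lebesgue_rV_translation; last first.
  rewrite -[X in measurable X]setTI.
  by apply: measurable_rVZ => //; exact: measurable_eball.
by rewrite lebesgue_rVZ ?invr_gt0//; [rewrite invrK [X in (_ * X)%E]vballE EFinM|exact: measurable_eball].
Qed.

Lemma lebesgue_rV_isometry (M : 'M[R]_n) (A : set 'rV[R]_n) : M *m M^T = 1%:M ->
  measurable A -> leb ((fun y => y *m M) @^-1` A) = leb A.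
Proof.
move=> MM mA.
have [c c0 hc] := lebesgue_rV_mulmxr MM.
suff c1 : c = 1 by rewrite hc// c1 mul1e.
have := hc _ (measurable_eball 0 1).
have -> : (fun y : 'rV[R]_n => y *m M) @^-1` eball 0 1 = eball 0 1.
  apply/funext => y; rewrite /eball /= !subr0; congr (is_true (_ < _)).
  rewrite !enormE; congr Num.sqrt.
  by rewrite !edotE trmx_mul mulmxA -(mulmxA y) MM mulmx1.
rewrite [leb _]vballE -EFinM => -[] h.
by apply: (mulIf (lt0r_neq0 vball_gt0)); rewrite -h mul1r.
Qed.

Lemma lebesgue_rVN (A : set 'rV[R]_n) : measurable A ->
  leb ((fun y => - y) @^-1` A) = leb A.
Proof.
move=> mA; rewrite -[RHS](@lebesgue_rV_isometry (- 1%:M))//.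
  by congr (leb _); apply/funext => y /=; rewrite mulmxN mulmx1.
by rewrite linearN/= trmx1 mulNmx mul1mx opprK.
Qed.

Definition cball (r : R) : set 'rV[R]_n := [set y | enorm y <= r].

Lemma measurable_cball r : measurable (cball r).
Proof. by apply: measurable_setle => //; exact: measurable_enorm. Qed.

(** The closed ball lies in every open ball of radius [r + d], and [(r + d)^n] is continuous at
    [d = 0]. *)
Lemma lebesgue_rV_cball (r : R) : 0 < r -> leb (cball r) = (r ^+ n * vball)%:E.
Proof.
move=> r0; apply/eqP; rewrite eq_le; apply/andP; split; last first.
  rewrite -(lebesgue_rV_eball 0)//; apply: le_measure; rewrite ?inE//.
  - exact: measurable_eball.
  - exact: measurable_cball.
  - by move=> y; rewrite /eball /cball /= subr0 => /ltW.
apply/lee_addgt0Pr => e e0.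
have [d d0 hd] : exists2 d : R, 0 < d & (r + d) ^+ n * vball <= r ^+ n * vball + e.
  have c1 : continuous (fun d : R => (r + d) ^+ n * vball).
    move=> z; apply: cvgMr_tmp; apply: (@continuous_comp _ _ _ (fun d => r + d) (fun t => t ^+ n)).
      by apply: (@cvgD _ _ _ (nbhs z) _ (cst r) id); [exact: cvg_cst|exact: cvg_id].
    exact: exprn_continuous.
  have /cvgrPdist_lt /(_ e e0) := c1 0.
  rewrite addr0 => /nbhs_ballP[d /= d0 hd].
  exists (d / 2); first by rewrite divr_gt0.
  have : ball 0 d (d / 2).
    rewrite /ball /= sub0r normrN ger0_norm ?divr_ge0 ?ltW//.
    by rewrite ltr_pdivrMr// ltr_pMr// ltrDl.
  move=> /hd; rewrite ltr_norml => /andP[h _]; lra.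
apply: (@le_trans _ _ (leb (eball 0 (r + d)))); last first.
  by rewrite lebesgue_rV_eball ?addr_gt0// -EFinD lee_fin.
apply: le_measure; rewrite ?inE//.
- exact: measurable_cball.
- exact: measurable_eball.
- by move=> y; rewrite /eball /cball /= => h; rewrite subr0 (le_lt_trans h)// ltrDl.
Qed.

End lebesgue_rV_linear.
Arguments vball {R} n.

Section change_of_variables.
Context {R : realType} (n : nat).
Local Notation leb := (@lebesgue_rV R n).
Variable f : 'rV[R]_n -> \bar R.
Hypotheses (mf : measurable_fun setT f) (f0 : forall y, (0 <= f y)%E).

Lemma ge0_integral_rVD a : (\int[leb]_y f (y + a) = \int[leb]_y f y)%E.
Proof.
rewrite -[RHS]mul1e; apply: (@ge0_integral_transport _ _ _ _ _ leb leb (fun y => y + a)) => //.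
  by apply: measurable_rVD.
by move=> A mA; rewrite mul1e; exact: lebesgue_rV_translation.
Qed.

Lemma ge0_integral_rVN : (\int[leb]_y f (- y) = \int[leb]_y f y)%E.
Proof.
rewrite -[RHS]mul1e; apply: (@ge0_integral_transport _ _ _ _ _ leb leb (fun y => - y)) => //.
  by apply: measurable_rVN.
by move=> A mA; rewrite mul1e; exact: lebesgue_rVN.
Qed.

Lemma ge0_integral_rVZ c : 0 < c ->
  (\int[leb]_y f (c *: y) = (c^-1 ^+ n)%:E * \int[leb]_y f y)%E.
Proof.
move=> c0; apply: (@ge0_integral_transport _ _ _ _ _ leb leb (fun y => c *: y)) => //.
- by rewrite exprn_ge0// invr_ge0 ltW.
- by apply: measurable_rVZ.
- by move=> A mA; exact: lebesgue_rVZ.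
Qed.

End change_of_variables.

Lemma ge0_integral_mulmxr {R : realType} n (M M' : 'M[R]_n) : M *m M' = 1%:M ->
  exists2 c : R, 0 <= c & forall f : 'rV[R]_n -> \bar R, measurable_fun setT f ->
    (forall y, 0 <= f y)%E ->
    (\int[lebesgue_rV n]_y f (y *m M) = c%:E * \int[lebesgue_rV n]_y f y)%E.
Proof.
move=> /lebesgue_rV_mulmxr[c c0 hc]; exists c => // f mf f0.
apply: (@ge0_integral_transport _ _ _ _ _ _ _ (fun y => y *m M) c) => //.
exact: measurable_mulmxr.
Qed.

(** * Power integrals and the Gamma function *)

Section powR_integrals.
Context {R : realType}.
Implicit Types (a b c x t : R).
Local Notation mu := (@lebesgue_measure R).

Lemma continuous_at_powR a x : 0 < x -> {for x, continuous (fun t => t `^ a)}.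
Proof.
move=> x0; apply/differentiable_continuous/derivable1_diffP.
by apply: derivable_powR; rewrite in_itv/= andbT.
Qed.

Lemma is_derive_cpowR k a x : 0 < x ->
  is_derive x (1 : R) (fun t => k * t `^ a) (k * (a * x `^ (a - 1))).
Proof.
move=> x0.
exact: (@is_deriveZ _ _ _ (fun t => t `^ a) k x 1 _ (is_derive1_powR a x0)).
Qed.

Lemma within_continuous_powR a (I : interval R) : (forall x, x \in I -> 0 < x) ->
  {within [set` I], continuous (fun t : R => t `^ a)}.
Proof.
move=> I0; apply: continuous_in_subspaceT => x; rewrite inE => /I0 x0.
exact: continuous_at_powR.
Qed.

Lemma cvg_powRN_pinfty a : 0 < a -> t `^ (- a) @[t --> +oo] --> (0 : R).
Proof.
move=> a0; apply/cvgrPdist_le => e e0; near=> t.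
have t0 : 0 < t by near: t; exact: nbhs_pinfty_gt.
rewrite sub0r normrN ger0_norm ?powR_ge0// powRN -[leRHS]invrK.
rewrite lef_pV2 ?posrE ?invr_gt0 ?powR_gt0//.
have -> : e^-1 = (e^-1 `^ (a^-1)) `^ a.
  by rewrite -powRrM mulVf ?gt_eqF// powRr1// invr_ge0 ltW.
have ht : (e^-1) `^ a^-1 <= t by near: t; exact: nbhs_pinfty_ge.
by apply: ge0_ler_powR ht; rewrite ?nnegrE ?powR_ge0 ?ltW.
Unshelve. all: by end_near. Qed.

Lemma integral_powR_pinfty a c : 0 < a -> 0 < c ->
  (\int[mu]_(t in `[c, +oo[) (t `^ (- a - 1))%:E = (c `^ (- a) / a)%:E)%E.
Proof.
move=> a0 c0; pose F t := (- a^-1) * t `^ (- a).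
have dF x : 0 < x -> is_derive x 1 F (x `^ (- a - 1)).
  move=> x0; have := is_derive_cpowR (- a^-1) (- a) x0.
  by rewrite mulrA mulrNN mulVf ?gt_eqF// mul1r.
rewrite (@ge0_continuous_FTC2y _ _ F c 0).
- by rewrite sub0e -EFinN; congr EFin; rewrite /F mulNr opprK mulrC.
- by move=> x _; exact: powR_ge0.
- apply: within_continuous_powR => x; rewrite in_itv/= andbT; exact: lt_le_trans.
- rewrite -[X in _ --> X](mulr0 (- a^-1)); apply: cvgMl_tmp.
  exact: cvg_powRN_pinfty.
- by move=> x cx; have [] := dF x (lt_trans c0 cx).
- apply: cvg_at_right_filter; apply: cvgMl_tmp.
  exact: continuous_at_powR.
- move=> x; rewrite in_itv/= andbT => cx.
  by have xd := dF x (lt_trans c0 cx); rewrite derive1E derive_val.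
Qed.

Lemma integral_powR_0 b c : 0 < b -> 0 < c ->
  (\int[mu]_(t in `]0%R, c]) (t `^ (b - 1))%:E = (c `^ b / b)%:E)%E.
Proof.
move=> b0 c0; pose F t := b^-1 * t `^ b.
have dF x : 0 < x -> is_derive x 1 F (x `^ (b - 1)).
  move=> x0; have := is_derive_cpowR (b^-1) b x0.
  by rewrite mulrA mulVf ?gt_eqF// mul1r.
(* For [b < 1] the integrand is singular at 0, so the fundamental theorem is applied on intervals
   that exhaust []0, c]]; the first one is a single point and is treated apart. *)
pose I (k : nat) : set R := `[c / k.+1%:R, c]%classic.
have h1 : (\int[mu]_(t in I k) (t `^ (b - 1))%:E)%E @[k --> \oo] -->
    (\int[mu]_(t in \bigcup_k I k) (t `^ (b - 1))%:E)%E.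
  apply: ge0_nondecreasing_set_cvg_integral.
  - move=> k m km; apply/subsetPset => x; rewrite /I /= !in_itv/=.
    move=> /andP[h ->]; rewrite andbT; apply: le_trans h.
    by rewrite ler_pM2l// lef_pV2 ?posrE// ler_nat.
  - by move=> k; exact: measurable_itv.
  - by move=> k; apply: measurable_funTS; apply/measurable_EFinP; exact: measurable_powR.
  - by move=> k x _; rewrite lee_fin powR_ge0.
have UI : \bigcup_k I k = `]0, c]%classic.
  apply/seteqP; split => x /=.
    move=> [k _]; rewrite /I /= !in_itv/= => /andP[h ->]; rewrite andbT.
    by apply: lt_le_trans h; rewrite divr_gt0.
  rewrite in_itv/= => /andP[x0 xc].
  exists (Num.bound (c / x)) => //; rewrite /I /= in_itv/= xc andbT.
  rewrite ler_pdivrMr// mulrC -ler_pdivrMr//.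
  apply: ltW; apply: (@lt_le_trans _ _ (Num.bound (c / x))%:R); last by rewrite ler_nat.
  by apply: archi_boundP; rewrite divr_ge0 ?ltW.
have h2 k : (\int[mu]_(t in I k) (t `^ (b - 1))%:E)%E =
    (F c - F (c / k.+1%:R))%:E.
  case: k => [|k].
    by rewrite /I divr1 set_itv1 integral_set1 subrr.
  have k0 : 0 < c / k.+2%:R by rewrite divr_gt0.
  rewrite /I (@continuous_FTC2 _ _ F).
  - by rewrite -EFinB.
  - by rewrite ltr_pdivrMr// ltr_pMr// ltr1n.
  - by apply: within_continuous_powR => x; rewrite in_itv/= => /andP[] /(lt_le_trans k0).
  - split.
    + move=> x; rewrite in_itv/= => /andP[h _].
      by have [] := dF x (lt_trans k0 h).
    + by apply: cvg_at_right_filter; apply: cvgMl_tmp; exact: continuous_at_powR.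
    + by apply: cvg_at_left_filter; apply: cvgMl_tmp; exact: continuous_at_powR.
  - move=> x; rewrite in_itv/= => /andP[h _].
    by have xd := dF x (lt_trans k0 h); rewrite derive1E derive_val.
rewrite -UI; apply: (cvg_unique _ h1) => //.
rewrite (_ : (fun k => _) = (fun k => (F c - F (c / k.+1%:R))%:E)); last first.
  by apply/funext => k; exact: h2.
apply: cvg_EFin; first by near=> k.
rewrite -[X in _ --> X]subr0 mulrC.
apply: cvgB; first exact: cvg_cst.
rewrite -(mulr0 b^-1); apply: cvgMl_tmp.
move: (powR_cvg0 b0) => /cvg_at_rightP; apply; split.
  by move=> k; rewrite divr_gt0.
rewrite -(mulr0 c); apply: cvgMl_tmp; exact: cvg_harmonic.
Unshelve. all: by end_near. Qed.

Lemma integral_expRN_pinfty c :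
  (\int[mu]_(t in `[c, +oo[) (expR (- t))%:E = (expR (- c))%:E)%E.
Proof.
pose F t := - expR (- t : R).
have dF x : is_derive x 1 F (expR (- x)).
  have h : is_derive x 1 (expR \o -%R) (- expR (- x)).
    have -> : - expR (- x) = expR (- x) * (- 1) by rewrite mulrN1.
    apply: is_derive1_comp; exact: is_deriveN.
  by have := is_deriveN h; rewrite opprK.
rewrite (@ge0_continuous_FTC2y _ _ F c 0).
- by rewrite sub0e -EFinN opprK.
- by move=> x _; exact: expR_ge0.
- apply: continuous_subspaceT => x.
  by apply: (@continuous_comp _ _ _ -%R expR); [exact: opp_continuous|exact: continuous_expR].
- by rewrite -oppr0; apply: cvgN; exact: cvgr_expR.
- by move=> x cx; have [] := dF x.
- apply: cvg_at_right_filter; apply: cvgN.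
  by apply: (@continuous_comp _ _ _ -%R expR); [exact: opp_continuous|exact: continuous_expR].
- by move=> x _; have xd := dF x; rewrite derive1E derive_val.
Qed.

End powR_integrals.

(** In the Tonelli arguments below the domain of integration is encoded by an [if] on the product
    space; this turns each section of it back into an integral over a set. *)
Lemma integral_if d (T : measurableType d) (R : realType)
    (m : {measure set T -> \bar R}) (P : T -> bool) (f : T -> \bar R) :
  (\int[m]_x (if P x then f x else 0) = \int[m]_(x in [set x | P x]) f x)%E.
Proof.
rewrite [RHS]integral_mkcond; apply: eq_integral => x _.
by rewrite patchE; congr (if _ then _ else _); rewrite mem_setE.
Qed.

(** * The Gamma function: convergence, functional equation, continuity *)

Section Gamma_theory.
Context {R : realType}.
Implicit Types (z t : R).
Local Notation mu := (@lebesgue_measure R).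

Lemma measurable_EFin_powR (p : R) (D : set (measurableTypeR R)) :
  measurable_fun D (fun t : measurableTypeR R => (t `^ p)%:E).
Proof. by apply: measurable_funTS; apply/measurable_EFinP; exact: measurable_powR. Qed.

Definition Gamma_integrand z t : R := t `^ (z - 1) * expR (- t).

Lemma Gamma_integrand_ge0 z t : 0 <= Gamma_integrand z t.
Proof. by rewrite mulr_ge0 ?powR_ge0 ?expR_ge0. Qed.

Lemma measurable_expRN : measurable_fun setT (fun t : R => expR (- t)).
Proof. by apply: measurableT_comp. Qed.

Lemma measurable_Gamma_integrand z : measurable_fun setT (Gamma_integrand z).
Proof.
apply: measurable_funM; first exact: measurable_powRl.
exact: measurable_expRN.
Qed.

Lemma Gamma_integral_fin z : 0 < z ->
  (\int[mu]_(t in `]0%R, +oo[) (Gamma_integrand z t)%:E < +oo)%E.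
Proof.
move=> z0.
have mf D : measurable_fun D (fun t => (Gamma_integrand z t)%:E).
  by apply/measurable_EFinP/measurable_funTS; exact: measurable_Gamma_integrand.
have -> : `]0%R, +oo[%classic = `]0%R, 1%R] `|` `]1%R, +oo[%classic :> set R.
  apply/seteqP; split => t /=; rewrite !in_itv/= !andbT.
    by move=> t0; case: (leP t 1) => h; [left|right]; rewrite ?t0.
  by case=> [/andP[]//|]; exact: lt_trans.
rewrite ge0_integral_setU//; last 3 first.
- exact: mf.
- by move=> t _; rewrite lee_fin Gamma_integrand_ge0.
- rewrite disj_set2E; apply/eqP/seteqP; split => // t /= [].
  rewrite !in_itv/= andbT => /andP[_ h] h'.
  by have := le_lt_trans h h'; rewrite ltxx.
apply: lte_add_pinfty.
  apply: (@le_lt_trans _ _ (\int[mu]_(t in `]0%R, 1%R]) (t `^ (z - 1))%:E)%E).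
    apply: ge0_le_integral => //.
    - by move=> t _; rewrite lee_fin Gamma_integrand_ge0.
    - exact: mf.
    - exact: measurable_EFin_powR.
    - move=> t /=; rewrite in_itv/= => /andP[t0 _].
      rewrite lee_fin /Gamma_integrand ler_piMr ?powR_ge0//.
      by rewrite expR_le1 oppr_le0 ltW.
  by rewrite integral_powR_0// ltry.
(* As [N >= z], the bound [expR t >= t^(N+1) / (N+1)!] dominates the integrand on [[1, +oo[] by
   [(N+1)! t^(-2)]. *)
pose N := Num.bound z.
have zN : z <= N%:R by apply/ltW/archi_boundP/ltW.
apply: (@le_lt_trans _ _ (\int[mu]_(t in `[1%R, +oo[) ((N.+1)`!%:R%:E * (t `^ (- 1 - 1))%:E))%E).
  apply: (@le_trans _ _ (\int[mu]_(t in `[1%R, +oo[) (Gamma_integrand z t)%:E)%E).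
    apply: ge0_subset_integral => //; first exact: mf.
      by move=> t _; rewrite lee_fin Gamma_integrand_ge0.
    by move=> t /=; rewrite !in_itv/= !andbT => /ltW.
  apply: ge0_le_integral => //.
  - by move=> t _; rewrite lee_fin Gamma_integrand_ge0.
  - exact: mf.
  - apply: emeasurable_funM => //.
    exact: measurable_EFin_powR.
  - move=> t /=; rewrite in_itv/= andbT => t1.
    have t0 : 0 < t by exact: lt_le_trans t1.
    rewrite -EFinM lee_fin /Gamma_integrand expRN ler_pdivrMr ?expR_gt0//.
    have -> : t `^ (z - 1) = t `^ (z + 1) * t `^ (- 1 - 1).
      rewrite -powRD; first by congr (_ `^ _); ring.
      by rewrite (gt_eqF t0) implybT.
    rewrite mulrAC ler_wpM2r ?powR_ge0//.
    apply: (@le_trans _ _ (t ^+ N.+1)).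
      rewrite -powR_mulrn ?(ltW t0)//; apply: ler_powR => //.
      by rewrite -natr1 lerD2r.
    have := expR_ge1Dxn N (ltW t0).
    rewrite -ler_pdivrMl ?ltr0n ?fact_gt0// mulrC; apply: le_trans.
    by rewrite lerDr.
rewrite ge0_integralZl//; last 2 first.
- exact: measurable_EFin_powR.
- by move=> t _; rewrite lee_fin powR_ge0.
by rewrite integral_powR_pinfty// lte_mul_pinfty// ltry.
Qed.

Lemma GammaE z : 0 < z ->
  (\int[mu]_(t in `]0%R, +oo[) (Gamma_integrand z t)%:E = (Gamma z)%:E)%E.
Proof.
move=> z0; rewrite /Gamma /Rintegral fineK//.
rewrite ge0_fin_numE; first exact: Gamma_integral_fin.
by apply: integral_ge0 => t _; rewrite lee_fin Gamma_integrand_ge0.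
Qed.

Lemma Gamma_ge0 z : 0 <= Gamma z.
Proof.
apply: Rintegral_ge0 => t _; exact: Gamma_integrand_ge0.
Qed.

(** Tonelli takes the place of integration by parts: [t^z] is the integral of [z r^(z-1)] over
    [0 < r <= t], and [expR (- t)] is integrated over [t >= r] first. *)
Lemma GammaD1 z : 0 < z -> Gamma (z + 1) = z * Gamma z.
Proof.
move=> z0; have z10 : 0 < z + 1 by rewrite addr_gt0.
apply: EFin_inj; rewrite EFinM -!GammaE//.
pose P (p : measurableTypeR R * measurableTypeR R) : bool := (0 < p.2) && (p.2 <= p.1).
pose h (p : measurableTypeR R * measurableTypeR R) : \bar R :=
  if P p then (expR (- p.1) * (z * p.2 `^ (z - 1)))%:E else 0%E.
have m1 : measurable_fun setT (fun p : measurableTypeR R * measurableTypeR R => p.1 : R).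
  exact: measurable_fst.
have m2 : measurable_fun setT (fun p : measurableTypeR R * measurableTypeR R => p.2 : R).
  exact: measurable_snd.
have mh : measurable_fun setT h.
  apply: measurable_fun_ifT => //.
    by apply: measurable_and; [exact: measurable_fun_ltr|exact: measurable_fun_ler].
  apply/measurable_EFinP; apply: measurable_funM.
    by apply: (measurableT_comp measurable_expRN).
  by apply: measurable_funM => //; exact: measurable_powRl.
have h0 p : (0 <= h p)%E.
  by rewrite /h; case: ifP => // _; rewrite lee_fin !mulr_ge0 ?expR_ge0 ?powR_ge0 ?ltW.
have := @fubini_tonelli _ _ _ _ _ mu mu h mh h0.
have -> : (\int[mu]_t \int[mu]_r h (t, r) = \int[mu]_(t in `]0%R, +oo[) (Gamma_integrand (z + 1) t)%:E)%E.
  rewrite [RHS]integral_mkcond; apply: eq_integral => t _.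
  rewrite patchE mem_setE in_itv/= andbT /h /P /=.
  rewrite (@integral_if _ (measurableTypeR R) R mu (fun r : R => (0 < r) && (r <= t))).
  case: ifPn => [t0|]; last first.
    rewrite -leNgt => t0; rewrite (_ : [set _ | _] = set0) ?integral_set0//.
    apply/seteqP; split => r //= /andP[r0 rt].
    by have := lt_le_trans r0 (le_trans rt t0); rewrite ltxx.
  have -> : [set x | 0 < x <= t] = `]0, t]%classic by apply/seteqP; split => r; rewrite /= in_itv.
  under eq_integral do rewrite mulrA EFinM.
  rewrite ge0_integralZl//; last 3 first.
  - exact: measurable_EFin_powR.
  - by move=> r _; rewrite lee_fin powR_ge0.
  - by rewrite lee_fin mulr_ge0 ?expR_ge0// ltW.
  rewrite integral_powR_0// -EFinM /Gamma_integrand addrK; congr EFin.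
  by field; rewrite gt_eqF.
move=> ->.
rewrite -ge0_integralZl//; last 3 first.
- by apply/measurable_EFinP/measurable_funTS; exact: measurable_Gamma_integrand.
- by move=> r _; rewrite lee_fin Gamma_integrand_ge0.
- by rewrite lee_fin ltW.
rewrite [RHS]integral_mkcond; apply: eq_integral => r _.
rewrite patchE mem_setE in_itv/= andbT /h /P /=.
rewrite (@integral_if _ (measurableTypeR R) R mu (fun t : R => (0 < r) && (r <= t))).
case: ifPn => r0; last first.
  rewrite (_ : [set _ | _] = set0) ?integral_set0//.
  by apply/seteqP; split => t //=; rewrite ?(negbTE r0).
rewrite (_ : [set _ | _] = `[r, +oo[%classic); last first.
  by apply/seteqP; split => t; rewrite /= in_itv/= andbT ?r0.
under eq_integral do rewrite EFinM.
rewrite ge0_integralZr//; last 2 first.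
- by apply/measurable_EFinP/measurable_funTS; exact: measurable_expRN.
- by rewrite lee_fin mulr_ge0 ?powR_ge0// ltW.
rewrite integral_expRN_pinfty -!EFinM /Gamma_integrand; congr EFin; ring.
Qed.

Lemma Gamma1 : Gamma (1 : R) = 1.
Proof.
apply: EFin_inj; rewrite -GammaE//.
rewrite /Gamma_integrand subrr.
under eq_integral do rewrite powRr0 mul1r.
rewrite (@integral_itv_obnd_cbnd R).
  by rewrite integral_expRN_pinfty oppr0 expR0.
by apply/measurable_EFinP/measurable_funTS; exact: measurable_expRN.
Qed.

Lemma continuous_Gamma z : 0 < z -> {for z, continuous Gamma}.
Proof.
move=> z0.
have int_G a : 0 < a -> mu.-integrable `]0, +oo[%classic (EFin \o Gamma_integrand a).
  move=> a0; apply/integrableP; split.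
    by apply/measurable_EFinP/measurable_funTS; exact: measurable_Gamma_integrand.
  under eq_integral do rewrite /= ger0_norm ?Gamma_integrand_ge0//.
  exact: Gamma_integral_fin.
have zz (a : R) : z / 2 < a -> 0 < a by apply: lt_trans; rewrite divr_gt0.
have zI : `]z / 2, 2 * z[%classic z by rewrite /= in_itv/=; apply/andP; split; lra.
have I1 (a : R) : `]z / 2, 2 * z[%classic a ->
    mu.-integrable `]0, +oo[%classic (EFin \o Gamma_integrand a).
  by rewrite /= in_itv/= => /andP[/zz a0 _]; exact: int_G.
have I2 : {ae mu, forall t, `]0, +oo[%classic t ->
    {in (`]z / 2, 2 * z[%classic : set R), continuous (Gamma_integrand ^~ t)}}.
  apply/aeW => t; rewrite /= in_itv/= andbT => t0 a _.
  apply: cvgMr_tmp.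
  have -> : (fun a => t `^ (a - 1)) = (fun a => expR ((a - 1) * ln t)).
    by apply/funext => b; rewrite /powR gt_eqF.
  rewrite [X in _ --> X](_ : _ = expR ((a - 1) * ln t)); last by rewrite /powR gt_eqF.
  have c : continuous (fun b : R => expR ((b - 1) * ln t)).
    move=> b; apply: (@continuous_comp R R R (fun a : R => (a - 1) * ln t) (@expR R));
      last exact: continuous_expR.
    apply: cvgMr_tmp.
    by apply: (@cvgB _ _ _ (nbhs b) _ id (cst 1)); [exact: cvg_id|exact: cvg_cst].
  exact: c.
(* The power [t^(a-1)] is monotone in [a], increasing for [t >= 1] and decreasing for [t < 1], so
   the integrands at the two end points together dominate those in between. *)
pose g t := Gamma_integrand (z / 2) t + Gamma_integrand (2 * z) t.
have I3 : mu.-integrable `]0, +oo[%classic (EFin \o g).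
  rewrite (_ : EFin \o g = (EFin \o Gamma_integrand (z / 2)) \+ (EFin \o Gamma_integrand (2 * z)))%E.
    by apply: integrableD => //; apply: int_G; rewrite ?divr_gt0 ?mulr_gt0.
  by apply/funext => t /=; rewrite EFinD.
have I4 (a : R) : `]z / 2, 2 * z[%classic a ->
    {ae mu, forall t, `]0, +oo[%classic t -> `|Gamma_integrand a t| <= g t}.
  rewrite /= in_itv/= => /andP[h1 h2]; apply/aeW => t.
  rewrite /= in_itv/= andbT => t0.
  rewrite ger0_norm ?Gamma_integrand_ge0// /g /Gamma_integrand -mulrDl.
  rewrite ler_wpM2r ?expR_ge0//.
  case: (leP 1 t) => t1.
    rewrite -[leLHS]add0r lerD ?powR_ge0//; apply: ler_powR => //.
    by rewrite lerD2r ltW.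
  rewrite -[leLHS]addr0 lerD ?powR_ge0//; apply: ger_powR; rewrite ?t0 ?(ltW t1)//.
  by rewrite lerD2r ltW.
have := @continuity_under_integral R _ _ mu Gamma_integrand `]0, +oo[%classic
  (measurable_itv _) (z / 2) (2 * z) I1 I2 g I3 I4.
by move=> /(_ z); apply; rewrite inE.
Qed.

End Gamma_theory.

(** * Layer-cake formula and the volume of the unit ball *)

Section layer_cake.
Context {R : realType}.
Local Notation mu := (@lebesgue_measure R).

Lemma integral_rV_cons n (f : 'rV[R]_n.+1 -> \bar R) :
  measurable_fun setT f -> (forall y, 0 <= f y)%E ->
  (\int[lebesgue_rV n.+1]_y f y =
   \int[mu]_t \int[lebesgue_rV n]_y f (rV_cons (t, y)))%E.
Proof.
move=> mf f0.
have mc : measurable_fun setT (f \o @rV_cons R n).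
  exact: measurableT_comp (@measurable_rV_cons R n).
rewrite -[RHS]/(\int[mu]_t (fubini_F (lebesgue_rV n) (f \o @rV_cons R n) t))%E.
rewrite -fubini_tonelli1//; last by move=> p /=.
rewrite -[LHS]mul1e; apply/esym.
apply: (@ge0_integral_transport _ _ _ _ _ (mu \x lebesgue_rV n)%E (lebesgue_rV n.+1) (@rV_cons R n) 1 f) => //.
  exact: measurable_rV_cons.
by move=> A mA; rewrite mul1e.
Qed.

Lemma integral_gaussian_rV n :
  (\int[lebesgue_rV n]_y (expR (- edot y y))%:E = (Num.sqrt pi ^+ n)%:E :> \bar R)%E.
Proof.
have me k : measurable_fun setT (fun y : 'rV[R]_k => (expR (- edot y y))%:E).
  apply/measurable_EFinP; apply: (measurableT_comp (@measurable_expRN R)).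
  apply: measurable_sum => j.
  by apply: measurable_funM; exact: measurable_coor.
elim: n => [|n ih].
  rewrite [LHS]integral_dirac//=; last exact: (me 0).
  by rewrite /edot big_ord0 oppr0 expR0 mule1 diracT.
apply: etrans (integral_rV_cons (me n.+1) _) _; first by move=> y; rewrite lee_fin expR_ge0.
have h (t : R) (y : 'rV[R]_n) : (expR (- edot (rV_cons (t, y)) (rV_cons (t, y))))%:E =
    ((gauss_fun t)%:E * (expR (- edot y y))%:E)%E.
  rewrite -EFinM -expRD; congr (expR _)%:E.
  rewrite /edot big_ord_recl rV_cons0 opprD expr2; congr (_ - _).
  by apply: eq_bigr => i _; rewrite rV_consS.
have ih' (t : R) : (\int[lebesgue_rV n]_y (expR (- edot (rV_cons (t, y)) (rV_cons (t, y))))%:E =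
    (gauss_fun t)%:E * (Num.sqrt pi ^+ n)%:E)%E.
  under eq_integral do rewrite h.
  rewrite -ih; apply: ge0_integralZl => //.
  - exact: me.
  - by rewrite lee_fin gauss_fun_ge0.
under eq_integral do rewrite ih'.
rewrite ge0_integralZr//.
- by rewrite integralT_gauss -EFinM exprS.
- by apply/measurable_EFinP; exact: measurable_gauss_fun.
- by move=> t _; rewrite lee_fin gauss_fun_ge0.
Qed.

Section layer.
Context {n : nat} (D : set 'rV[R]_n) (h : 'rV[R]_n -> R) (psi : R -> R).
Hypotheses (mD : measurable D) (mh : measurable_fun setT h).
Hypotheses (mpsi : measurable_fun setT psi) (psi0 : forall t, 0 <= psi t).

Let P (p : 'rV[R]_n * measurableTypeR R) : bool := (p.1 \in D) && (h p.1 <= p.2).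
Let f (k : R -> R) (p : 'rV[R]_n * measurableTypeR R) : \bar R :=
  if P p then (k p.2)%:E else 0%E.

Let mf k : measurable_fun setT k -> measurable_fun setT (f k).
Proof.
move=> mk; have mP : measurable_fun setT P.
  apply: measurable_and; last first.
    apply: measurable_fun_ler; last exact: measurable_snd.
    by apply: (measurableT_comp mh); exact: measurable_fst.
  apply: (@measurable_fun_bool _ _ _ _ true).
  have -> : (fun x => x.1 \in D) @^-1` [set true] = (@fst _ _ @^-1` D : set ('rV[R]_n * measurableTypeR R)).
    by apply/seteqP; split => p /=; [move=> /set_mem|move=> /mem_set].
  by rewrite -[X in _ `&` X]setTI setIA setTI; exact: measurable_fst.
apply: measurable_fun_ifT => //.
by apply/measurable_EFinP; apply: (measurableT_comp mk); exact: measurable_snd.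
Qed.

Let f0 k p : (forall t, 0 <= k t) -> (0 <= f k p)%E.
Proof. by move=> k0; rewrite /f; case: ifP => // _; rewrite lee_fin. Qed.

Let fG k t : (\int[lebesgue_rV n]_y f k (y, t) =
  (k t)%:E * lebesgue_rV n (D `&` [set y | h y <= t]%R))%E.
Proof.
rewrite /f /P /=.
rewrite (@integral_if _ 'rV[R]_n R (lebesgue_rV n) (fun y => (y \in D) && (h y <= t))).
have -> : [set y | (y \in D) && (h y <= t)] = D `&` [set y | h y <= t].
  by apply/seteqP; split => y /=; [move=> /andP[/set_mem]|move=> [/mem_set -> ->]].
by rewrite integral_cst//; apply: measurableI => //; exact: measurable_setle.
Qed.

Let fF k y : (\int[mu]_t f k (y, t) =
  ((fun y => \int[mu]_(t in `[h y, +oo[) (k t)%:E) \_ D) y)%E.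
Proof.
rewrite patchE /f /P /=.
rewrite (@integral_if _ (measurableTypeR R) R mu (fun t : R => (y \in D) && (h y <= t))).
case: ifPn => yD.
  by congr integral; apply/seteqP; split => t; rewrite /= in_itv/= andbT.
rewrite (_ : [set _ | _] = set0) ?integral_set0//.
by apply/seteqP; split.
Qed.

Lemma measurable_layer :
  measurable_fun setT (fun t : measurableTypeR R =>
    lebesgue_rV n (D `&` [set y | h y <= t])).
Proof.
rewrite (_ : (fun t => _) = fubini_G (lebesgue_rV n) (f (cst 1))).
  by apply: measurable_fun_fubini_tonelli_G; [exact: mf|move=> p; exact: f0].
by apply/funext => t; rewrite /fubini_G fG mul1e.
Qed.

Lemma measurable_layer_integral :
  measurable_fun D (fun y => \int[mu]_(t in `[h y, +oo[) (psi t)%:E)%E.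
Proof.
apply/(measurable_restrictT _ mD).
rewrite (_ : _ \_ _ = fubini_F mu (f psi)).
  by apply: measurable_fun_fubini_tonelli_F; [exact: mf|move=> p; exact: f0].
by apply/funext => y; rewrite /fubini_F fF.
Qed.

(** Tonelli on the region [h y <= t]. With [h] a function of the norm it replaces polar coordinates:
    radial integrals become one-dimensional integrals of volumes of balls. *)
Lemma layer_cake :
  (\int[lebesgue_rV n]_(y in D) \int[mu]_(t in `[h y, +oo[) (psi t)%:E =
   \int[mu]_t ((psi t)%:E * lebesgue_rV n (D `&` [set y | h y <= t]%R)))%E.
Proof.
have fub := @fubini_tonelli _ _ _ _ _ (lebesgue_rV n) mu (f psi) (mf mpsi)
  (fun p => f0 p psi0).
rewrite [LHS]integral_mkcond; transitivity (\int[lebesgue_rV n]_x (\int[mu]_y f psi (x, y)))%E.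
  by apply: eq_integral => y _; rewrite fF.
by rewrite fub; apply: eq_integral => t _; rewrite fG.
Qed.

End layer.

(** The dilation by 2 fixes the one-point set [cball 0] and multiplies its finite measure by
    [2^(-n) < 1]. *)
Lemma lebesgue_rV_cball0 n : (0 < n)%N -> lebesgue_rV n (@cball R n 0) = 0%E.
Proof.
move=> n0.
have := @lebesgue_rVZ R n 2 (cball 0) (ltr0Sn _ _) (measurable_cball 0).
have -> : (fun y : 'rV[R]_n => 2 *: y) @^-1` cball 0 = cball 0.
  apply/funext => y; rewrite /cball /= enormZ ger0_norm//; apply/propext.
  by rewrite pmulr_rle0.
have fin : (lebesgue_rV n (@cball R n 0) \is a fin_num).
  rewrite ge0_fin_numE//; apply: le_lt_trans (eball_fin 0 1).
  apply: le_measure; rewrite ?inE; [exact: measurable_cball|exact: measurable_eball|].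
  by move=> y; rewrite /cball /eball /= subr0 => /le_lt_trans; apply.
rewrite -(fineK fin) -EFinM => -[] /eqP.
rewrite -subr_eq0 -{1}[fine _]mul1r -mulrBl mulf_eq0 => /orP[|/eqP -> //].
rewrite subr_eq0 => /eqP h; have : (2^-1 : R) ^+ n < 1.
  by rewrite exprn_ilt1// ?invr_ge0// -?lt0n// invf_lt1// ltr1n.
by rewrite -h ltxx.
Qed.

(** Both sides are the Gaussian integral: [expR (- |y|^2)] is the integral of [expR (- t)] over
    [t >= |y|^2], and the ball of radius [sqrt t] has volume [t^(n/2) |B|]. *)
Lemma Gamma_vball n : (0 < n)%N ->
  vball n * Gamma (n%:R / 2 + 1) = (pi : R) `^ (n%:R / 2).
Proof.
move=> n0; apply: EFin_inj.
have -> : (pi : R) `^ (n%:R / 2) = Num.sqrt pi ^+ n.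
  by rewrite mulrC powRrM powR12_sqrt ?pi_ge0// powR_mulrn// sqrtr_ge0.
rewrite -integral_gaussian_rV EFinM -GammaE; last by rewrite ltr_wpDl// divr_ge0.
transitivity (\int[lebesgue_rV n]_(y in setT) \int[mu]_(t in `[(enorm y ^+ 2)%R, +oo[) (expR (- t))%:E)%E; last first.
  by apply: eq_integral => y _; rewrite integral_expRN_pinfty enorm_sqr.
rewrite layer_cake//; last 2 first.
- by apply: measurable_funX; exact: measurable_enorm.
- exact: measurable_expRN.
rewrite -ge0_integralZl//; last 3 first.
- by apply: measurable_funTS; apply/measurable_EFinP; exact: measurable_Gamma_integrand.
- by move=> t _; rewrite lee_fin Gamma_integrand_ge0.
- by rewrite lee_fin ltW// vball_gt0.
rewrite [LHS]integral_mkcond; apply: eq_integral => t _.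
rewrite patchE mem_setE in_itv/= andbT setTI /Gamma_integrand addrK.
case: ltP => t0; last first.
  rewrite [X in (_ * X)%E](_ : _ = 0%E) ?mule0//.
  apply/eqP; rewrite eq_le measure_ge0 andbT -(lebesgue_rV_cball0 n0).
  apply: le_measure; rewrite ?inE.
  - by apply: measurable_setle => //; apply: measurable_funX; exact: measurable_enorm.
  - exact: measurable_cball.
  - move=> y /= /le_trans /(_ t0) h; rewrite /cball /=.
    by rewrite -(@ler_pXn2r _ 2)// ?nnegrE ?enorm_ge0// expr0n.
have -> : [set y : 'rV[R]_n | enorm y ^+ 2 <= t] = cball (Num.sqrt t).
  apply/seteqP; split => y /=; rewrite /cball /=.
    by move=> h; rewrite -[enorm y]ger0_norm ?enorm_ge0// -sqrtr_sqr ler_sqrt// ltW.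
  by move=> h; rewrite -(sqr_sqrtr (ltW t0)) lerXn2r ?nnegrE ?enorm_ge0 ?sqrtr_ge0.
rewrite [X in _ = (_ * X)%E]lebesgue_rV_cball ?sqrtr_gt0// -!EFinM; congr EFin.
have -> : t `^ (n%:R / 2) = Num.sqrt t ^+ n.
  by rewrite mulrC powRrM powR12_sqrt ?(ltW t0)// powR_mulrn// sqrtr_ge0.
ring.
Qed.

End layer_cake.

(** * Integrals of powers of the Euclidean norm *)

Section enorm_power_integrals.
Context {R : realType} (n : nat).
Hypothesis n0 : (0 < n)%N.
Local Notation mu := (@lebesgue_measure R).
Local Notation leb := (@lebesgue_rV R n).
Let n0R : 0 < n%:R :> R. Proof. by rewrite ltr0n. Qed.

Lemma measurable_cpowR k p D : measurable_fun D (fun t : measurableTypeR R => (k * t `^ p)%:E).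
Proof.
apply: measurable_funTS; apply/measurable_EFinP.
by apply: measurable_funM => //; exact: measurable_powR.
Qed.

Lemma integral_cpowR_pinfty k a c : 0 <= k -> 0 < a -> 0 < c ->
  (\int[mu]_(t in `[c, +oo[) (k * t `^ (- a - 1))%:E = (k * (c `^ (- a) / a))%:E)%E.
Proof.
move=> k0 a0 c0; under eq_integral do rewrite EFinM.
rewrite ge0_integralZl//; last 2 first.
- exact: measurable_EFin_powR.
- by move=> t _; rewrite lee_fin powR_ge0.
by rewrite integral_powR_pinfty// EFinM.
Qed.

Lemma integral_cpowR_0 k b c : 0 <= k -> 0 < b -> 0 < c ->
  (\int[mu]_(t in `]0%R, c]) (k * t `^ (b - 1))%:E = (k * (c `^ b / b))%:E)%E.
Proof.
move=> k0 b0 c0; under eq_integral do rewrite EFinM.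
rewrite ge0_integralZl//; last 2 first.
- exact: measurable_EFin_powR.
- by move=> t _; rewrite lee_fin powR_ge0.
by rewrite integral_powR_0// EFinM.
Qed.

Lemma integral_enorm_powR_out p : n%:R < p ->
  (\int[leb]_(y in ~` eball 0 1) (enorm y `^ (- p))%:E =
   (vball n * (n%:R / (p - n%:R)))%:E)%E.
Proof.
move=> np; have p0 : 0 < p by exact: lt_trans np.
have pn0 : 0 < p - n%:R by rewrite subr_gt0.
have mD : measurable (~` (eball 0 1 : set 'rV[R]_n)).
  by apply: measurableC; exact: measurable_eball.
pose psi (t : R) := p * t `^ (- p - 1).
have psi0 t : 0 <= psi t by rewrite mulr_ge0 ?powR_ge0// ltW.
have -> : (\int[leb]_(y in ~` eball 0 1) (enorm y `^ (- p))%:E =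
    \int[leb]_(y in ~` eball 0 1) \int[mu]_(t in `[enorm y, +oo[) (psi t)%:E)%E.
  apply: eq_integral => y; rewrite inE /eball /= subr0 => /negP; rewrite -leNgt => y1.
  rewrite integral_cpowR_pinfty ?(ltW p0)//; last exact: lt_le_trans y1.
  by rewrite mulrCA mulfV ?gt_eqF// mulr1.
rewrite layer_cake//; last 2 first.
- exact: measurable_enorm.
- by apply: measurable_funM => //; exact: measurable_powR.
pose m t := leb (~` eball 0 1 `&` [set y | enorm y <= t]).
have -> : (\int[mu]_t ((psi t)%:E * m t) = \int[mu]_(t in `[1%R, +oo[) ((psi t)%:E * m t))%E.
  rewrite [RHS]integral_mkcond; apply: eq_integral => t _.
  rewrite patchE mem_setE in_itv/= andbT; case: leP => // t1.
  rewrite /m (_ : _ `&` _ = set0) ?measure0 ?mule0//.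
  apply/seteqP; split => y //= []; rewrite /eball /= subr0 => /negP; rewrite -leNgt.
  by move=> y1 yt; have := le_lt_trans (le_trans y1 yt) t1; rewrite ltxx.
have mm : measurable_fun setT m.
  by apply: measurable_layer => //; exact: measurable_enorm.
(* The shell [1 <= |y| <= t] has volume [(t^n - 1) |B|]. Since [psi] has integral 1 over [[1, +oo[],
   adding [|B|] on the left completes the shell to a full ball, and every integrand stays
   nonnegative. *)
have E : (\int[mu]_(t in `[1%R, +oo[) ((psi t)%:E * m t) + (vball n)%:E =
    (p * (vball n / (p - n%:R)))%:E)%E.
  rewrite [X in (_ + X)%E](_ : _ = \int[mu]_(t in `[1%R, +oo[) (p * vball n * t `^ (- p - 1))%:E)%E; last first.
    rewrite integral_cpowR_pinfty// ?powR1; last by rewrite mulr_ge0 ?ltW ?vball_gt0.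
    by congr EFin; field; rewrite gt_eqF.
  rewrite -ge0_integralD//; last 4 first.
  - by move=> t _; rewrite mule_ge0// lee_fin.
  - apply: emeasurable_funM; first exact: measurable_cpowR.
    exact: measurable_funTS.
  - by move=> t _; rewrite lee_fin !mulr_ge0 ?powR_ge0 ?ltW ?vball_gt0.
  - exact: measurable_cpowR.
  rewrite (_ : (p * _)%:E = (p * vball n * (1 `^ (- (p - n%:R)) / (p - n%:R)))%:E); last first.
    by rewrite powR1; congr EFin; rewrite mul1r mulrA.
  rewrite -integral_cpowR_pinfty//; last by rewrite mulr_ge0 ?ltW ?vball_gt0.
  apply: eq_integral => t; rewrite inE/= in_itv/= andbT => t1.
  have t0 : 0 < t by exact: lt_le_trans t1.
  have -> : (p * vball n * t `^ (- p - 1))%:E = ((psi t)%:E * leb (eball 0 1))%E.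
    by rewrite vballE -EFinM /psi mulrAC.
  rewrite -ge0_muleDr ?measure_ge0//.
  have -> : (m t + leb (eball 0 1) = (t ^+ n * vball n)%:E)%E.
    rewrite -lebesgue_rV_cball// /m -measureU//.
    - congr (leb _); apply/seteqP; split => y.
        rewrite /eball /cball /= subr0; case=> [[]//|/ltW y1]; exact: le_trans t1.
      rewrite /eball /cball /= subr0 => yt.
      by have [y1|y1] := ltP (enorm y) 1; [right|left; split => //; rewrite ltNge y1].
    - by apply: measurableI => //; exact: measurable_cball.
    - exact: measurable_eball.
    - by apply/seteqP; split => y // [] [].
  rewrite -EFinM /psi; congr EFin.
  rewrite -(powR_mulrn _ (ltW t0)).
  have -> : - (p - n%:R) - 1 = (- p - 1) + n%:R by ring.
  rewrite [t `^ (_ + n%:R)]powRD; last by rewrite (gt_eqF t0) implybT.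
  ring.
rewrite -[LHS](addeK _ (isT : (vball n)%:E \is a fin_num)) E -EFinB.
by congr EFin; field; rewrite gt_eqF.
Qed.

Lemma integral_enorm_powR_in q r : 0 < q -> q < n%:R -> 0 < r ->
  (\int[leb]_(y in eball 0 r) (enorm y `^ (- q))%:E <=
   (r `^ (n%:R - q) * (vball n * (q / (n%:R - q) + 1)))%:E)%E.
Proof.
move=> q0 qn r0.
have qn0 : 0 < n%:R - q by rewrite subr_gt0.
pose psi (t : R) := q * t `^ (- q - 1).
have psi0 t : 0 <= psi t by rewrite mulr_ge0 ?powR_ge0// ltW.
have mD : measurable (eball 0 r : set 'rV[R]_n) by exact: measurable_eball.
apply: (@le_trans _ _ (\int[leb]_(y in eball 0 r) \int[mu]_(t in `[enorm y, +oo[) (psi t)%:E)%E).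
  apply: ge0_le_integral => //.
  - by move=> y _; rewrite lee_fin powR_ge0.
  - apply: measurable_funTS; apply/measurable_EFinP.
    by apply: measurable_powRl; exact: measurable_enorm.
  - apply: measurable_layer_integral => //; first exact: measurable_enorm.
    by apply: measurable_funM => //; exact: measurable_powR.
  - move=> y _; have [->|y0] := eqVneq y 0.
      rewrite enorm0 powR0 ?oppr_eq0 ?gt_eqF//.
      by apply: integral_ge0 => t _; rewrite lee_fin.
    rewrite integral_cpowR_pinfty ?(ltW q0) ?enorm_gt0//.
    by rewrite mulrCA mulfV ?gt_eqF// mulr1.
rewrite layer_cake//; last 2 first.
- exact: measurable_enorm.
- by apply: measurable_funM => //; exact: measurable_powR.
(* The set in the layer at [t] has volume at most [|B| min(t, r)^n]; [g1] uses [t^n] up to [r], and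
   [g2] uses [r^n] from [r] on. *)
pose g1 t : \bar R := (q * vball n * t `^ (n%:R - q - 1))%:E.
pose g2 t : \bar R := (q * (r ^+ n * vball n) * t `^ (- q - 1))%:E.
have g10 t : (0 <= g1 t)%E by rewrite lee_fin !mulr_ge0 ?powR_ge0 ?ltW ?vball_gt0.
have g20 t : (0 <= g2 t)%E by rewrite lee_fin !mulr_ge0 ?exprn_ge0 ?powR_ge0 ?ltW ?vball_gt0.
have mg1 D : measurable_fun D g1 by exact: measurable_cpowR.
have mg2 D : measurable_fun D g2 by exact: measurable_cpowR.
pose h t : \bar R := ((g1 \_ `]0%R, r]) t + (g2 \_ `[r, +oo[) t)%E.
have hE : (\int[mu]_t h t = (r `^ (n%:R - q) * (vball n * (q / (n%:R - q) + 1)))%:E)%E.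
  rewrite ge0_integralD//; last 4 first.
  - by move=> t _; apply: erestrict_ge0 => ? _; exact: g10.
  - by apply/(measurable_restrictT _ (measurable_itv _)).
  - by move=> t _; apply: erestrict_ge0 => ? _; exact: g20.
  - by apply/(measurable_restrictT _ (measurable_itv _)).
  rewrite -!integral_mkcond integral_cpowR_0//; last by rewrite mulr_ge0 ?ltW ?vball_gt0.
  rewrite integral_cpowR_pinfty//; last by rewrite !mulr_ge0 ?exprn_ge0 ?ltW ?vball_gt0.
  rewrite -EFinD; congr EFin.
  rewrite -(powR_mulrn _ (ltW r0)) -[n%:R - q]/(n%:R + - q) powRD; last by rewrite (gt_eqF r0) implybT.
  by field; rewrite !gt_eqF.
rewrite -hE; apply: ge0_le_integral => //.
- by move=> t _; rewrite mule_ge0// lee_fin.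
- apply: emeasurable_funM; first exact: measurable_cpowR.
  by apply: measurable_layer => //; exact: measurable_enorm.
- apply: emeasurable_funD; apply/(measurable_restrictT _ (measurable_itv _)) => //.
move=> t _; rewrite /h !patchE !mem_setE !in_itv/= andbT.
have [t0|t0] := ltP 0 t; last first.
  rewrite [r <= t]leNgt (le_lt_trans t0 r0)/= adde0.
  move: t0; rewrite le_eqVlt => /orP[/eqP ->|t0].
    rewrite /psi powR0 ?mulr0 ?mul0e// lt_eqF// -opprD oppr_lt0 addr_gt0//.
  rewrite (_ : _ `&` _ = set0) ?measure0 ?mule0//.
  apply/seteqP; split => y //= [_ yt].
  by have := le_lt_trans (le_trans (enorm_ge0 y) yt) t0; rewrite ltxx.
have b1 : (leb (eball 0 r `&` [set y | (enorm y <= t)%R]) <= (t ^+ n * vball n)%:E)%E.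
  rewrite -lebesgue_rV_cball//; apply: le_measure; rewrite ?inE.
  - by apply: measurableI => //; exact: measurable_cball.
  - exact: measurable_cball.
  - by move=> y [].
have b2 : (leb (eball 0 r `&` [set y | (enorm y <= t)%R]) <= (r ^+ n * vball n)%:E)%E.
  rewrite -(lebesgue_rV_eball 0)//; apply: le_measure; rewrite ?inE//.
  by apply: measurableI => //; exact: measurable_cball.
have [tr|tr] := leP t r; last first.
  rewrite /= (ltW tr) add0e; apply: le_trans (lee_wpmul2l _ b2) _; first by rewrite lee_fin.
  by rewrite -EFinM lee_fin /psi mulrAC.
rewrite /=; apply: (@le_trans _ _ (g1 t)); last first.
  by rewrite leeDl//; case: ifP.
apply: le_trans (lee_wpmul2l _ b1) _; first by rewrite lee_fin.
rewrite -EFinM lee_fin /psi -(powR_mulrn _ (ltW t0)).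
have -> : n%:R - q - 1 = n%:R + (- q - 1) by rewrite addrA.
rewrite [t `^ (n%:R + _)]powRD; last by rewrite (gt_eqF t0) implybT.
by rewrite le_eqVlt; apply/orP; left; apply/eqP; ring.
Qed.

End enorm_power_integrals.

(** * Hausdorff measure *)

Lemma lee_ereal_supD {R : realType} (A B c : \bar R) : (0 <= A -> 0 <= B ->
  (forall a b : R, a%:E < A -> b%:E < B -> a%:E + b%:E <= c) -> A + B <= c)%E.
Proof.
move=> A0 B0 h.
have m1 (X : \bar R) : (0 <= X -> (-1)%:E < X)%E by apply: lt_le_trans; rewrite lte_fin ltrN10.
case: c h => [c| |] h; last 2 first.
- by rewrite leey.
- by have := h _ _ (m1 _ A0) (m1 _ B0).
case: A A0 h => [x| |//] A0 h; last first.
  have := h (c + 2) (-1) (ltry _) (m1 _ B0); rewrite -EFinD lee_fin => hh; exfalso; move: hh; clear; lra.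
case: B B0 h => [y| |//] B0 h; last first.
  have := h (-1) (c + 2) (m1 _ A0) (ltry _); rewrite -EFinD lee_fin => hh; exfalso; move: hh; clear; lra.
rewrite -EFinD lee_fin; apply/ler_addgt0Pr => e e0.
have := h (x - e / 2) (y - e / 2); rewrite -EFinD !lte_fin lee_fin.
have e2 : 0 < e / 2 by rewrite divr_gt0.
by rewrite !ltrBlDr !ltrDl e2 => /(_ isT isT); clear; lra.
Qed.

Section hausdorff_outer.
Context {R : realType} (d n : nat).
Implicit Types (U E F X : set 'rV[R]_n).

Lemma ediam_ge0 U : U !=set0 -> (0 <= ediam U)%E.
Proof.
move=> [x Ux]; apply: ereal_sup_ubound; exists x, x; split => //.
by rewrite subrr enorm0.
Qed.

Lemma ediam_ub U x y : U x -> U y -> ((enorm (x - y))%:E <= ediam U)%E.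
Proof. by move=> Ux Uy; apply: ereal_sup_ubound; exists x, y. Qed.

Lemma ediam_le U (r : \bar R) :
  (forall x y, U x -> U y -> ((enorm (x - y))%:E <= r)%E) -> (ediam U <= r)%E.
Proof. by move=> h; apply: ge_ereal_sup => _ [x [y [Ux Uy ->]]]; exact: h. Qed.

Lemma ediam_subset E F : E `<=` F -> (ediam E <= ediam F)%E.
Proof. by move=> EF; apply: ediam_le => x y /EF Fx /EF Fy; exact: ediam_ub. Qed.

Lemma gauge0 : gauge d (set0 : set 'rV[R]_n) = 0%E.
Proof. by rewrite /gauge eqxx. Qed.

Lemma gauge_ge0 U : (0 <= gauge d U)%E.
Proof.
rewrite /gauge; case: ifPn => // /set0P U0.
exact/expe_ge0/ediam_ge0.
Qed.

Lemma lee_expe (x y : \bar R) k : (0 <= x)%E -> (x <= y)%E -> (x ^+ k <= y ^+ k)%E.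
Proof.
move=> x0 xy; elim: k => // k ih; rewrite !expeS.
by apply: lee_pmul => //; exact: expe_ge0.
Qed.

Lemma gauge_subset E F : E `<=` F -> (gauge d E <= gauge d F)%E.
Proof.
move=> EF; rewrite {1}/gauge; case: ifPn => [_|E0]; first exact: gauge_ge0.
have F0 : F != set0.
  by apply: contraNneq E0 => F0; apply/eqP; rewrite -subset0 -F0.
rewrite /gauge (negbTE F0); apply: lee_expe; last exact: ediam_subset.
exact/ediam_ge0/set0P.
Qed.

(** [mu_ext] takes covers by measurable sets; for the sigma-algebra generated by all sets these are
    arbitrary covers, as in [hausdorff_delta]. *)
Local Notation disc := (g_sigma_algebraType [set: set 'rV[R]_n]).

(** The mesh condition is moved from the cover into the weight: an oversized piece costs [+oo]. In
    this form [hausdorff_delta] is the outer measure generated by a set function. *)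
Definition gauge_delta (delta : R) U : \bar R :=
  if (ediam U <= delta%:E)%E then gauge d U else +oo%E.

Lemma gauge_delta_ge0 delta U : (0 <= gauge_delta delta U)%E.
Proof. by rewrite /gauge_delta; case: ifP => // _; exact: gauge_ge0. Qed.

Lemma ediam0 : ediam (set0 : set 'rV[R]_n) = -oo%E.
Proof.
apply/eqP; rewrite -leeNy_eq; apply: ediam_le => x y [].
Qed.

Lemma gauge_delta0 delta : gauge_delta delta set0 = 0%E.
Proof. by rewrite /gauge_delta ediam0 leNye gauge0. Qed.

Lemma hausdorff_deltaE delta E :
  hausdorff_delta d delta E = mu_ext (gauge_delta delta : set disc -> \bar R) E.
Proof.
apply/eqP; rewrite eq_le; apply/andP; split.
  apply: le_ereal_inf_tmp => _ [U [_ EU] <-].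
  have [h|/existsNP[k /negP hk]] := pselect (forall k, (ediam (U k) <= delta%:E)%E).
    apply: ereal_inf_lbound; exists U => //=.
    apply: congr_lim; apply/funext => m; apply: eq_bigr => k _.
    by rewrite /gauge_delta h.
  rewrite (@nneseries_pinfty _ _ _ k) ?leey//.
    by move=> m _; exact: gauge_delta_ge0.
  by rewrite /gauge_delta (negbTE hk).
apply: le_ereal_inf_tmp => _ [U [EU h] <-].
apply: ereal_inf_lbound; exists U => /=.
  by split => // k; exact: sub_sigma_algebra.
apply: congr_lim; apply/funext => m; apply: eq_bigr => k _.
by rewrite /gauge_delta h.
Qed.

Lemma hausdorff_delta_ge0 delta E : (0 <= hausdorff_delta d delta E)%E.
Proof. by rewrite hausdorff_deltaE; exact/mu_ext_ge0/gauge_delta_ge0. Qed.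

Lemma hausdorff_delta_le delta E (U : (set 'rV[R]_n)^nat) :
  E `<=` \bigcup_k U k -> (forall k, (ediam (U k) <= delta%:E)%E) ->
  (hausdorff_delta d delta E <= \sum_(0 <= k <oo) gauge d (U k))%E.
Proof. by move=> EU h; apply: ereal_inf_lbound; exists U. Qed.

Lemma hausdorff_delta_anti E (a b : R) : a <= b ->
  (hausdorff_delta d b E <= hausdorff_delta d a E)%E.
Proof.
move=> ab; apply: ereal_inf_le_tmp => _ [U [EU h] <-]; exists U => //; split => //.
by move=> k; apply: le_trans (h k) _; rewrite lee_fin.
Qed.

Local Notation H := (@hausdorff_unnormalized R d n).

Lemma hausdorff_delta_le_sup delta E : 0 < delta -> (hausdorff_delta d delta E <= H E)%E.
Proof. by move=> d0; apply: ereal_sup_ubound; exists delta. Qed.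

Lemma hausdorff_le E (c : \bar R) : (forall delta : R, (0 < delta)%R -> hausdorff_delta d delta E <= c)%E ->
  (H E <= c)%E.
Proof. by move=> h; apply: ge_ereal_sup => _ [delta d0 <-]; exact: h. Qed.

Let H_ge0 E : (0 <= H E)%E.
Proof.
by apply: le_trans (hausdorff_delta_le_sup E ltr01); exact: hausdorff_delta_ge0.
Qed.

Let H0 : H set0 = 0%E.
Proof.
apply/eqP; rewrite eq_le H_ge0 andbT; apply: hausdorff_le => delta d0.
rewrite hausdorff_deltaE mu_ext0//; first exact: gauge_delta0.
exact: gauge_delta_ge0.
Qed.

Let H_mono : {homo H : A B / A `<=` B >-> (A <= B)%E}.
Proof.
move=> A B AB; apply: hausdorff_le => delta d0.
apply: le_trans (hausdorff_delta_le_sup B d0).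
by rewrite !hausdorff_deltaE; exact: le_mu_ext.
Qed.

Let H_sub : sigma_subadditive H.
Proof.
move=> F; apply: hausdorff_le => delta d0.
rewrite hausdorff_deltaE; apply: le_trans (mu_ext_sigma_subadditive _ _) _.
  exact: gauge_delta_ge0.
apply: lee_nneseries => [k _ _|k _]; first exact/mu_ext_ge0/gauge_delta_ge0.
by rewrite -hausdorff_deltaE; exact: hausdorff_delta_le_sup.
Qed.

HB.instance Definition _ := isOuterMeasure.Build R 'rV[R]_n H H0 H_ge0 H_mono H_sub.

(** A piece of diameter at most [delta < eta] cannot meet both sets, so each piece of a cover of the
    union is charged only once. *)
Lemma hausdorff_delta_separated delta eta E F : delta < eta ->
  (forall x y, E x -> F y -> eta <= enorm (x - y)) ->
  (hausdorff_delta d delta E + hausdorff_delta d delta F <= hausdorff_delta d delta (E `|` F))%E.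
Proof.
move=> de EF; apply: le_ereal_inf_tmp => _ [U [EFU h] <-].
apply: (@le_trans _ _ (\sum_(0 <= k <oo) (gauge d (U k `&` E) + gauge d (U k `&` F)))%E).
  rewrite nneseriesD; [|by move=> *; exact: gauge_ge0|by move=> *; exact: gauge_ge0].
  apply: leeD; apply: hausdorff_delta_le.
  - by move=> x Ex; have [|k _ Ukx] := EFU x; [left|exists k].
  - by move=> k; apply: le_trans (h k); apply: ediam_subset => x [].
  - by move=> x Ex; have [|k _ Ukx] := EFU x; [right|exists k].
  - by move=> k; apply: le_trans (h k); apply: ediam_subset => x [].
apply: lee_nneseries => [k _ _|k _]; first by rewrite adde_ge0 ?gauge_ge0.
have [->|/set0P[x [Ux Ex]]] := eqVneq (U k `&` E) set0.
  by rewrite gauge0 add0e; apply: gauge_subset => x [].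
have -> : U k `&` F = set0.
  apply/seteqP; split => y //= [Uy Fy].
  have := le_trans (ediam_ub Ux Uy) (h k).
  by rewrite lee_fin leNgt (lt_le_trans de)// EF.
by rewrite gauge0 adde0; apply: gauge_subset => y [].
Qed.

Lemma hausdorff_separated eta E F : 0 < eta ->
  (forall x y, E x -> F y -> eta <= enorm (x - y)) ->
  (H E + H F <= H (E `|` F))%E.
Proof.
move=> eta0 EF; apply: lee_ereal_supD => // a b /ereal_sup_gt[_ [d1 /= d10 <-] h1].
move=> /ereal_sup_gt[_ [d2 /= d20 <-] h2].
pose del := Num.min (Num.min d1 d2) (eta / 2).
have del0 : 0 < del by rewrite !lt_min d10 d20 divr_gt0.
have del1 : del <= d1 by rewrite !ge_min lexx.
have del2 : del <= d2 by rewrite !ge_min lexx orbT.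
have del3 : del < eta by rewrite gt_min ltr_pdivrMr// ltr_pMr// ltr1n orbT.
apply: (@le_trans _ _ (hausdorff_delta d del E + hausdorff_delta d del F)%E).
  apply: leeD; apply: ltW; first exact: lt_le_trans (hausdorff_delta_anti E del1).
  exact: lt_le_trans (hausdorff_delta_anti F del2).
apply: le_trans (hausdorff_delta_separated del3 EF) _.
exact: hausdorff_delta_le_sup.
Qed.

End hausdorff_outer.

(** * Borel sets are Caratheodory measurable *)

Section hausdorff_borel.
Context {R : realType} (d n : nat).
Local Notation H := (@hausdorff_unnormalized R d n).
Implicit Types (X E F : set 'rV[R]_n).

(* Caratheodory's criterion for the half-space y_i <= a: shells [R_ k] of equal
   parity are at positive distance, so their measures are summable and the tail
   of the series can be neglected. *)
Section halfspace.
Variables (i : 'I_n) (a : R) (X : set 'rV[R]_n).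

Let c (k : nat) : R := a + k.+1%:R^-1.
Let X_ (k : nat) := X `&` [set y | c k <= y ord0 i].
Let R_ (k : nat) := X `&` [set y | c k.+1 <= y ord0 i < c k].

Let cS k : c k.+1 < c k.
Proof. by rewrite ltrD2l ltf_pV2 ?posrE// ltr_nat. Qed.

Let c_le k m : (k <= m)%N -> c m <= c k.
Proof. by move=> km; rewrite lerD2l lef_pV2 ?posrE// ler_nat. Qed.

Let shells b m : (\sum_(0 <= k < m) H (R_ (k.*2 + b).+1) <=
  H (X `&` [set y | c (m.*2 + b)%N <= y ord0 i]%R))%E.
Proof.
elim: m => [|m ih]; first by rewrite big_geq// outer_measure_ge0.
rewrite big_nat_recr//=.
apply: (@le_trans _ _ (H (X `&` [set y | c (m.*2 + b)%N <= y ord0 i]%R) + H (R_ (m.*2 + b).+1))%E).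
  exact: leeD.
have eta0 : 0 < c (m.*2 + b) - c (m.*2 + b).+1 by rewrite subr_gt0.
apply: (le_trans (@hausdorff_separated R d n _ (X `&` [set y | c (m.*2 + b)%N <= y ord0 i]) (R_ (m.*2 + b).+1) eta0 _)).
  move=> x y [_ /= hx] [_ /= /andP[_ hy]].
  apply: le_trans (coor_le_enorm _ i); rewrite !mxE.
  by apply: le_trans (ler_norm _); lra.
apply: le_outer_measure => y /= [[Xy hy]|[Xy /andP[hy _]]]; split => //.
by apply: le_trans hy; apply: c_le; rewrite doubleS !addSn ?leqW.
Qed.

Let shells_fin : (\sum_(0 <= k <oo) H (R_ k.+1) <= H X + H X)%E.
Proof.
have e m : (\sum_(0 <= k < m.*2) H (R_ k.+1) =
    \sum_(0 <= k < m) H (R_ (k.*2 + 0).+1) + \sum_(0 <= k < m) H (R_ (k.*2 + 1).+1))%E.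
  elim: m => [|m ih]; first by rewrite !big_geq// adde0.
  rewrite doubleS !big_nat_recr ?leq0n//= ih addn0 addn1.
  by rewrite -!addeA; congr (_ + _)%E; rewrite addeCA.
apply: lime_le; first by apply: is_cvg_nneseries => k _ _; exact: outer_measure_ge0.
apply: nearW => m.
apply: (@le_trans _ _ (\sum_(0 <= k < m.*2) H (R_ k.+1))%E).
  apply: lee_sum_nneg_natr => //.
    by move=> k _ _; exact: outer_measure_ge0.
  by rewrite -addnn leq_addr.
rewrite e; apply: leeD.
  by apply: le_trans (shells 0 m) _; apply: le_outer_measure => y [].
by apply: le_trans (shells 1 m) _; apply: le_outer_measure => y [].
Qed.

Lemma hausdorff_halfspace :
  (H (X `&` [set y | y ord0 i <= a]%R) + H (X `&` [set y | a < y ord0 i]%R) <= H X)%E.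
Proof.
have [->|Xfin] := eqVneq (H X) +oo%E; first by rewrite leey.
have Xfin' : (H X < +oo)%E by rewrite ltey.
have tail := @nneseries_tail_cvg R (fun k => H (R_ k.+1)) xpredT
  (le_lt_trans shells_fin (lte_add_pinfty Xfin' Xfin')) (fun k _ => outer_measure_ge0 H _).
have step N : (H (X `&` [set y | y ord0 i <= a]%R) + H (X `&` [set y | a < y ord0 i]%R) <=
    H X + \sum_(N <= k <oo) H (R_ k.+1))%E.
  apply: (@le_trans _ _ (H (X `&` [set y | y ord0 i <= a]%R) +
      (H (X_ N.+1) + \sum_(N <= k <oo) H (R_ k.+1)))%E).
    apply: leeD => //.
    apply: le_trans (leeD (lexx _) (outer_measure_sigma_subadditive_tail H N (fun k => R_ k.+1))).
    apply: le_trans (outer_measureU2 H _ _).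
    apply: le_outer_measure => y [Xy /= ay].
    have [h|h] := leP (c N.+1) (y ord0 i); [by left|right].
    have exj : exists j, c j <= y ord0 i.
      exists (Num.bound (y ord0 i - a)^-1); rewrite /c -lerBrDl.
      rewrite -[leRHS]invrK lef_pV2 ?posrE ?invr_gt0 ?subr_gt0//.
      apply: ltW; apply: lt_le_trans (archi_boundP _) _.
        by rewrite invr_ge0 subr_ge0 ltW.
      by rewrite ler_nat.
    case: (ex_minnP exj) => j hj minj.
    have Nj : (N.+1 < j)%N.
      rewrite ltnNge; apply/negP => /c_le hh.
      by have := lt_le_trans h (le_trans hh hj); rewrite ltxx.
    (* By minimality the point lies in the shell [R_] of index [j - 1]. The series runs over
       [R_ k.+1], so [k = j - 2], which is at least [N] because [N + 1 < j]. *)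
    case: j => [|[|j]] in hj minj Nj *; [by []|by []|].
    exists j => /=; first by apply/negP; rewrite -leqNgt -ltnS -ltnS.
    split => //; apply/andP; split => //.
    rewrite ltNge; apply/negP => /minj; by rewrite ltnn.
  rewrite addeA; apply: leeD => //.
  have eta0 : 0 < c N.+1 - a by rewrite subr_gt0 ltrDl invr_gt0.
  apply: (le_trans (@hausdorff_separated R d n _ (X `&` [set y | y ord0 i <= a]) (X_ N.+1) eta0 _)).
    move=> x y [_ /= hx] [_ /= hy]; rewrite enormBC.
    apply: le_trans (coor_le_enorm _ i); rewrite !mxE.
    by apply: le_trans (ler_norm _); lra.
  by apply: le_outer_measure => y /= [[]|[]].
rewrite -[leRHS]adde0.
have lim : (H X + \sum_(N <= k <oo) H (R_ k.+1))%E @[N --> \oo] --> (H X + 0)%E.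
  apply: cvgeD => //; first by rewrite fin_num_adde_defl.
  exact: cvg_cst.
by apply: (cvge_ge _ lim); apply: nearW => N; exact: step.
Qed.

End halfspace.

Let cH := caratheodory_type H.

(** The half-spaces [y_i > a] generate the Borel sets, so Caratheodory's condition for them passes
    to all Borel sets. *)
Let measurable_id_cara : measurable_fun setT (id : cH -> 'rV[R]_n).
Proof.
apply: measurable_fun_rVP => i.
apply: (measurability _ (measurable_realfun.RGenOInfty.measurableE R)) => // _ [_ [a ->] <-].
rewrite setTI; apply: le_caratheodory_measurable => X.
have := hausdorff_halfspace i a X; rewrite addeC; congr (_ + _ <= _)%E; congr (H _).
  by apply/seteqP; split => y [Xy /= h]; split => //=; move: h; rewrite in_itv/= andbT.
apply/seteqP; split => y [Xy /= h]; split => //=; move: h; rewrite in_itv/= andbT leNgt; first by move/negP.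
by move=> /negP.
Qed.

Lemma hausdorff_measurable (A : set 'rV[R]_n) : measurable A ->
  measurable (A : set cH).
Proof. by move=> mA; rewrite -[X in measurable X]setTI; exact: measurable_id_cara. Qed.

Definition hausdorff_borel (A : set 'rV[R]_n) : \bar R := H A.

Let hb0 : hausdorff_borel set0 = 0%E. Proof. exact: outer_measure0. Qed.

Let hb_ge0 A : (0 <= hausdorff_borel A)%E. Proof. exact: outer_measure_ge0. Qed.

Let hb_additive : semi_sigma_additive hausdorff_borel.
Proof.
move=> F mF tF mUF.
apply: (@caratheodory_measure_sigma_additive R 'rV[R]_n H) => //.
  by move=> k; exact: hausdorff_measurable.
exact: hausdorff_measurable.
Qed.

HB.instance Definition _ := isMeasure.Build _ _ _ hausdorff_borel hb0 hb_ge0 hb_additive.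

End hausdorff_borel.

(** * Hausdorff measure under Lipschitz maps and isometries *)

Section hausdorff_lipschitz.
Context {R : realType} (d : nat).
Local Notation H := (hausdorff_unnormalized d).

Lemma muleX (x y : \bar R) k : ((x * y) ^+ k = x ^+ k * y ^+ k)%E.
Proof. by elim: k => [|k ih]; rewrite ?expe0 ?mule1// !expeS ih muleACA. Qed.

Lemma gauge_lipschitz m n (f : 'rV[R]_m -> 'rV[R]_n) (U : set 'rV[R]_m) (L : R) : 0 <= L ->
  (forall x y, U x -> U y -> enorm (f x - f y) <= L * enorm (x - y)) ->
  (gauge d (f @` U) <= (L ^+ d)%:E * gauge d U)%E.
Proof.
move=> L0 fL; have [->|U0] := eqVneq U set0.
  by rewrite image_set0 !gauge0 mule0.
rewrite /gauge (negbTE U0) ifF; last first.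
  by apply/negbTE; move/set0P : U0 => [x Ux]; apply/set0P; exists (f x), x.
rewrite EFin_expe -muleX; apply: lee_expe.
  by apply: ediam_ge0; move/set0P : U0 => [x Ux]; exists (f x), x.
apply: ediam_le => _ _ [x Ux <-] [y Uy <-].
apply: (@le_trans _ _ (L%:E * (enorm (x - y))%:E)%E); first by rewrite lee_fin fL.
by apply: lee_wpmul2l; [rewrite lee_fin|exact: ediam_ub].
Qed.

Lemma ediam_lipschitz m n (f : 'rV[R]_m -> 'rV[R]_n) (U : set 'rV[R]_m) (L : R) : 0 <= L ->
  (forall x y, U x -> U y -> enorm (f x - f y) <= L * enorm (x - y)) ->
  forall delta : R, (ediam U <= delta%:E -> ediam (f @` U) <= (L * delta)%:E)%E.
Proof.
move=> L0 fL delta hd; apply: ediam_le => _ _ [x Ux <-] [y Uy <-].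
rewrite lee_fin; apply: le_trans (fL _ _ Ux Uy) _; apply: ler_wpM2l => //.
by rewrite -lee_fin; apply: le_trans hd; exact: ediam_ub.
Qed.

Lemma hausdorff_lipschitz m n (f : 'rV[R]_m -> 'rV[R]_n) (E : set 'rV[R]_m) (L : R) : 0 < L ->
  (forall x y, E x -> E y -> enorm (f x - f y) <= L * enorm (x - y)) ->
  (H (f @` E) <= (L ^+ d)%:E * H E)%E.
Proof.
move=> L0 fL; apply: hausdorff_le => delta d0.
have Ld0 : 0 < L ^+ d by rewrite exprn_gt0.
apply: (@le_trans _ _ ((L ^+ d)%:E * hausdorff_delta d (delta / L) E)%E); last first.
  apply: lee_wpmul2l; first by rewrite lee_fin ltW.
  by apply: hausdorff_delta_le_sup; rewrite divr_gt0.
rewrite -lee_pdivrMl//; apply: le_ereal_inf_tmp => _ [U [EU hU] <-].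
rewrite lee_pdivrMl// -nneseriesZl; last by move=> *; exact: gauge_ge0.
(* The Lipschitz bound is available on [E] only, so the pieces of the cover are first cut down to
   [E]. *)
have fL' k x y : (U k `&` E) x -> (U k `&` E) y -> enorm (f x - f y) <= L * enorm (x - y).
  by move=> [_ Ex] [_ Ey]; exact: fL.
apply: (@le_trans _ _ (\sum_(0 <= k <oo) gauge d (f @` (U k `&` E)))%E).
  apply: hausdorff_delta_le.
    move=> _ [x Ex <-]; have [k _ Ukx] := EU x Ex.
    by exists k => //; exists x.
  move=> k; rewrite -[delta](@divfK _ L) ?gt_eqF// [_ / _ * _]mulrC.
  apply: (ediam_lipschitz (ltW L0) (fL' k)).
  by apply: le_trans (hU k); apply: ediam_subset => x [].
apply: lee_nneseries => [k _ _|k _]; first exact: gauge_ge0.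
apply: le_trans (gauge_lipschitz (ltW L0) (fL' k)) _.
apply: lee_wpmul2l; first by rewrite lee_fin ltW.
by apply: gauge_subset => x [].
Qed.

Lemma hausdorff_isometry n (f g : 'rV[R]_n -> 'rV[R]_n) (A : set 'rV[R]_n) :
  cancel f g -> cancel g f ->
  (forall x y, enorm (f x - f y) = enorm (x - y)) -> H (f @^-1` A) = H A.
Proof.
move=> fK gK fiso; have giso x y : enorm (g x - g y) = enorm (x - y).
  by rewrite -fiso !gK.
apply/eqP; rewrite eq_le; apply/andP; split.
  have -> : f @^-1` A = g @` A.
    apply/seteqP; split => x /=; first by exists (f x).
    by move=> [y Ay <-]; rewrite gK.
  have := @hausdorff_lipschitz _ _ g A 1 ltr01.
  by rewrite expr1n mul1e; apply => x y _ _; rewrite mul1r giso.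
have {1}-> : A = f @` (f @^-1` A).
  apply/seteqP; split => x /=; last by move=> [y Ay <-].
  by move=> Ax; exists (g x); rewrite /= gK.
have := @hausdorff_lipschitz _ _ f (f @^-1` A) 1 ltr01.
by rewrite expr1n mul1e; apply => x y _ _; rewrite mul1r fiso.
Qed.

End hausdorff_lipschitz.

(** * Hausdorff and Lebesgue measure in full dimension *)

Section hausdorff_lebesgue.
Context {R : realType} (d : nat).
Local Notation H := (@hausdorff_unnormalized R d d).

Lemma gauge_fin_series (U : (set 'rV[R]_d)^nat) (m : nat) (w : R) : 0 <= w ->
  (forall k, (k < m)%N -> (gauge d (U k) <= w%:E)%E) ->
  (forall k, (m <= k)%N -> U k = set0) ->
  (\sum_(0 <= k <oo) gauge d (U k) <= (m%:R * w)%:E)%E.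
Proof.
move=> w0 hU U0; rewrite (nneseries_split 0 m); last by move=> *; exact: gauge_ge0.
rewrite add0n [X in (_ + X)%E](_ : _ = 0%E) ?adde0.
  rewrite big_mkord mulr_natl -[in leRHS](card_ord m) -sumr_const -sumEFin.
  by apply: lee_sum => k _; exact: hU.
apply/eqP; rewrite eq_le nneseries_ge0 ?andbT; last by move=> *; exact: gauge_ge0.
apply: lime_le; first by apply: is_cvg_nneseries => *; exact: gauge_ge0.
apply: nearW => k; rewrite big_nat_cond big1// => j /andP[/andP[mj _] _].
by rewrite U0// gauge0.
Qed.

(** The [(N+1)^d] cubes of side [1/(N+1)] have diameter at most [sqrt d / (N+1)]; the sum of the
    [d]-th powers is bounded independently of [N]. *)
Lemma unit_cube_fin : (H (@unit_cube R d) <= (Num.sqrt d%:R ^+ d)%:E)%E.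
Proof.
apply: hausdorff_le => delta d0.
pose N := (Num.bound (Num.sqrt d%:R / delta)).
have s0 : 0 <= Num.sqrt d%:R :> R by rewrite sqrtr_ge0.
have hN : Num.sqrt d%:R / N.+1%:R <= delta.
  rewrite ler_pdivrMr// -ler_pdivrMl// mulrC; apply/ltW.
  apply: (@lt_le_trans _ _ N%:R); last by rewrite ler_nat.
  by apply: archi_boundP; rewrite divr_ge0// ltW.
pose Q (f : {ffun 'I_d -> 'I_N.+1}) : set 'rV[R]_d :=
  [set y | forall i, (f i)%:R <= N.+1%:R * y ord0 i <= (f i).+1%:R].
pose w : R := Num.sqrt d%:R / N.+1%:R.
have w0 : 0 <= w by rewrite divr_ge0.
have Qd f : (ediam (Q f) <= w%:E)%E.
  apply: ediam_le => x y Qx Qy; rewrite lee_fin.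
  apply: (@le_trans _ _ (Num.sqrt d%:R * N.+1%:R^-1)) => //.
  apply: enorm_le_sup => [|i]; first by rewrite invr_ge0.
  have /andP[h1 h2] := Qx i; have /andP[h3 h4] := Qy i.
  rewrite !mxE -[leLHS](mulKf (lt0r_neq0 (ltr0Sn R N))) ler_piMr ?invr_ge0//.
  rewrite -{1}[N.+1%:R]ger0_norm// -normrM mulrBr ler_norml.
  by move: h2 h4; rewrite -![(f i).+1%:R]natr1 => h2 h4; apply/andP; split; lra.
pose s := enum {ffun 'I_d -> 'I_N.+1}.
pose U k := if (k < size s)%N then Q (nth [ffun=> ord0] s k) else set0.
apply: le_trans (hausdorff_delta_le d (delta := delta) (U := U) _ _) _.
- move=> y hy.
  have ex i : exists k : 'I_N.+1, ((k%:R : R) <= N.+1%:R * y ord0 i <= k.+1%:R).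
    have /andP[y0 y1] := hy i.
    pose t := N.+1%:R * y ord0 i; have t0 : 0 <= t by rewrite mulr_ge0.
    have /andP[tl tu] := truncn_itv t0.
    have [tN|tN] := leqP (Num.truncn t) N.
      by exists (Ordinal (tN : (Num.truncn t < N.+1)%N)) => /=; rewrite tl ltW.
    (* This case is the face [y_i = 1], where truncation gives [N + 1]; it is assigned to the last
       cell. *)
    exists ord_max => /=; apply/andP; split.
      by apply: le_trans tl; rewrite ler_nat ltnW.
    by rewrite -[leRHS]mulr1 ler_pM2l.
  have [f hf] := choice ex.
  exists (index [ffun i => f i] s) => //.
  rewrite /U index_mem mem_enum/= nth_index ?mem_enum// => i.
  by rewrite ffunE.
- move=> k; rewrite /U; case: ifP => _; last by rewrite ediam0 leNye.
  by apply: le_trans (Qd _) _; rewrite lee_fin.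
apply: le_trans (@gauge_fin_series U (size s) (w ^+ d) _ _ _) _.
- by rewrite exprn_ge0.
- move=> k ks; rewrite /U ks.
  rewrite /gauge; case: ifPn => [_|/set0P Q0]; first by rewrite lee_fin exprn_ge0.
  rewrite EFin_expe; apply: lee_expe => //.
  exact: ediam_ge0.
- by move=> k; rewrite /U ltnNge => ->.
rewrite /s -cardE card_ffun !card_ord lee_fin natrX -exprMn /w.
by rewrite mulrCA mulfV ?mulr1// pnatr_eq0.
Qed.

(** A set of diameter [r] fits into a cube of side [2r], so its Lebesgue measure is at most [2^d]
    times its gauge. Covers of a cube of volume 1 therefore have total gauge at least [2^(-d)]. *)
Lemma unit_cube_gt0 : (0 < H (@unit_cube R d))%E.
Proof.
have c0 : 0 < (2 ^+ d : R)^-1 by rewrite invr_gt0 exprn_gt0.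
apply: (@lt_le_trans _ _ ((2 ^+ d : R)^-1)%:E); first by rewrite lte_fin.
apply: le_trans (hausdorff_delta_le_sup d _ (ltr01)).
apply: le_ereal_inf_tmp => _ [U [cU hU] <-].
have /choice[V hV] : forall k, exists Vk : set 'rV[R]_d,
   [/\ measurable Vk, U k `<=` Vk & (lebesgue_rV d Vk <= (2 ^+ d)%:E * gauge d (U k))%E].
  move=> k.
  have [->|/set0P[x Ux]] := eqVneq (U k) set0.
    by exists set0; split => //; rewrite measure0 gauge0 mule0.
  have Uk0 : U k !=set0 by exists x.
  have [r rE] : exists r : R, ediam (U k) = r%:E.
    have := hU k; have := ediam_ge0 Uk0; case: (ediam (U k)) => // r _ _; by exists r.
  have r0 : 0 <= r by rewrite -lee_fin -rE ediam_ge0.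
  pose a : 'rV[R]_d := const_mx r - x.
  exists ((fun y => y + a) @^-1` rV_cube (2 * r)); split.
  - rewrite -[X in measurable X]setTI.
    by apply: (measurable_rV_shift _) => //; exact: measurable_rV_cube.
  - move=> y Uy i; rewrite !mxE.
    have := le_trans (coor_le_enorm (y - x) i) _.
    move=> /(_ r); rewrite !mxE ler_norml => /(_ _)/andP[|].
      by rewrite -lee_fin -rE; exact: ediam_ub.
    by move=> h1 h2; apply/andP; split; lra.
  - rewrite [leLHS]lebesgue_rV_translation; last exact: measurable_rV_cube.
    rewrite [leLHS]lebesgue_rV_cube ?mulr_ge0// /gauge ifF; last exact/negbTE/set0P.
    by rewrite rE -EFin_expe -EFinM exprMn.
rewrite -[leLHS]mule1 -(lebesgue_rV_unit_cube d) lee_pdivrMl ?exprn_gt0//.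
rewrite -nneseriesZl; last by move=> *; exact: gauge_ge0.
apply: (@le_trans _ _ (\sum_(0 <= k <oo) lebesgue_rV d (V k))%E).
  apply: measure_sigma_subadditive.
  - by move=> k; have [] := hV k.
  - exact: measurable_unit_cube.
  - by move=> y /cU[k _ Uky]; exists k => //; have [_ + _] := hV k; apply.
apply: lee_nneseries => [k _ _|k _]; first exact: measure_ge0.
by have [] := hV k.
Qed.

Definition hcube : R := fine (H (@unit_cube R d)).

Lemma hcubeE : H (@unit_cube R d) = hcube%:E.
Proof.
rewrite fineK// ge0_fin_numE; last exact: outer_measure_ge0.
by apply: le_lt_trans unit_cube_fin _; rewrite ltry.
Qed.

Lemma hcube_gt0 : 0 < hcube.
Proof. by rewrite -lte_fin -hcubeE unit_cube_gt0. Qed.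

Lemma hausdorff_rV_box (k : nat) : (H (rV_box k%:R) < +oo)%E.
Proof.
pose f (y : 'rV[R]_d) : 'rV[R]_d := (2 * k%:R + 1) *: y - const_mx k%:R.
have L0 : 0 < 2 * k%:R + 1 :> R by rewrite ltr_wpDl// mulr_ge0.
apply: (@le_lt_trans _ _ (H (f @` @unit_cube R d))).
  apply: le_outer_measure => y hy; exists ((2 * k%:R + 1)^-1 *: (y + const_mx k%:R)).
    move=> i; have := hy i; rewrite ler_norml !mxE => /andP[h1 h2].
    rewrite mulr_ge0 ?invr_ge0 ?(ltW L0)//; last by lra.
    by rewrite ler_pdivrMl// mulr1; lra.
  by rewrite /f scalerA mulfV ?gt_eqF// scale1r addrK.
apply: (@le_lt_trans _ _ (((2 * k%:R + 1) ^+ d)%:E * H (@unit_cube R d))%E).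
  apply: hausdorff_lipschitz => // x y _ _.
  by rewrite /f opprB addrA subrK -scalerBr enormZ ger0_norm// ltW.
by rewrite hcubeE -EFinM ltry.
Qed.

(** Isometry invariance includes translation invariance, so uniqueness of the invariant measure
    applies; the unit cube, of Lebesgue measure 1, fixes the constant. *)
Lemma hausdorff_lebesgue (A : set 'rV[R]_d) : measurable A ->
  H A = (hcube%:E * lebesgue_rV d A)%E.
Proof.
move=> mA.
have shiftB (a x y : 'rV[R]_d) : x + a - (y + a) = x - y by rewrite (addrC y) addrKA.
have [c c0 hc] := @translation_invariant_unique R d (@hausdorff_borel R d d)
  (fun a A _ => @hausdorff_isometry R d d (fun y => y + a) (fun y => y - a) A
    (fun y => addrK a y) (fun y => subrK a y)
    (fun x y => congr1 (@enorm R d) (shiftB a x y)))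
  hausdorff_rV_box.
rewrite [LHS]hc// /hcube -[H _]/(@hausdorff_borel R d d _) hc; last exact: measurable_unit_cube.
by rewrite lebesgue_rV_unit_cube mule1.
Qed.

End hausdorff_lebesgue.

(** * The surface measure of the sphere *)

Section reflection.
Context {R : realType} (n : nat).
Implicit Types (p q v x y : 'rV[R]_n).

(* For v = 0 this is the identity, because 0^-1 = 0. *)
Definition refl v y : 'rV[R]_n := y - (2 * edot y v / edot v v) *: v.

Lemma refl_edot v x y : edot (refl v x) y = edot x (refl v y).
Proof. by rewrite /refl edotBl edotBr edotZl edotZr (edotC v y); ring. Qed.

Lemma reflK v : cancel (refl v) (refl v).
Proof.
move=> y; rewrite /refl edotBl edotZl.
have [v0|v0] := eqVneq (edot v v) 0.
  by rewrite v0 !invr0 !mulr0 !scale0r !subr0.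
rewrite -addrA -opprD -scalerDl [X in X *: v](_ : _ = 0) ?scale0r ?subr0//.
by field.
Qed.

Lemma refl_iso v x y : edot (refl v x) (refl v y) = edot x y.
Proof. by rewrite refl_edot reflK. Qed.

Lemma refl_enorm v x : enorm (refl v x) = enorm x.
Proof. by rewrite !enormE refl_iso. Qed.

Lemma reflB v x y : refl v x - refl v y = refl v (x - y).
Proof.
by rewrite /refl edotBl; apply/rowP => i; rewrite !mxE; ring.
Qed.

Lemma refl_dist v x y : enorm (refl v x - refl v y) = enorm (x - y).
Proof. by rewrite reflB refl_enorm. Qed.

(** When [|p| = |q|], [2 p.(p - q) = |p - q|^2], so exactly [p - q] is subtracted from [p].
    Reflections thus act transitively on the sphere, and the measure of a cap or cone does not
    depend on its centre. *)
Lemma refl_swap p q : edot p p = edot q q -> refl (p - q) p = q.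
Proof.
move=> pq; rewrite /refl.
have [v0|v0] := eqVneq (edot (p - q) (p - q)) 0.
  by rewrite v0 invr0 mulr0 scale0r subr0; apply/eqP; rewrite -subr_eq0; apply/eqP/edot_eq0.
rewrite [X in X *: _](_ : _ = 1) ?scale1r ?subKr//.
have -> : 2 * edot p (p - q) = edot (p - q) (p - q).
  by rewrite !edotBr !edotBl -pq (edotC q p); ring.
by rewrite mulfV.
Qed.

Lemma measurable_edot d (T : measurableType d) (f g : T -> 'rV[R]_n) :
  measurable_fun setT f -> measurable_fun setT g ->
  measurable_fun setT (fun t => edot (f t) (g t)).
Proof.
move=> mf mg; apply: measurable_sum => i.
by apply: measurable_funM; exact: measurable_coor_comp.
Qed.

Lemma lebesgue_rV_refl v (A : set 'rV[R]_n) : measurable A ->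
  lebesgue_rV n (refl v @^-1` A) = lebesgue_rV n A.
Proof.
move=> mA; pose a := 2 / edot v v.
pose M : 'M[R]_n := 1%:M - a *: (v^T *m v).
have ME y : y *m M = refl v y.
  rewrite /M mulmxBr mulmx1 /refl -scalemxAr (mulmxA y v^T v); congr (_ - _).
  rewrite [y *m v^T]mx11_scalar -edotE mul_scalar_mx scalerA; congr (_ *: _).
  by rewrite /a; ring.
have MT : M^T = M.
  by rewrite /M linearB/= trmx1 linearZ/= trmx_mul trmxK.
have MM : M *m M^T = 1%:M.
  by rewrite MT; apply/row_matrixP => i; rewrite row_mul !rowE !ME reflK mulmx1.
rewrite -(lebesgue_rV_isometry MM mA); congr (lebesgue_rV _ _).
by apply/funext => y /=; rewrite ME.
Qed.

End reflection.

Section caps.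
Context {R : realType} (n : nat).
Implicit Types (p y : 'rV[R]_n) (tau : R).

Definition cap tau p : set 'rV[R]_n := [set y | edot y y = 1 /\ tau < edot y p].

(** The part of the closed unit ball over [cap tau p]. The condition is homogeneous in [x], so on
    the sphere it is that of the cap: one relation [tau |x| < x.y] has cones as sections in one
    variable and caps in the other. *)
Definition cone tau p : set 'rV[R]_n :=
  [set x | enorm x <= 1 /\ tau * enorm x < edot x p].

Lemma measurable_eq_edot (c : R) : measurable [set y : 'rV[R]_n | edot y y = c].
Proof.
have -> : [set y : 'rV[R]_n | edot y y = c] = (fun y => edot y y) @^-1` [set c] by [].
rewrite -[X in measurable X]setTI; apply: measurable_edot => //.
Qed.

Lemma measurable_cap tau p : measurable (cap tau p).
Proof.
apply: measurableI; first exact: measurable_eq_edot.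
by apply: measurable_setlt => //; exact: measurable_edot.
Qed.

Lemma measurable_cone tau p : measurable (cone tau p).
Proof.
apply: measurableI; first exact: measurable_cball.
apply: measurable_setlt; last exact: measurable_edot.
by apply: measurable_funM => //; exact: measurable_enorm.
Qed.

Lemma hausdorff_cap d tau p q : edot p p = 1 -> edot q q = 1 ->
  hausdorff_unnormalized d (cap tau p) = hausdorff_unnormalized d (cap tau q).
Proof.
move=> p1 q1; have pq : refl (q - p) q = p by apply: refl_swap; rewrite p1.
rewrite -(@hausdorff_isometry _ d _ (refl (q - p)) (refl (q - p)) (cap tau q))//.
- congr hausdorff_unnormalized; apply/seteqP; split => y /=; rewrite /cap /=;
  by rewrite refl_iso refl_edot pq.
- exact: reflK.
- exact: reflK.
- exact: refl_dist.
Qed.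

Lemma lebesgue_rV_cone tau p q : edot p p = 1 -> edot q q = 1 ->
  lebesgue_rV n (cone tau p) = lebesgue_rV n (cone tau q).
Proof.
move=> p1 q1; have pq : refl (q - p) q = p by apply: refl_swap; rewrite p1.
rewrite -(lebesgue_rV_refl (q - p) (measurable_cone tau q)).
congr (lebesgue_rV _ _); apply/seteqP; split => y /=; rewrite /cone /=;
  by rewrite refl_enorm refl_edot pq.
Qed.

End caps.

(** * Caps as graphs over a disc, and the cones over them *)

Section charts.
Context {R : realType} (d : nat).
Implicit Types (tau t : R) (w : 'rV[R]_d).

Definition pole : 'rV[R]_d.+1 := rV_cons (1, 0).

Lemma rV_consP (y : 'rV[R]_d.+1) : exists t w, y = rV_cons (t, w).
Proof. by exists (y ord0 ord0), (rV_tail y); rewrite rV_cons_tail. Qed.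

Lemma edot_cons t w s z : edot (rV_cons (t, w)) (rV_cons (s, z)) = t * s + edot w z.
Proof.
rewrite {1}/edot big_ord_recl !rV_cons0; congr (_ + _).
by apply: eq_bigr => i _; rewrite !rV_consS.
Qed.

Lemma edot0r w : edot w 0 = 0.
Proof. by rewrite /edot big1// => i _; rewrite mxE mulr0. Qed.

Lemma edot_pole t w : edot (rV_cons (t, w)) pole = t.
Proof. by rewrite edot_cons mulr1 edot0r addr0. Qed.

Lemma pole1 : edot pole pole = 1.
Proof. by rewrite edot_pole. Qed.

Lemma rV_consB t w s z : rV_cons (t, w) - rV_cons (s, z) = rV_cons (t - s, w - z).
Proof.
by rewrite rV_consD; congr (_ + _); rewrite -scaleN1r -rV_consZ mulN1r scaleN1r.
Qed.

Local Notation c := (@hcube R d).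

Lemma hausdorff_eball_d (r : R) : 0 < r ->
  hausdorff_unnormalized d (eball 0 r : set 'rV[R]_d) = (c * (r ^+ d * vball d))%:E.
Proof.
move=> r0; rewrite hausdorff_lebesgue; last exact: measurable_eball.
by rewrite EFinM; congr (_ * _)%E; exact: lebesgue_rV_eball.
Qed.

(** Cavalieri: the slice at height [t] is a [d]-dimensional ball of radius [k t]. *)
Lemma lebesgue_rV_straight_cone (k T : R) : 0 < k -> 0 < T ->
  lebesgue_rV d.+1 [set x : 'rV[R]_d.+1 | 0 < x ord0 ord0 <= T /\ enorm (rV_tail x) < k * x ord0 ord0] =
  (k ^+ d * vball d * (T ^+ d.+1 / d.+1%:R))%:E.
Proof.
move=> k0 T0; rewrite lebesgue_rVSE /product_measure1 /=.
rewrite (_ : (k ^+ d * _ * _)%:E =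
    \int[lebesgue_measure]_(t in `]0%R, T]) (k ^+ d * vball d * t `^ (d.+1%:R - 1))%:E)%E; last first.
  rewrite integral_cpowR_0 ?mulr_ge0 ?exprn_ge0 ?(ltW k0) ?(ltW (vball_gt0 _))//.
  by rewrite powR_mulrn// ltW.
rewrite [RHS]integral_mkcond; apply: eq_integral => t _ /=.
rewrite patchE mem_setE in_itv/=.
case: ifPn => [/andP[t0 tT]|tT]; last first.
  rewrite (_ : xsection _ _ = set0) ?measure0//.
  apply/seteqP; split => w //=; rewrite /xsection /= inE /= rV_cons0.
  by rewrite (negbTE tT) => -[].
rewrite (_ : xsection _ _ = eball 0 (k * t)); last first.
  apply/seteqP; split => w; rewrite /xsection /eball /= inE /= rV_cons0 rV_tail_cons subr0.
    by case.
  by move=> h; split => //; rewrite t0 tT.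
rewrite [LHS]lebesgue_rV_eball ?mulr_gt0//; congr EFin.
by rewrite -natr1 addrK powR_mulrn ?(ltW t0)// exprMn; ring.
Qed.

Section fixed_tau.
Variables (tau : R).
Hypothesis tau01 : 0 < tau < 1.
Let tau0 : 0 < tau. Proof. by case/andP: tau01. Qed.
Let tau1 : tau < 1. Proof. by case/andP: tau01. Qed.
Let r : R := Num.sqrt (1 - tau ^+ 2).
Let rr : 0 < 1 - tau ^+ 2. Proof. by rewrite subr_gt0 exprn_ilt1// ltW. Qed.
Let r0 : 0 < r. Proof. by rewrite sqrtr_gt0. Qed.
Let r2 : r ^+ 2 = 1 - tau ^+ 2. Proof. by rewrite sqr_sqrtr// ltW. Qed.

Let eball_edot w : eball 0 r w -> tau ^+ 2 < 1 - edot w w.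
Proof.
rewrite /eball /= subr0 -enorm_sqr => h.
have : enorm w ^+ 2 < r ^+ 2 by rewrite ltr_pXn2r ?nnegrE ?enorm_ge0// ltW.
by rewrite r2; lra.
Qed.

Let phi w : 'rV[R]_d.+1 := rV_cons (Num.sqrt (1 - edot w w), w).

Let capE : cap tau pole = phi @` eball 0 r.
Proof.
apply/seteqP; split => y /=.
  have [t [z ->]] := rV_consP y; rewrite /cap /= edot_cons edot_pole => -[y1 ty].
  have t0 : 0 < t by exact: lt_trans ty.
  rewrite -expr2 in y1; exists z.
    rewrite /eball /= subr0 -(@ltr_pXn2r _ 2)// ?nnegrE ?enorm_ge0 ?(ltW r0)// enorm_sqr r2.
    have : tau ^+ 2 < t ^+ 2 by rewrite ltr_pXn2r ?nnegrE ?(ltW tau0) ?(ltW t0).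
    lra.
  rewrite /phi; congr (rV_cons (_, _)).
  have -> : 1 - edot z z = t ^+ 2 by rewrite -y1 addrK.
  by rewrite sqrtr_sqr ger0_norm// ltW.
move=> [w /eball_edot hw <-].
have h0 : 0 <= 1 - edot w w by apply/ltW/(lt_trans _ hw); rewrite exprn_gt0.
split; first by rewrite edot_cons -expr2 sqr_sqrtr//; ring.
by rewrite edot_pole -[tau]ger0_norm ?(ltW tau0)// -sqrtr_sqr ltr_sqrt// (lt_trans _ hw)// exprn_gt0.
Qed.

(** Dropping the first coordinate is 1-Lipschitz and maps the cap onto the flat disc of radius
    [r]. *)
Lemma cap_ge : ((c * (r ^+ d * vball d))%:E <= hausdorff_unnormalized d (cap tau pole))%E.
Proof.
rewrite -hausdorff_eball_d//.
have -> : eball 0 r = @rV_tail R d @` cap tau pole.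
  by rewrite capE image_comp eq_image_id// => w _; exact: rV_tail_cons.
have := @hausdorff_lipschitz R d _ _ (@rV_tail R d) (cap tau pole) 1 ltr01.
rewrite expr1n mul1e; apply => x y _ _; rewrite mul1r.
have [t [w ->]] := rV_consP x; have [t' [z ->]] := rV_consP y.
rewrite rV_consB !rV_tail_cons.
rewrite -(@ler_pXn2r _ 2)// ?nnegrE ?enorm_ge0// !enorm_sqr edot_cons lerDr.
by rewrite -expr2 sqr_ge0.
Qed.

(** Over the disc of radius [r] the upper hemisphere has slope at most [r / tau]. Since
    [1 + (r/tau)^2 = tau^(-2)], the chart [phi] is Lipschitz with constant [1/tau]. *)
Lemma cap_le : (hausdorff_unnormalized d (cap tau pole) <=
  (tau ^- d * (c * (r ^+ d * vball d)))%:E)%E.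
Proof.
rewrite capE EFinM -hausdorff_eball_d// -exprVn.
apply: hausdorff_lipschitz; first by rewrite invr_gt0.
move=> w z hw hz.
rewrite /phi rV_consB -(@ler_pXn2r _ 2)// ?nnegrE ?enorm_ge0 ?mulr_ge0 ?enorm_ge0 ?invr_ge0 ?(ltW tau0)//.
rewrite enorm_sqr edot_cons exprMn enorm_sqr.
have aw := eball_edot hw; have az := eball_edot hz.
set A := Num.sqrt (1 - edot w w); set B := Num.sqrt (1 - edot z z).
have t20 : 0 < tau ^+ 2 by rewrite exprn_gt0.
have A2 : A ^+ 2 = 1 - edot w w by rewrite sqr_sqrtr// ltW// (lt_trans t20).
have B2 : B ^+ 2 = 1 - edot z z by rewrite sqr_sqrtr// ltW// (lt_trans t20).
have tA : tau < A by rewrite -[tau]ger0_norm ?(ltW tau0)// -sqrtr_sqr ltr_sqrt// (lt_trans t20).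
have tB : tau < B by rewrite -[tau]ger0_norm ?(ltW tau0)// -sqrtr_sqr ltr_sqrt// (lt_trans t20).
have hw' : enorm w < r by move: hw; rewrite /eball /= subr0.
have hz' : enorm z < r by move: hz; rewrite /eball /= subr0.
set D := edot (w - z) (w - z).
have D0 : 0 <= D by exact: edot_ge0.
pose N := enorm (w - z).
have N0 : 0 <= N := enorm_ge0 _.
have DN : D = N ^+ 2 by rewrite enorm_sqr.
have n1 : enorm w - enorm z <= N by rewrite lerBlDr; apply: le_trans (enormD _ _); rewrite subrK.
have n2 : enorm z - enorm w <= N by rewrite lerBlDr /N enormBC; apply: le_trans (enormD _ _); rewrite subrK.
have e1 : (A - B) * (A + B) = (enorm z - enorm w) * (enorm z + enorm w).
  by rewrite -!subr_sqr A2 B2 !enorm_sqr; ring.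
have r0' := r0.
(* Slope bound by differences of squares: [(A - B)(A + B) = (|z| - |w|)(|z| + |w|)], with
   [A + B >= 2 tau] and [|z| + |w| <= 2 r]. *)
have key : `|A - B| * tau <= r * N.
  rewrite -(ler_pM2l (ltr0Sn R 1)).
  apply: (@le_trans _ _ (`|A - B| * (A + B))).
    by rewrite mulrCA ler_wpM2l//; lra.
  have AB0 : 0 <= A + B by rewrite addr_ge0 ?sqrtr_ge0.
  rewrite -(ger0_norm AB0) -normrM e1 normrM.
  rewrite [X in _ * X <= _]ger0_norm ?addr_ge0 ?enorm_ge0//.
  have -> : 2 * (r * N) = N * (2 * r) by ring.
  apply: ler_pM => //; first by rewrite addr_ge0 ?enorm_ge0.
    by rewrite ler_norml; apply/andP; split; lra.
  by lra.
have key2 : (A - B) ^+ 2 * tau ^+ 2 <= (1 - tau ^+ 2) * D.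
  rewrite -real_normK ?num_real// -exprMn -r2 DN -exprMn.
  by rewrite ler_pXn2r// nnegrE ?mulr_ge0// ltW.
rewrite -expr2 exprVn ler_pdivlMl// mulrDr mulrC.
by rewrite -lerBrDr; move: key2; rewrite mulrBl mul1r mulrC.
Qed.

(** Aperture of the cone: as [1 + k^2 = tau^(-2)], the condition [tau |(t, w)| < t] reads
    [|w| < k t] for [t > 0]. The cone in the ball thus lies between the straight cones of this
    aperture and heights [tau] and 1. *)
Let k : R := r / tau.
Let k0 : 0 < k. Proof. by rewrite divr_gt0. Qed.
Let k2 : 1 + k ^+ 2 = tau ^- 2.
Proof. by rewrite /k exprMn r2; field; rewrite gt_eqF. Qed.

Let measurable_sc T :
  measurable [set x : 'rV[R]_d.+1 | 0 < x ord0 ord0 <= T /\ enorm (rV_tail x) < k * x ord0 ord0].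
Proof.
have -> : [set x : 'rV[R]_d.+1 | 0 < x ord0 ord0 <= T /\ enorm (rV_tail x) < k * x ord0 ord0] =
   ([set x : 'rV[R]_d.+1 | 0 < x ord0 ord0] `&` [set x : 'rV[R]_d.+1 | x ord0 ord0 <= T]) `&`
   [set x | enorm (rV_tail x) < k * x ord0 ord0].
  by apply/seteqP; split => x /=; [move=> [/andP[-> ->] ->]|move=> [[-> ->] ->]].
have m0 := @measurable_coor R d.+1 ord0.
apply: measurableI; first apply: measurableI.
- exact: measurable_setlt.
- exact: measurable_setle.
- apply: measurable_setlt; last exact: measurable_funM.
  by apply: measurable_enorm; exact: measurable_rV_tail.
Qed.

Let cone_iff t w : 0 < t -> (tau * enorm (rV_cons (t, w)) < t) = (enorm w < k * t).
Proof.
move=> t0.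
rewrite -[LHS](@ltr_pXn2r _ 2)// ?nnegrE ?mulr_ge0 ?enorm_ge0 ?(ltW tau0) ?(ltW t0)//.
rewrite -[RHS](@ltr_pXn2r _ 2)// ?nnegrE ?enorm_ge0 ?(mulr_ge0 (ltW k0) (ltW t0))//.
rewrite exprMn !enorm_sqr edot_cons -ltr_pdivlMl ?exprn_gt0// -k2.
by rewrite [(k * t) ^+ 2]exprMn mulrDl mul1r -[t * t]expr2 ltrD2l.
Qed.

Lemma cone_ge : ((r ^+ d * vball d * tau / d.+1%:R)%:E <= lebesgue_rV d.+1 (cone tau pole))%E.
Proof.
have -> : r ^+ d * vball d * tau / d.+1%:R = k ^+ d * vball d * (tau ^+ d.+1 / d.+1%:R).
  rewrite /k exprMn exprVn exprS; field.
  by rewrite expf_neq0 ?pnatr_eq0 ?gt_eqF.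
rewrite -lebesgue_rV_straight_cone//; apply: le_measure; rewrite ?inE.
- exact: measurable_sc.
- exact: measurable_cone.
move=> x; have [t [w ->]] := rV_consP x.
rewrite /cone /= rV_cons0 rV_tail_cons edot_pole => -[/andP[t0 tT]].
move=> h; rewrite cone_iff//; split => //.
rewrite -(ler_pM2l tau0) mulr1; apply: le_trans tT.
by rewrite ltW// cone_iff.
Qed.

Lemma cone_le : (lebesgue_rV d.+1 (cone tau pole) <= (r ^+ d * vball d * tau ^- d / d.+1%:R)%:E)%E.
Proof.
have -> : r ^+ d * vball d * tau ^- d / d.+1%:R = k ^+ d * vball d * (1 ^+ d.+1 / d.+1%:R).
  by rewrite /k exprMn exprVn expr1n; field; rewrite expf_neq0 ?pnatr_eq0 ?gt_eqF.
rewrite -lebesgue_rV_straight_cone//; apply: le_measure; rewrite ?inE.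
- exact: measurable_cone.
- exact: measurable_sc.
move=> x; have [t [w ->]] := rV_consP x.
rewrite /cone /= rV_cons0 rV_tail_cons edot_pole => -[x1 h].
have t0 : 0 < t by apply: le_lt_trans h; rewrite mulr_ge0 ?enorm_ge0// ltW.
rewrite t0 -cone_iff// h; split => //=.
apply: le_trans x1; apply: le_trans (ler_norm _) _.
by have := coor_le_enorm (rV_cons (t, w)) ord0; rewrite rV_cons0.
Qed.

End fixed_tau.

End charts.

(** * The measure of the sphere by double counting *)

Section sphere_measure.
Context {R : realType} (d : nat).
Local Notation n := d.+1.
Local Notation H := (@hausdorff_unnormalized R d n).
Local Notation c := (@hcube R d).

Definition sphere : set 'rV[R]_n := [set y | edot y y = 1].

Lemma unit_sphereE : @unit_sphere R n = sphere.
Proof.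
apply/seteqP; split => y; rewrite /unit_sphere /sphere /= -enorm_sqr.
  by move=> ->; rewrite expr1n.
move=> h; apply/eqP; rewrite -(@eqrXn2 _ 2) ?enorm_ge0//.
by rewrite h expr1n.
Qed.

(** The [2n] caps around the points [e_i] and [- e_i] cover the sphere for this [tau]: if all
    coordinates were at most [tau] in absolute value, the norm would be at most [sqrt n tau < 1]. *)
Lemma sphere_fin : (H sphere < +oo)%E.
Proof.
pose tau : R := (Num.sqrt n%:R + 1)^-1.
have s1 : 1 <= Num.sqrt n%:R :> R by rewrite -[leLHS]sqrtr1 ler_sqrt// ler1n.
have tau01 : 0 < tau < 1.
  rewrite invr_gt0 invf_lt1; first by apply/andP; split; lra.
  by lra.
pose e (k : nat) : 'rV[R]_n := delta_mx ord0 (inord k).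
have edot_delta y (i : 'I_n) : edot y (delta_mx ord0 i) = y ord0 i.
  rewrite /edot (bigD1 i)//= mxE !eqxx mulr1 big1 ?addr0// => j ji.
  by rewrite mxE (negbTE ji) mulr0.
have e1 k : edot (e k) (e k) = 1 by rewrite edot_delta mxE !eqxx.
have e1N k : edot (- e k) (- e k) = 1 by rewrite -(scaleN1r (e k)) edotZl edotZr e1; ring.
pose F k := cap tau (e k) `|` cap tau (- e k).
pose b : \bar R := (tau ^- d * (c * ((Num.sqrt (1 - tau ^+ 2)) ^+ d * vball d)))%:E.
have hce p : edot p p = 1 -> (H (cap tau p) <= b)%E.
  by move=> p1; rewrite (hausdorff_cap d tau p1 (pole1 d)); exact: cap_le.
have Fb k : (H (F k) <= b + b)%E.
  apply: le_trans (outer_measureU2 H _ _) _; apply: leeD.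
    exact: hce.
  exact: hce.
apply: (@le_lt_trans _ _ (H (\big[setU/set0]_(k < n) F k))).
  apply: le_outer_measure => y; rewrite /sphere /= => y1.
  have [i hi] : exists i, tau < `|y ord0 i|.
    apply/not_existsP => hh.
    have : enorm y <= Num.sqrt n%:R * tau.
      apply: enorm_le_sup; first by case/andP : tau01 => /ltW.
      by move=> i; rewrite leNgt; apply/negP/hh.
    rewrite enormE y1 sqrtr1 leNgt ltr_pdivrMr ?mul1r ?ltrDl//; lra.
  rewrite -bigcup_seq/=; exists i => /=; first by rewrite mem_index_enum.
  rewrite /F /cap /e inord_val /=.
  rewrite -(scaleN1r (delta_mx _ _)) edotZr edot_delta mulN1r.
  move: hi; case: (ler0P (y ord0 i)) => _ hi; [by right|by left].
apply: le_lt_trans (outer_measure_subadditive H F n) _.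
apply: (@le_lt_trans _ _ (\sum_(k < n) (b + b))%E).
  by apply: lee_sum => k _; exact: Fb.
by rewrite -EFinD sumEFin ltry.
Qed.

Lemma measurable_sphere : measurable sphere.
Proof. exact: measurable_eq_edot. Qed.

(** On [R^(d+1)] the [d]-dimensional Hausdorff measure is not sigma-finite; restricted to the sphere
    it is finite, and Tonelli's theorem applies. *)
Let nu := mrestr (@hausdorff_borel R d n) measurable_sphere.

Let nu_fin : sigma_finite setT nu.
Proof.
exists (fun=> setT); first by rewrite bigcup_const.
by move=> k; split => //; rewrite /nu /mrestr setTI; exact: sphere_fin.
Qed.

Let nu' : {sigma_finite_measure set 'rV[R]_n -> \bar R} := sigma_finite_alias nu_fin.

(* Double counting of the pairs (x, y), x in the ball and y on the sphere, with
   tau |x| < x . y. *)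
Lemma Christensen_sphere (tau : R) :
  (H (cap tau (pole d)) * (vball n)%:E = lebesgue_rV n (cone tau (pole d)) * H sphere)%E.
Proof.
(* The origin is removed because for [x != 0] the section over [x] is the cap centred at [x / |x|];
   a point is a null set. *)
pose D : set 'rV[R]_n := cball 1 `\` cball 0.
have mD : measurable D by apply: measurableD; exact: measurable_cball.
have DE x : D x <-> enorm x <= 1 /\ 0 < enorm x.
  rewrite /D /cball /=; split => -[h1 h2]; split => //.
    by rewrite ltNge; apply/negP.
  by apply/negP; rewrite -ltNge.
have lD : lebesgue_rV n D = (vball n)%:E.
  have := @lebesgue_rV_cball R n 1 ltr01; rewrite expr1n mul1r => <-.
  have -> : cball 1 = D `|` cball 0 :> set 'rV[R]_n.
    rewrite /D setDE setUIl [_ `|` cball 0]setUC setvU setIT.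
    by rewrite setUidr// => x; rewrite /cball /= => /le_trans; apply.
  rewrite measureU//; last 2 first.
  - exact: measurable_cball.
  - by rewrite /D setDE -setIA setICl setI0.
  by rewrite [X in (_ = _ + X)%E]lebesgue_rV_cball0// adde0.
pose P (p : 'rV[R]_n * 'rV[R]_n) : bool :=
  [&& p.1 \in D, p.2 \in sphere & tau * enorm p.1 < edot p.1 p.2].
pose f (p : 'rV[R]_n * 'rV[R]_n) : \bar R := if P p then 1%E else 0%E.
have mf : measurable_fun setT f.
  apply: measurable_fun_ifT => //; apply: (@measurable_fun_bool _ _ _ _ true).
  have -> : setT `&` P @^-1` [set true] =
      ((setT `&` @fst _ _ @^-1` D) `&` (setT `&` @snd _ _ @^-1` sphere)) `&`
      [set p | tau * enorm p.1 < edot p.1 p.2].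
    apply/seteqP; split => p /=; rewrite /P.
      by move=> [_ /and3P[/set_mem ? /set_mem ? ?]].
    by move=> [[[_ ?] [_ ?]] ?]; split => //; apply/and3P; split => //; exact/mem_set.
  apply: measurableI; first apply: measurableI.
  - exact: measurable_fst.
  - by apply: measurable_snd => //; exact: measurable_sphere.
  - apply: measurable_setlt.
      by apply: measurable_funM => //; apply: measurable_enorm; exact: measurable_fst.
    by apply: measurable_edot; [exact: measurable_fst|exact: measurable_snd].
have f0 p : (0 <= f p)%E by rewrite /f; case: ifP.
have := @fubini_tonelli _ _ _ _ _ (lebesgue_rV n) nu' f mf f0.
have -> : (\int[lebesgue_rV n]_x \int[nu']_y f (x, y) = H (cap tau (pole d)) * (vball n)%:E)%E.
  rewrite -lD -integral_cst// integral_mkcond; apply: eq_integral => x _.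
  rewrite patchE /f /P /=.
  rewrite (@integral_if _ 'rV[R]_n R nu' (fun y => [&& x \in D, y \in sphere & tau * enorm x < edot x y])).
  case: ifPn => xD; last by rewrite (_ : [set _ | _] = set0) ?integral_set0//; apply/seteqP; split.
  have /DE[x1 x0] := set_mem xD.
  have -> : [set y | (true && (y \in sphere)) && (tau * enorm x < edot x y)] = cap tau ((enorm x)^-1 *: x).
    apply/seteqP; split => y; rewrite /cap /=.
      move=> /andP[/set_mem ys h]; split => //.
      by rewrite edotZr ltr_pdivlMl// mulrC edotC.
    move=> [ys h]; rewrite mem_set//=.
    by move: h; rewrite edotZr ltr_pdivlMl// mulrC edotC.
  rewrite integral_cst; last exact: measurable_cap.
  rewrite mul1e; apply: etrans (@hausdorff_cap R n d tau ((enorm x)^-1 *: x) (pole d) _ (pole1 d)).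
    rewrite /nu' /sigma_finite_alias /= /nu /mrestr; congr (H _).
    by apply/seteqP; split => y /=; [case|move=> h; split => //; case: h].
  by rewrite edotZl edotZr -enorm_sqr; field; rewrite gt_eqF.
move=> ->.
have -> : (\int[nu']_y \int[lebesgue_rV n]_x f (x, y) =
    \int[nu']_(y in sphere) cst (lebesgue_rV n (cone tau (pole d))) y)%E.
  rewrite [RHS]integral_mkcond; apply: eq_integral => y _.
  rewrite patchE /f /P /=.
  rewrite (@integral_if _ 'rV[R]_n R (lebesgue_rV n) (fun x => [&& x \in D, y \in sphere & tau * enorm x < edot x y])).
  case: ifPn => ys; last first.
    by rewrite (_ : [set _ | _] = set0) ?integral_set0//; apply/seteqP; split => x //=; rewrite andbF.
  have -> : [set x | [&& x \in D, true & tau * enorm x < edot x y]] = cone tau y.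
    apply/seteqP; split => x; rewrite /cone /=.
      by move=> /andP[/set_mem/DE[]].
    move=> [x1 h]; rewrite h andbT; apply/mem_set/DE; split => //.
    rewrite lt_def enorm_ge0 andbT; apply/negP => /eqP e0.
    move: h; rewrite e0 mulr0; move/eqP : e0; rewrite enorm_eq0 => /eqP ->.
    by rewrite edotC edot0r ltxx.
  rewrite integral_cst; last exact: measurable_cone.
  by rewrite mul1e; apply: lebesgue_rV_cone; [exact: set_mem ys|exact: pole1].
rewrite integral_cst; last exact: measurable_sphere.
by congr (_ * _)%E; rewrite /nu' /sigma_finite_alias /= /nu /mrestr setIid.
Qed.

Lemma hausdorff_sphere : H sphere = (c * (n%:R * vball n))%:E.
Proof.
have hs : H sphere \is a fin_num by rewrite ge0_fin_numE ?sphere_fin// outer_measure_ge0.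
rewrite -(fineK hs); congr EFin; set s := fine (H sphere).
have s0 : 0 <= s by rewrite fine_ge0// outer_measure_ge0.
have c0 : 0 < c := hcube_gt0 d.
have vd0 : 0 < vball d :> R := vball_gt0 d.
have vn0 : 0 < vball n :> R := vball_gt0 n.
(* The bounds for cap and cone are inserted into the double-counting identity. The factor
   [r^d |B_d|], common to all of them, cancels, and what remains are powers of [tau] tending to
   1. *)
have bounds tau : 0 < tau < 1 ->
    (tau ^+ d * (c * (n%:R * vball n)) <= s) && (tau ^+ d * tau * s <= c * (n%:R * vball n)).
  move=> t01; have /andP[t0 t1] := t01.
  have := Christensen_sphere tau.
  have r0 : 0 < Num.sqrt (1 - tau ^+ 2) by rewrite sqrtr_gt0 subr_gt0 exprn_ilt1// ltW.
  have h1 := cap_ge d t01; have h2 := cap_le d t01.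
  have g1 := cone_ge d t01; have g2 := cone_le d t01.
  have capf : H (cap tau (pole d)) \is a fin_num.
    by rewrite ge0_fin_numE ?outer_measure_ge0// (le_lt_trans h2)// ltry.
  have conef : lebesgue_rV n (cone tau (pole d)) \is a fin_num.
    by rewrite ge0_fin_numE// (le_lt_trans g2)// ltry.
  move: h1 h2 g1 g2; rewrite -(fineK capf) -(fineK conef) -(fineK hs).
  rewrite -/s -!EFinM !lee_fin.
  set h := fine (H _); set g := fine (lebesgue_rV _ _); set r := Num.sqrt _ in r0 *.
  move=> h1 h2 g1 g2 [E].
  have rd0 : 0 < r ^+ d by rewrite exprn_gt0.
  have td0 : 0 < tau ^+ d by rewrite exprn_gt0.
  have n0 : 0 < n%:R :> R by rewrite ltr0n.
  have B0 : 0 < r ^+ d * vball d by rewrite mulr_gt0.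
  have h2' : tau ^+ d * h <= c * (r ^+ d * vball d) by rewrite -ler_pdivlMl.
  have g1' : r ^+ d * vball d * tau <= n%:R * g by rewrite -ler_pdivrMl// mulrC.
  have g2' : tau ^+ d * (n%:R * g) <= r ^+ d * vball d.
    rewrite -ler_pdivlMl// -ler_pdivlMl//.
    by apply: le_trans g2 _; rewrite le_eqVlt; apply/orP; left; apply/eqP; ring.
  apply/andP; split.
    rewrite -(ler_pM2l B0).
    apply: (@le_trans _ _ (tau ^+ d * n%:R * (vball n * h))).
      have -> : r ^+ d * vball d * (tau ^+ d * (c * (n%:R * vball n))) =
        tau ^+ d * n%:R * (vball n * (c * (r ^+ d * vball d))) by ring.
      by rewrite ler_wpM2l ?mulr_ge0 ?(ltW td0)// ler_wpM2l// ltW.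
    rewrite (mulrC (vball n)) E.
    have -> : tau ^+ d * n%:R * (g * s) = tau ^+ d * (n%:R * g) * s by ring.
    by rewrite ler_wpM2r.
  rewrite -(ler_pM2l B0).
  apply: (@le_trans _ _ (tau ^+ d * (n%:R * g) * s)).
    have -> : r ^+ d * vball d * (tau ^+ d * tau * s) = tau ^+ d * (r ^+ d * vball d * tau * s) by ring.
    by rewrite -[leRHS]mulrA ler_wpM2l ?(ltW td0)// ler_wpM2r.
  have -> : tau ^+ d * (n%:R * g) * s = n%:R * tau ^+ d * (g * s) by ring.
  rewrite -E.
  have -> : n%:R * tau ^+ d * (h * vball n) = n%:R * vball n * (tau ^+ d * h) by ring.
  have -> : r ^+ d * vball d * (c * (n%:R * vball n)) = n%:R * vball n * (c * (r ^+ d * vball d)) by ring.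
  by rewrite ler_wpM2l// mulr_ge0// ltW.
have lim k (a : R) : (tau ^+ k * a) @[tau --> (1 : R)^'-] --> a.
  rewrite -[X in _ --> X]mul1r -{2}(expr1n R k).
  apply: cvgMr_tmp; apply: cvg_at_left_filter; exact: exprn_continuous.
have near01 : \forall tau \near (1 : R)^'-, 0 < tau < 1.
  near=> tau; apply/andP; split; near: tau; last exact: nbhs_left_lt.
  exact: nbhs_left_gt.
apply/eqP; rewrite eq_le; apply/andP; split.
  apply: (cvgr_to_le (lim d.+1 s)); near=> tau.
  have t01 : 0 < tau < 1 by near: tau.
  by have /andP[_] := bounds tau t01; rewrite exprSr.
apply: (cvgr_to_le (lim d _)); near=> tau.
have t01 : 0 < tau < 1 by near: tau.
by have /andP[] := bounds tau t01.
Unshelve. all: by end_near. Qed.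

Lemma omegaE : omega n = n%:R * vball n :> R.
Proof.
rewrite /omega /hausdorff /= -[fine (hausdorff_unnormalized _ _)]/c unit_sphereE hausdorff_sphere.
by rewrite -EFinM /= mulKf// gt_eqF// hcube_gt0.
Qed.

End sphere_measure.

(** * Touching paraboloids *)

Section taylor.
Context {R : realType} (n : nat).
Implicit Types (f g : 'rV[R]_n -> R) (x y h v p : 'rV[R]_n).

Lemma derivable_line f a v (t : R) : derivable f (a + t *: v) v ->
  derivable (fun t : R => f (a + t *: v)) t 1 /\
  derive1 (fun t : R => f (a + t *: v)) t = 'D_v f (a + t *: v).
Proof.
have e : (fun h : R => h^-1 *: (((fun t : R => f (a + t *: v)) \o shift t) (h *: (1 : R)) - f (a + t *: v))) =
         (fun h : R => h^-1 *: ((f \o shift (a + t *: v)) (h *: v) - f (a + t *: v))).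
  apply/funext => h /=; congr (_ *: (f _ - _)).
  by rewrite /shift/= [h *: (1 : R)]mulr1 scalerDl addrCA.
by move=> df; rewrite derive1E /derivable /derive e.
Qed.

Lemma lipschitz_line (phi : R -> R) (a L : R) :
  (forall t, `|t| <= `|a| -> derivable phi t 1 /\ `|derive1 phi t| <= L) ->
  `|phi a - phi 0| <= L * `|a|.
Proof.
move=> hphi.
have gen (b c : R) : b <= c -> (forall t, b <= t <= c -> `|t| <= `|a|) ->
    `|phi c - phi b| <= L * (c - b).
  move=> bc hb.
  have [||t /[!in_itv]/= tbc ->] := @MVT_segment R phi (derive1 phi) b c bc.
  - move=> t; rewrite in_itv/= => /andP[/ltW bt /ltW tc].
    have [|d _] := hphi t; first by apply: hb; rewrite bt.
    by rewrite derive1E; exact: derivableP.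
  - apply: derivable_within_continuous => t; rewrite in_itv/= => tbc.
    by have [] := hphi t (hb t tbc).
  rewrite normrM [X in _ * X <= _]ger0_norm ?subr_ge0// ler_wpM2r ?subr_ge0//.
  by have [] := hphi t (hb t tbc).
have [a0|a0] := leP 0 a.
  apply: le_trans (gen 0 a a0 _) _; last by rewrite subr0 ger0_norm.
  by move=> t /andP[t0 ta]; rewrite !ger0_norm.
rewrite distrC; apply: le_trans (gen a 0 (ltW a0) _) _.
  by move=> t /andP[ta t0]; rewrite !ler0_norm ?lerN2// ltW.
by rewrite sub0r ltr0_norm.
Qed.

Definition sup_box x (r : R) : set 'rV[R]_n := [set y | forall i, `|(y - x) ord0 i| <= r].

(** The path from [x] to [x + h] changes one coordinate at a time, with [n] uses of the mean value
    theorem. Sup boxes occur instead of Euclidean balls because this staircase stays inside them. *)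
Lemma lipschitz_partial g x (rho L : R) :
  (forall y, sup_box x rho y -> forall i,
     derivable g y (delta_mx ord0 i : 'rV[R]_n) /\ `|partial i g y| <= L) ->
  forall h, (forall i, `|h ord0 i| <= rho) -> `|g (x + h) - g x| <= n%:R * (L * rho).
Proof.
move=> hg h hh.
pose P (k : nat) : 'rV[R]_n := x + \row_i (if (i < k)%N then h ord0 i else 0).
have step k : (k <= n)%N -> `|g (P k) - g x| <= k%:R * (L * rho).
  elim: k => [_|k ih kn].
    rewrite mul0r /P (_ : \row_i _ = 0) ?addr0 ?subrr ?normr0//.
    by apply/rowP => i; rewrite !mxE.
  pose i := Ordinal kn; pose e : 'rV[R]_n := delta_mx ord0 i.
  have rho0 : 0 <= rho by apply: le_trans (hh i).
  have L0 : 0 <= L.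
    by have [j|_] := hg x _ i; [rewrite subrr mxE normr0|apply: le_trans].
  have PS : P k.+1 = P k + h ord0 i *: e.
    apply/rowP => j; rewrite !mxE eqxx /= -addrA; congr (_ + _).
    rewrite ltnS leq_eqVlt -[(j == k :> nat)]/(j == i).
    by case: eqVneq => [->|_] /=; rewrite ?mulr1 ?mulr0 ?addr0// ltnn add0r.
  have -> : g (P k.+1) - g x = (g (P k.+1) - g (P k)) + (g (P k) - g x).
    by rewrite addrA subrK.
  apply: le_trans (ler_normD _ _) _.
  rewrite -natr1 mulrDl mul1r addrC; apply: lerD; first exact/ih/ltnW.
  apply: (@le_trans _ _ (L * `|h ord0 i|)); last by rewrite ler_wpM2l.
  have := @lipschitz_line (fun t => g (P k + t *: e)) (h ord0 i) L.
  rewrite scale0r addr0 -PS; apply => t ht.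
  have [|dg bg] := hg (P k + t *: e) _ i.
    move=> j; rewrite !mxE eqxx /=.
    rewrite [_ + _ - x _ _](_ : _ = (if (j < k)%N then h ord0 j else 0) + t * (j == i)%:R); last by ring.
    case: eqVneq => [->|ji].
      by rewrite /= ltnn add0r mulr1 (le_trans ht).
    by rewrite mulr0 addr0; case: ifP => _; rewrite ?normr0.
  have [d1 d2] := derivable_line dg.
  by split => //; rewrite d2.
rewrite (_ : x + h = P n); first exact: step.
by congr (_ + _); apply/rowP => i; rewrite mxE ltn_ord.
Qed.

Definition quad (c : R) p (M : R) x : 'rV[R]_n -> R :=
  fun y => c + edot p (y - x) + M * edot (y - x) (y - x).

Lemma is_derive_quad c p M x y v :
  is_derive y v (quad c p M x) (edot p v + 2 * M * edot (y - x) v).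
Proof.
set l := edot p v + 2 * M * edot (y - x) v.
have lim : (fun h : R => h^-1 *: ((quad c p M x \o shift y) (h *: v) - quad c p M x y)) @ 0^' --> (l : R^o).
  apply: (@cvg_trans _ ((fun h : R => l + h * (M * edot v v)) @ 0^')).
    apply: near_eq_cvg; near=> h.
    have h0 : h != 0 by near: h; exact: nbhs_dnbhs_neq.
    rewrite /= /shift /quad -[h *: v + y - x]addrA /l; move: (y - x) => z.
    rewrite !(edotDl, edotDr, edotZl, edotZr) (edotC v z) -[RHS]/(h^-1 * (_ - _)).
    by field.
  have -> : (l : R) = l + 0 * (M * edot v v) by rewrite mul0r addr0.
  apply: cvgD; first by rewrite mul0r addr0; exact: cvg_cst.
  apply: cvgMr_tmp; exact: nbhs_dnbhs.
split; last by apply/cvg_lim.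
by apply/cvg_ex; exists l.
Unshelve. all: by end_near. Qed.

Lemma continuous_edot p x : continuous (fun y => edot p (y - x)).
Proof.
move=> y; apply: (@cvg_rsum _ _ (nbhs y)) => i; apply: cvgMl_tmp.
apply: (@continuous_comp _ _ _ (fun y : 'rV[R]_n => y - x) (fun y : 'rV[R]_n => y ord0 i)).
  by apply: (@cvgB _ _ _ (nbhs y) _ id (cst x)); [exact: cvg_id|exact: cvg_cst].
exact: coord_continuous.
Qed.

Lemma continuous_quad c p M x : continuous (quad c p M x).
Proof.
move=> y; apply: (@cvgD _ _ _ (nbhs y) _ (fun y => c + edot p (y - x))).
  apply: (@cvgD _ _ _ (nbhs y) _ (cst c) (fun y => edot p (y - x))).
    exact: cvg_cst.
  exact: continuous_edot.
apply: cvgMl_tmp; apply: (@cvg_rsum _ _ (nbhs y)) => i.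
have ci : {for y, continuous (fun y => (y - x) ord0 i)}.
  apply: (@continuous_comp _ _ _ (fun y : 'rV[R]_n => y - x) (fun y : 'rV[R]_n => y ord0 i)).
    by apply: (@cvgB _ _ _ (nbhs y) _ id (cst x)); [exact: cvg_id|exact: cvg_cst].
  exact: coord_continuous.
exact: cvgM.
Qed.

(** The derivative is again a [quad], with zero quadratic part, so the same lemmas settle the second
    derivatives. *)
Lemma partial_quad i c p M x :
  partial i (quad c p M x) = quad (p ord0 i) ((2 * M) *: delta_mx ord0 i) 0 x.
Proof.
apply/funext => y; rewrite /partial.
have /@derive_val -> := is_derive_quad c p M x y (delta_mx ord0 i).
have ed z : edot z (delta_mx ord0 i) = z ord0 i.
  rewrite /edot (bigD1 i)//= mxE !eqxx mulr1 big1 ?addr0// => j ji.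
  by rewrite mxE (negbTE ji) mulr0.
by rewrite /quad mul0r addr0 !ed edotZl (edotC (delta_mx _ _)) ed.
Qed.

Lemma C2_quad N c p M x : C2_on N (quad c p M x).
Proof.
move=> y _; split; first exact: continuous_quad.
  move=> i; split; first by have [] := is_derive_quad c p M x y (delta_mx ord0 i).
  by rewrite partial_quad; exact: continuous_quad.
move=> i j; rewrite partial_quad; split.
  by have [] := is_derive_quad (p ord0 i) ((2 * M) *: delta_mx ord0 i) 0 x y (delta_mx ord0 j).
by rewrite partial_quad; exact: continuous_quad.
Qed.

Lemma le_double_sum (F : 'I_n -> 'I_n -> R) i j : (forall i j, 0 <= F i j) ->
  F i j <= \sum_i \sum_j F i j.
Proof.
move=> F0; rewrite (bigD1 i)//= (bigD1 j)//= -addrA lerDl addr_ge0// sumr_ge0// => k _.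
by rewrite sumr_ge0.
Qed.

(* [M] is a bound on the second partial derivatives near x, and the Lipschitz
   estimate along the coordinates is used twice instead of Taylor's formula. *)
Lemma C2_quad_bound N f x : (0 < n)%N -> open N -> N x -> C2_on N f ->
  exists p M r, [/\ 0 <= M, 0 < r, eball x r `<=` N &
    forall y, eball x r y -> f y <= quad (f x) p M x y].
Proof.
move=> n0 oN Nx C2; have [r1 r10 r1N] := nbhs_eball oN Nx.
pose L := 1 + \sum_(i < n) \sum_(j < n) `|partial j (partial i f) x|.
have L0 : 0 <= L by rewrite addr_ge0// sumr_ge0// => i _; rewrite sumr_ge0.
have bnd : \forall y \near x, forall i j, `|partial j (partial i f) y| <= L.
  apply: (@filter_forall _ _ (fun i => [set y | forall j, `|partial j (partial i f) y| <= L]) (nbhs x)) => i.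
  apply: (@filter_forall _ _ (fun j => [set y | `|partial j (partial i f) y| <= L]) (nbhs x)) => j.
  have [_ _ /(_ i j)[_ cij]] := C2 x Nx.
  move/cvgrPdist_le : (cij) => /(_ 1 ltr01); apply: filterS => y /= hy.
  rewrite -[partial j (partial i f) y](subrK (partial j (partial i f) x)).
  apply: le_trans (ler_normD _ _) _; apply: lerD; [rewrite distrC; exact: hy|].
  exact: (le_double_sum (F := fun i j => `|partial j (partial i f) x|)).
have [W [oO Ox] Obnd] : exists2 W : set 'rV[R]_n, open_nbhs x W & W `<=` [set y | forall i j, `|partial j (partial i f) y| <= L].
  have : nbhs x [set y | forall i j, `|partial j (partial i f) y| <= L] by exact: bnd.
  by rewrite nbhsE => -[W oW WL]; exists W.
have [r2 r20 r2N] := nbhs_eball oO Ox.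
(* The division makes every sup box of radius below [r] lie in both Euclidean balls. *)
pose r := Num.min r1 r2 / (Num.sqrt n%:R + 1).
have s1 : 0 < Num.sqrt n%:R + 1 :> R by rewrite ltr_wpDl// sqrtr_ge0.
have m0 : 0 < Num.min r1 r2 by rewrite lt_min r10.
have r0 : 0 < r by rewrite divr_gt0.
have box_eball rho y : rho < r -> sup_box x rho y -> eball x r1 y /\ W y.
  move=> rr hy; have rho0 : 0 <= rho by apply: le_trans (hy (Ordinal n0)).
  have : enorm (y - x) < Num.min r1 r2.
    apply: le_lt_trans (enorm_le_sup rho0 hy) _.
    apply: (@le_lt_trans _ _ (Num.sqrt n%:R * r)).
      by rewrite ler_wpM2l ?sqrtr_ge0// ltW.
    rewrite /r mulrA ltr_pdivrMr// mulrC ltr_pM2l//; lra.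
  by rewrite lt_min => /andP[h1 h2]; split => //; exact: r2N.
pose p : 'rV[R]_n := \row_i partial i f x.
(* With the linear part subtracted, the first partials vanish at [x]. Their own Lipschitz bound
   makes them at most [n L rho] at distance [rho], and [g] then varies by at most
   [n (n L rho) rho]. *)
pose g := fun y => f y - quad 0 p 0 x y.
have dg y i : N y -> derivable g y (delta_mx ord0 i : 'rV[R]_n) /\
    partial i g y = partial i f y - partial i f x.
  move=> Ny; have [_ /(_ i)[df _] _] := C2 y Ny.
  have dq := is_derive_quad 0 p 0 x y (delta_mx ord0 i).
  have [d1 d2] : is_derive y (delta_mx ord0 i : 'rV[R]_n) g (partial i f y - partial i (quad 0 p 0 x) y).
    apply: is_deriveB; first exact: derivableP.
    by apply: derivableP; case: dq.
  split => //; rewrite {1}/partial d2 partial_quad /quad mulr0 scale0r /edot big1 ?mul0r ?addr0 ?mxE//.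
  by move=> j _; rewrite mxE mul0r.
exists p, (n%:R * (L * n%:R)), r; split => //.
- by rewrite !mulr_ge0.
- move=> y yr; apply: r1N; apply: lt_le_trans yr _.
  apply: (@le_trans _ _ (Num.min r1 r2)); last by rewrite ge_min lexx.
  rewrite /r ler_pdivrMr// ler_pMr//; have := sqrtr_ge0 (n%:R : R); lra.
move=> y yr; pose h := y - x; have hyx : y = x + h by rewrite addrC subrK.
pose rho := enorm h; have rho0 : 0 <= rho := enorm_ge0 _.
have key : `|g (x + h) - g x| <= n%:R * ((n%:R * (L * rho)) * rho).
  apply: lipschitz_partial; last by move=> i; exact: coor_le_enorm.
  move=> z zr i; have [z1 zO] := box_eball _ _ yr zr.
  have [dz ->] := dg z i (r1N _ z1); split => //.
  have -> : z = x + (z - x) by rewrite addrC subrK.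
  apply: lipschitz_partial => // w wr j.
  have [w1 wO] := box_eball _ _ yr wr.
  have [_ _ /(_ i j)[dw _]] := C2 w (r1N _ w1).
  by split => //; exact: Obnd.
have gx : g x = f x by rewrite /g /quad subrr !edot0r mulr0 !addr0 subr0.
move: key; rewrite -hyx gx => /(le_trans (ler_norm _)).
rewrite /g /quad mul0r add0r addr0 -enorm_sqr -/h -/rho => key.
have -> : n%:R * (L * n%:R) * rho ^+ 2 = n%:R * (n%:R * (L * rho) * rho) by ring.
lra.
Qed.

End taylor.

(** * Integrability at infinity *)

Section weights.
Context {R : realType} (n : nat) (p : R).
Hypotheses (n0 : (0 < n)%N) (np : n%:R < p).
Local Notation leb := (@lebesgue_rV R n).
Implicit Types (v : 'rV[R]_n -> R) (x y w : 'rV[R]_n).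

Let p0 : 0 < p. Proof. by apply: lt_trans np; rewrite ltr0n. Qed.

Lemma measurable_enorm_powR q : measurable_fun setT (fun y : 'rV[R]_n => enorm y `^ q).
Proof. by apply: measurable_powRl; exact: measurable_enorm. Qed.

Lemma measurable_div_enorm_powR v q : measurable_fun setT v ->
  measurable_fun setT (fun y => (v y / enorm y `^ q)%:E).
Proof.
move=> mv; apply/measurable_EFinP; apply: measurable_funM => //.
by under eq_fun do rewrite -powRN; exact: measurable_enorm_powR.
Qed.

Lemma weight_gt0 y : 0 < 1 + enorm y `^ p.
Proof. by rewrite ltr_pwDl// powR_ge0. Qed.

Lemma measurable_weight : measurable_fun setT (fun y : 'rV[R]_n => (1 + enorm y `^ p)^-1).
Proof.
apply: (@eq_measurable_fun _ _ _ _ setT (fun y => (1 + enorm y `^ p) `^ (-1))).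
  by move=> y _; rewrite powR_inv1// ltW// weight_gt0.
by apply: measurable_powRl; apply: measurable_funD => //; exact: measurable_enorm_powR.
Qed.

Lemma integral_weight_fin : (\int[leb]_y ((1 + enorm y `^ p)^-1)%:E < +oo)%E.
Proof.
have mB : measurable (eball 0 1 : set 'rV[R]_n) := measurable_eball 0 1.
have mw D : measurable_fun D (fun y : 'rV[R]_n => ((1 + enorm y `^ p)^-1)%:E).
  by apply: measurable_funTS; apply/measurable_EFinP; exact: measurable_weight.
have w0 y : (0 <= ((1 + enorm y `^ p)^-1)%:E)%E.
  by rewrite lee_fin invr_ge0 ltW// weight_gt0.
rewrite -(setUv (eball 0 1 : set 'rV[R]_n)) ge0_integral_setU//; last 2 first.
- exact: measurableC.
- by rewrite disj_set2E setICr.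
apply: lte_add_pinfty.
  apply: (@le_lt_trans _ _ (\int[leb]_(y in eball 0 1) cst 1%E y)%E).
    apply: ge0_le_integral => //.
    move=> y _; rewrite lee_fin invf_le1 ?weight_gt0// lerDl.
    exact: powR_ge0.
  by rewrite integral_cst// mul1e [X in (X < _)%E]vballE ltry.
apply: (@le_lt_trans _ _ (\int[leb]_(y in ~` eball 0 1) (enorm y `^ (- p))%:E)%E).
  apply: ge0_le_integral => //.
  - exact: measurableC.
  - by apply: measurable_funTS; apply/measurable_EFinP; exact: measurable_enorm_powR.
  - move=> y; rewrite /eball /= subr0 => /negP; rewrite -leNgt => y1.
    have y0 : 0 < enorm y by exact: lt_le_trans y1.
    rewrite lee_fin powRN lef_pV2 ?posrE ?weight_gt0 ?powR_gt0//.
    by rewrite lerDr.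
by rewrite integral_enorm_powR_out// ltry.
Qed.

Lemma outer_integral_fin v x r : measurable_fun setT v -> (forall y, 0 <= v y) ->
  (\int[leb]_y (v y / (1 + enorm y `^ p))%:E < +oo)%E -> 0 < r ->
  (\int[leb]_(w in ~` eball 0 r) (v (x + w) * enorm w `^ (- p))%:E < +oo)%E.
Proof.
move=> mv v0 vfin r0.
(* For [|w| >= r] this gives [1 + |x + w|^p <= k |w|^p]: the first term because [1 <= r^(-p) |w|^p],
   the second because [|x + w| <= (|x|/r + 1) |w|]. *)
pose k := r `^ (- p) + (enorm x / r + 1) `^ p.
have k0 : 0 <= k by rewrite addr_ge0 ?powR_ge0.
have mf : measurable_fun setT (fun y : 'rV[R]_n => (v y / (1 + enorm y `^ p))%:E).
  by apply/measurable_EFinP; apply: measurable_funM => //; exact: measurable_weight.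
have f0 y : (0 <= (v y / (1 + enorm y `^ p))%:E)%E.
  by rewrite lee_fin mulr_ge0// invr_ge0 ltW// weight_gt0.
have mD : measurable (~` (eball 0 r : set 'rV[R]_n)).
  by apply: measurableC; exact: measurable_eball.
have mx : measurable_fun setT (fun w : 'rV[R]_n => w + x).
  by apply: measurable_rVD.
apply: (@le_lt_trans _ _ (\int[leb]_w (k%:E * (v (w + x) / (1 + enorm (w + x) `^ p))%:E))%E); last first.
  rewrite (ge0_integralZl leb measurableT (measurableT_comp mf mx) (fun w _ => f0 _)) ?lee_fin//.
  rewrite (ge0_integral_rVD mf f0 x).
  by apply: lte_mul_pinfty.
rewrite integral_mkcond; apply: ge0_le_integral => //.
- by move=> y _; apply: erestrict_ge0 => w _; rewrite lee_fin mulr_ge0 ?powR_ge0.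
- apply/(measurable_restrictT _ mD); apply: measurable_funTS; apply/measurable_EFinP.
  apply: measurable_funM; last exact: measurable_enorm_powR.
  by apply: (measurableT_comp mv); apply: measurable_rVD.
- by apply: measurable_funeM; exact: (measurableT_comp mf mx).
move=> w _; rewrite patchE; case: ifPn => [|_]; last by rewrite mule_ge0.
rewrite inE /eball /= subr0 => /negP; rewrite -leNgt => rw.
have w0 : 0 < enorm w by exact: lt_le_trans rw.
rewrite -EFinM lee_fin (addrC x w) mulrCA ler_wpM2l// powRN.
rewrite ler_pdivlMr ?weight_gt0// ler_pdivrMl ?powR_gt0//.
rewrite mulrDr; apply: lerD.
  rewrite powRN -ler_pdivrMr ?invr_gt0 ?powR_gt0// invrK mul1r.
  by apply: ge0_ler_powR; rewrite ?nnegrE ?(ltW p0) ?(ltW r0) ?enorm_ge0.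
rewrite -powRM ?enorm_ge0 ?addr_ge0 ?divr_ge0 ?enorm_ge0 ?(ltW r0)//.
apply: ge0_ler_powR; rewrite ?nnegrE ?(ltW p0) ?mulr_ge0 ?addr_ge0 ?divr_ge0 ?enorm_ge0 ?(ltW r0)//.
apply: le_trans (enormD _ _) _; rewrite mulrDr mulr1 addrC lerD2r.
by rewrite mulrCA ler_peMr ?enorm_ge0// ler_pdivlMr// mul1r.
Qed.

End weights.

(** * From the viscosity inequality to integrals *)

Definition pos_part {T} {R : realType} (f : T -> R) x := Num.max (f x) 0.
Definition neg_part {T} {R : realType} (f : T -> R) x := Num.max (- f x) 0.

Section parts.
Context {d} {T : measurableType d} {R : realType} (mu : {measure set T -> \bar R}).
Implicit Types f W : T -> R.

Lemma pos_part_ge0 f x : 0 <= pos_part f x.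
Proof. by rewrite /pos_part le_max lexx orbT. Qed.

Lemma neg_part_ge0 f x : 0 <= neg_part f x.
Proof. by rewrite /neg_part le_max lexx orbT. Qed.

Lemma pos_part_le f x : pos_part f x <= `|f x|.
Proof. by rewrite /pos_part ge_max ler_norm normr_ge0. Qed.

Lemma measurable_pos_part f : measurable_fun setT f -> measurable_fun setT (pos_part f).
Proof. by move=> mf; apply: measurable_maxr => //; exact: measurable_cst. Qed.

Lemma measurable_neg_part f : measurable_fun setT f -> measurable_fun setT (neg_part f).
Proof. by move=> mf; apply: measurable_maxr; [exact: measurableT_comp|exact: measurable_cst]. Qed.

(** No integrability is involved, since the integral is by definition the difference of the
    integrals of the two parts. *)
Lemma integral_pos_neg_part f W : (forall x, 0 <= W x) ->
  (\int[mu]_x (f x / W x)%:E =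
   \int[mu]_x (pos_part f x / W x)%:E - \int[mu]_x (neg_part f x / W x)%:E)%E.
Proof.
move=> W0; rewrite integralE; congr (_ - _)%E; apply: eq_integral => x _.
  by rewrite funeposE -EFin_max /pos_part maxr_pMl ?invr_ge0// mul0r.
by rewrite funenegE -EFinN -EFin_max /neg_part maxr_pMl ?invr_ge0// mul0r mulNr.
Qed.

End parts.

(** A finite bound on [A] excludes [+oo - +oo]; the real lower bound then forces [B] to be finite as
    well. *)
Lemma lee_subD_fin {R : realType} (e X : R) (A B : \bar R) :
  (0 <= A)%E -> (0 <= B)%E -> (e%:E <= A - B)%E -> (A <= X%:E)%E -> (e%:E + B <= X%:E)%E.
Proof.
case: A => [a| |]; case: B => [b| |] //= _ _; rewrite ?leeNy_eq// -EFinB -EFinD !lee_fin.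
by move=> h1 h2; rewrite -lerBrDr (le_trans h1)// lerB.
Qed.

(** * Shrinking the ball on which the paraboloid replaces the function *)

Section touching_integral.
Context {R : realType} (n : nat) (p : R).
Hypotheses (p2 : 2 < p) (pn2 : p < n%:R + 2).
Local Notation leb := (@lebesgue_rV R n).
Variables (T T' : 'M[R]_n) (TT' : T *m T' = 1%:M).
Variables (F : 'rV[R]_n -> R) (M e r1 : R).
Hypotheses (mF : measurable_fun setT F) (M0 : 0 <= M) (r10 : 0 < r1).
Hypothesis F_le : forall w, enorm w < r1 -> F w <= M * enorm w ^+ 2.
Hypothesis F_out : forall r, 0 < r ->
  (\int[leb]_(w in ~` eball 0 r) (`|F w| * enorm w `^ (- p))%:E < +oo)%E.
Hypothesis e_le : forall r, 0 < r -> r <= r1 ->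
  (e%:E <= \int[leb]_y ((if enorm (y *m T) < r then M * enorm (y *m T) ^+ 2
                         else F (y *m T)) / enorm y `^ p)%:E)%E.

Let p0 : 0 < p. Proof. by apply: lt_trans p2; rewrite ltr0n. Qed.

Let D r : set 'rV[R]_n := [set y | enorm (y *m T) < r].

Let mT : measurable_fun setT (fun y : 'rV[R]_n => y *m T).
Proof. exact: measurable_mulmxr. Qed.

Let mD r : measurable (D r).
Proof. by apply: measurable_setlt => //; exact: measurable_enorm. Qed.

Let W0 (t : R) (y : 'rV[R]_n) : 0 <= t -> (0 <= (t / enorm y `^ p)%:E)%E.
Proof. by move=> t0; rewrite lee_fin divr_ge0// powR_ge0. Qed.

Lemma weight_compare : exists2 a : R, 0 <= a &
  forall y : 'rV[R]_n, (enorm y `^ p)^-1 <= a * enorm (y *m T) `^ (- p).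
Proof.
have [a a0 ha] := enorm_mulmx_le T; exists (a `^ p); first exact: powR_ge0.
move=> y; have [->|y0] := eqVneq y 0.
  by rewrite enorm0 powR0 ?gt_eqF// invr0 mulr_ge0 ?powR_ge0.
have yT0 : 0 < enorm (y *m T).
  rewrite enorm_gt0; apply: contra_neq y0 => h.
  by rewrite -(mulmx1 y) -TT' mulmxA h mul0mx.
rewrite powRN ler_pdivlMr ?powR_gt0// ler_pdivrMl ?powR_gt0 ?enorm_gt0//.
rewrite -powRM ?enorm_ge0 ?(ltW a0)//.
by apply: ge0_ler_powR; rewrite ?nnegrE ?mulr_ge0 ?enorm_ge0 ?(ltW p0) ?(ltW a0)// mulrC.
Qed.

(** In the variable [w = y T] the integrand is at most a multiple of [|w|^(2-p)]. Because
    [p < n + 2] this is integrable near 0, and the positive exponent of [r] makes the contribution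
    of the paraboloid vanish with the radius. *)
Lemma inner_le : exists2 k : R, 0 <= k & forall r, 0 < r ->
  (\int[leb]_(y in D r) (M * enorm (y *m T) ^+ 2 / enorm y `^ p)%:E
     <= (k * r `^ (n%:R - (p - 2)))%:E)%E.
Proof.
have [a a0 ha] := weight_compare.
have [c c0 hc] := ge0_integral_mulmxr TT'.
pose K := vball n * ((p - 2) / (n%:R - (p - 2)) + 1) : R.
have K0 : 0 <= K.
  apply: mulr_ge0; first exact/ltW/vball_gt0.
  by apply: addr_ge0 => //; apply: divr_ge0; move: p2 pn2; lra.
exists (M * a * (c * K)); first by apply: mulr_ge0; apply: mulr_ge0.
move=> r r0.
pose h (w : 'rV[R]_n) := ((EFin \o (fun w : 'rV[R]_n => enorm w `^ (- (p - 2)))) \_ (eball 0 r)) w.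
have h0 w : (0 <= h w)%E by apply: erestrict_ge0 => z _; rewrite lee_fin powR_ge0.
have mh : measurable_fun setT h.
  apply/(measurable_restrictT _ (measurable_eball _ _)); apply: measurable_funTS.
  by apply/measurable_EFinP; exact: measurable_enorm_powR.
apply: (@le_trans _ _ (\int[leb]_y ((M * a)%:E * h (y *m T)))%E).
  rewrite integral_mkcond; apply: ge0_le_integral => //.
  - move=> y _; apply: erestrict_ge0 => z _.
    by rewrite lee_fin divr_ge0 ?powR_ge0// mulr_ge0// exprn_ge0// enorm_ge0.
  - apply/(measurable_restrictT _ (mD r)); apply: measurable_funTS; apply: measurable_div_enorm_powR.
    apply: measurable_funM => //; apply: measurable_funX; exact: measurable_enorm.
  - by apply: measurable_funeM; exact: (measurableT_comp mh mT).
  - move=> y _; rewrite patchE /h patchE; case: ifPn => yD; last first.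
      by rewrite mule_ge0// ?lee_fin ?mulr_ge0//; case: ifP => // _; rewrite lee_fin powR_ge0.
    move: yD; rewrite inE => yD; rewrite mem_set; last by rewrite /eball/= subr0.
    rewrite /= -EFinM lee_fin -(mulrA M a) -(mulrA M (_ ^+ 2)) ler_wpM2l//.
    apply: (@le_trans _ _ (enorm (y *m T) ^+ 2 * (a * enorm (y *m T) `^ (- p)))).
      by rewrite ler_wpM2l// exprn_ge0// enorm_ge0.
    rewrite mulrCA ler_wpM2l//.
    have := enorm_ge0 (y *m T); rewrite le_eqVlt => /orP[/eqP <-|t0].
      by rewrite expr0n mul0r powR_ge0.
    rewrite -(powR_mulrn _ (ltW t0)) -powRD; last by rewrite (gt_eqF t0) implybT.
    by rewrite opprB.
rewrite (ge0_integralZl leb measurableT (measurableT_comp mh mT) (fun w _ => h0 _)) ?lee_fin ?mulr_ge0//.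
rewrite hc// /h -integral_mkcond.
rewrite (_ : M * a * (c * K) * _ = (M * a) * (c * (r `^ (n%:R - (p - 2)) * K))); last by ring.
rewrite (EFinM (M * a)) (EFinM c); apply: lee_wpmul2l; first by rewrite lee_fin mulr_ge0.
apply: lee_wpmul2l; first by rewrite lee_fin.
by apply: integral_enorm_powR_in => //; move: p2 pn2; lra.
Qed.

Lemma outer_fin r : 0 < r ->
  (\int[leb]_(y in ~` D r) (`|F (y *m T)| / enorm y `^ p)%:E < +oo)%E.
Proof.
move=> r0; have [a a0 ha] := weight_compare.
have [c c0 hc] := ge0_integral_mulmxr TT'.
have mC : measurable (~` (eball 0 r : set 'rV[R]_n)).
  by apply: measurableC; exact: measurable_eball.
pose h (w : 'rV[R]_n) := ((EFin \o (fun w : 'rV[R]_n => `|F w| * enorm w `^ (- p))) \_ (~` eball 0 r)) w.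
have h0 w : (0 <= h w)%E.
  by apply: erestrict_ge0 => z _; rewrite lee_fin mulr_ge0// powR_ge0.
have mh : measurable_fun setT h.
  apply/(measurable_restrictT _ mC); apply: measurable_funTS.
  apply/measurable_EFinP; apply: measurable_funM; last exact: measurable_enorm_powR.
  exact: measurableT_comp.
apply: (@le_lt_trans _ _ (\int[leb]_y (a%:E * h (y *m T)))%E).
  rewrite integral_mkcond; apply: ge0_le_integral => //.
  - move=> y _; apply: erestrict_ge0 => z _.
    by rewrite lee_fin divr_ge0 ?powR_ge0.
  - apply/(measurable_restrictT _ (measurableC (mD r))); apply: measurable_funTS; apply: measurable_div_enorm_powR.
    by apply: measurableT_comp => //; exact: measurableT_comp.
  - by apply: measurable_funeM; exact: (measurableT_comp mh mT).
  - move=> y _; rewrite patchE /h patchE; case: ifPn => yD; last first.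
      rewrite mule_ge0 ?lee_fin//; case: ifP => // _.
      by rewrite lee_fin mulr_ge0// powR_ge0.
    move: yD; rewrite inE => yD; rewrite mem_set; last by rewrite /eball/= subr0.
    by rewrite /= -EFinM lee_fin mulrCA ler_wpM2l.
rewrite (ge0_integralZl leb measurableT (measurableT_comp mh mT) (fun w _ => h0 _)) ?lee_fin ?mulr_ge0//.
rewrite hc// /h -integral_mkcond.
apply: lte_mul_pinfty => //; rewrite ?lee_fin//.
apply: lte_mul_pinfty => //; rewrite ?lee_fin//.
exact: F_out.
Qed.

Let fp y : \bar R := (pos_part F (y *m T) / enorm y `^ p)%:E.
Let fm y : \bar R := (neg_part F (y *m T) / enorm y `^ p)%:E.

Let fp0 y : (0 <= fp y)%E. Proof. by rewrite W0// pos_part_ge0. Qed.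
Let fm0 y : (0 <= fm y)%E. Proof. by rewrite W0// neg_part_ge0. Qed.

Let mfp : measurable_fun setT fp.
Proof. by apply: measurable_div_enorm_powR; exact: (measurableT_comp (measurable_pos_part mF)). Qed.
Let mfm : measurable_fun setT fm.
Proof. by apply: measurable_div_enorm_powR; exact: (measurableT_comp (measurable_neg_part mF)). Qed.

Let phi y : \bar R := (M * enorm (y *m T) ^+ 2 / enorm y `^ p)%:E.

Let phi0 y : (0 <= phi y)%E.
Proof. by rewrite W0// mulr_ge0// exprn_ge0// enorm_ge0. Qed.

Let mphi : measurable_fun setT phi.
Proof.
by apply: measurable_div_enorm_powR; apply: measurable_funM => //; apply: measurable_funX; exact: measurable_enorm.
Qed.

Lemma touching_pos_fin : (\int[leb]_y fp y < +oo)%E.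
Proof.
rewrite -(setUv (D r1)) ge0_integral_setU//; last 3 first.
- exact: measurableC.
- exact: measurable_funTS.
- by rewrite disj_set2E setICr.
apply: lte_add_pinfty.
  have [k k0 hk] := inner_le.
  apply: le_lt_trans (ltry (k * r1 `^ (n%:R - (p - 2)))).
  apply: le_trans (hk _ r10); apply: ge0_le_integral => //.
  - exact: measurable_funTS.
  - exact: (measurable_funTS mphi).
  - move=> y Dy; rewrite lee_fin ler_wpM2r ?invr_ge0 ?powR_ge0//.
    rewrite /pos_part ge_max; apply/andP; split; first exact: F_le.
    by rewrite mulr_ge0// exprn_ge0// enorm_ge0.
apply: le_lt_trans (outer_fin r10); apply: ge0_le_integral => //.
- exact: measurableC.
- exact: measurable_funTS.
- apply: measurable_funTS; apply: measurable_div_enorm_powR.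
  by apply: measurableT_comp => //; exact: measurableT_comp.
- move=> y _; rewrite lee_fin ler_wpM2r ?invr_ge0 ?powR_ge0//; exact: pos_part_le.
Qed.

(** Test with a radius [rho <= r]. The patched integrand is nonnegative inside and unchanged
    outside, so the negative part keeps its integral over the complement of [D r], while the
    positive part gains at most [k rho^b]. *)
Lemma touching_neg_out r : 0 < r ->
  (e%:E + \int[leb]_(y in ~` D r) fm y <= \int[leb]_y fp y)%E.
Proof.
move=> r0.
have fpE : (\int[leb]_y fp y = (fine (\int[leb]_y fp y))%:E)%E.
  by rewrite fineK// ge0_fin_numE ?touching_pos_fin// integral_ge0.
have [k k0 hk] := inner_le.
have step rho : 0 < rho -> rho <= r1 ->
    (e%:E + \int[leb]_(y in ~` D rho) fm y <=
      (k * rho `^ (n%:R - (p - 2)) + fine (\int[leb]_y fp y))%:E)%E.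
  move=> rho0 rho1; have := e_le rho0 rho1.
  pose g y := if enorm (y *m T) < rho then M * enorm (y *m T) ^+ 2 else F (y *m T).
  have mg : measurable_fun setT g.
    apply: measurable_fun_ifT => //.
    - by apply: measurable_fun_ltr => //; exact: measurable_enorm.
    - by apply: measurable_funM => //; apply: measurable_funX; exact: measurable_enorm.
    - exact: measurableT_comp.
  rewrite -/(g _) => h.
  have {h} : (e%:E <= \int[leb]_y (pos_part g y / enorm y `^ p)%:E
     - \int[leb]_y (neg_part g y / enorm y `^ p)%:E)%E.
    rewrite -integral_pos_neg_part// => y; exact: powR_ge0.
  move=> h; apply: le_trans (lee_subD_fin _ _ h _).
  - apply: leeD2l; rewrite integral_mkcond; apply: ge0_le_integral => //.
    + by move=> y _; exact: erestrict_ge0.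
    + by apply/(measurable_restrictT _ (measurableC (mD rho))); exact: measurable_funTS.
    + by apply: measurable_div_enorm_powR; exact: measurable_neg_part.
    + move=> y _; rewrite patchE; case: ifPn => [|_]; last by rewrite W0// neg_part_ge0.
      by rewrite inE /D/= /fm /neg_part /g => /negP/negbTE ->.
  - by apply: integral_ge0 => y _; rewrite W0// pos_part_ge0.
  - by apply: integral_ge0 => y _; rewrite W0// neg_part_ge0.
  - rewrite EFinD -fpE.
    apply: (@le_trans _ _ (\int[leb]_y ((phi \_ (D rho)) y + fp y))%E).
      apply: ge0_le_integral => //.
      + by move=> y _; rewrite W0// pos_part_ge0.
      + by apply: measurable_div_enorm_powR; exact: measurable_pos_part.
      + apply: emeasurable_funD => //.
        by apply/(measurable_restrictT _ (mD rho)); exact: measurable_funTS.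
      + move=> y _; rewrite patchE; case: ifPn.
          rewrite inE /D/= => yD; rewrite -[leLHS]adde0; apply: leeD => //.
          rewrite lee_fin ler_wpM2r ?invr_ge0 ?powR_ge0//.
          by rewrite /pos_part /g yD max_l// mulr_ge0// exprn_ge0// enorm_ge0.
        by rewrite notin_setE /D/= => /negP/negbTE yD; rewrite add0e /fp /pos_part /g yD.
    rewrite ge0_integralD//; last 2 first.
    - by move=> y _; exact: erestrict_ge0.
    - by apply/(measurable_restrictT _ (mD rho)); exact: measurable_funTS.
    by rewrite -integral_mkcond; apply: leeD => //; exact: hk.
apply/lee_addgt0Pr => delta delta0.
set b := n%:R - (p - 2) in step hk.
have b0 : 0 < b by rewrite /b; move: pn2; lra.
(* The last entry gives [k rho^b <= k delta / (k + 1) <= delta]; the [k + 1] covers [k = 0]. *)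
pose rho := Num.min (Num.min r r1) ((delta / (k + 1)) `^ b^-1).
have k1 : 0 < k + 1 by rewrite ltr_wpDl.
have rho0 : 0 < rho by rewrite !lt_min r0 r10 powR_gt0// divr_gt0.
have rho1 : rho <= r1 by rewrite !ge_min lexx orbT.
apply: le_trans (le_trans _ (step _ rho0 rho1)) _.
  apply: leeD2l; apply: ge0_subset_integral => //.
  - exact: measurableC.
  - exact: measurableC.
  - exact: measurable_funTS.
  - move=> y; rewrite /D/= => /negP; rewrite -leNgt => ry; apply/negP; rewrite -leNgt.
    by apply: le_trans ry; rewrite /rho !ge_min lexx.
rewrite EFinD -fpE addeC; apply: leeD => //; rewrite lee_fin.
apply: (@le_trans _ _ (k * (delta / (k + 1)))).
  apply: ler_wpM2l => //.
  have -> : delta / (k + 1) = ((delta / (k + 1)) `^ b^-1) `^ b.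
    by rewrite -powRrM mulVf ?gt_eqF// powRr1// divr_ge0// ltW.
  apply: ge0_ler_powR; rewrite ?nnegrE ?(ltW rho0) ?powR_ge0 ?(ltW b0)//.
  by rewrite /rho ge_min lexx orbT.
by rewrite mulrCA ger_pMr// ler_pdivrMr// mul1r lerDl.
Qed.

Lemma touching_bound : (e%:E + \int[leb]_y fm y <= \int[leb]_y fp y)%E.
Proof.
have fpfin : (\int[leb]_y fp y)%E \is a fin_num.
  by rewrite ge0_fin_numE ?touching_pos_fin// integral_ge0.
pose G k : set 'rV[R]_n := ~` D k.+1%:R^-1.
have mG k : measurable (G k) by exact: measurableC.
(* The sets [G k] miss only the origin, where [fm] is 0: [0 ^ p = 0] there, and the inverse of 0 is
   0. *)
have bG : \bigcup_k G k = [set y | y != 0].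
  apply/seteqP; split => [y [k _]|y /= y0].
    rewrite /G /D/= => /negP; rewrite -leNgt; apply: contraTneq => ->.
    by rewrite mul0mx enorm0 -ltNge invr_gt0.
  have yT0 : 0 < enorm (y *m T).
    rewrite enorm_gt0; apply: contra_neq y0 => h.
    by rewrite -(mulmx1 y) -TT' mulmxA h mul0mx.
  have [k _ hk] := near_infty_natSinv_lt (PosNum yT0).
  by exists k => //; rewrite /G /D/=; apply/negP; rewrite -leNgt ltW//; apply: hk => /=.
have fmE : (\int[leb]_y fm y = \int[leb]_(y in \bigcup_k G k) fm y)%E.
  rewrite [RHS]integral_mkcond; apply: eq_integral => y _; rewrite patchE bG.
  case: ifPn => //; rewrite notin_setE /= => /negP; rewrite negbK => /eqP ->.
  by rewrite /fm enorm0 powR0 ?gt_eqF// invr0 mulr0.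
have cv : (\int[leb]_(y in G k) fm y)%E @[k --> \oo] --> (\int[leb]_y fm y)%E.
  rewrite fmE; apply: ge0_nondecreasing_set_cvg_integral => //.
  - move=> i j ij; apply/subsetPset => y; rewrite /G /D/= => /negP; rewrite -leNgt => h.
    apply/negP; rewrite -leNgt; apply: le_trans h.
    by rewrite lef_pV2 ?posrE// ler_nat.
  - by move=> k; exact: measurable_funTS.
rewrite -leeBrDl//; rewrite -(cvg_lim _ cv)//.
apply: lime_le; first by apply/cvg_ex; eexists; exact: cv.
by apply: nearW => k; rewrite leeBrDl//; apply: touching_neg_out; rewrite invr_gt0.
Qed.

End touching_integral.

(** * The viscosity inequality tested with a paraboloid *)

Section viscosity.
Context {R : realType} (n : nat) (s : R).
Hypotheses (n1 : (1 < n)%N) (s01 : 0 < s < 1).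
Local Notation leb := (@lebesgue_rV R n).
Local Notation p := (n%:R + 2 * s).
Implicit Types (u : 'rV[R]_n -> R) (x y w : 'rV[R]_n) (A : 'M[R]_n).

Let n0 : (0 < n)%N. Proof. exact: ltnW. Qed.
Let n2 : 2 <= n%:R :> R. Proof. by rewrite ler_nat. Qed.
Let np : n%:R < p. Proof. move: s01 => /andP[]; lra. Qed.
Let p2 : 2 < p. Proof. move: s01 n2 => /andP[]; lra. Qed.
Let pn2 : p < n%:R + 2. Proof. move: s01 n2 => /andP[]; lra. Qed.

Lemma measurable_second_diff u x : measurable_fun setT u ->
  measurable_fun setT (second_diff u x).
Proof.
move=> mu; apply: measurable_funB => //.
apply: measurable_funD; apply: (measurableT_comp mu).
  by apply: measurable_rVD.
by apply: measurable_rVB.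
Qed.

Lemma second_diff_out_fin u x r : L1_omega s u -> 0 < r ->
  (\int[leb]_(w in ~` eball 0 r) (`|second_diff u x w| * enorm w `^ (- p))%:E < +oo)%E.
Proof.
move=> [mu ufin] r0.
have mD : measurable (~` (eball 0 r : set 'rV[R]_n)).
  by apply: measurableC; exact: measurable_eball.
pose f1 w := (`|u (x + w)| * enorm w `^ (- p))%:E.
(* Writing [x - w] as [- (- x + w)] lets the bound for translates apply to the function [|u (- y)|]
   at the point [- x]. *)
pose f2 w := (`|u (- (- x + w))| * enorm w `^ (- p))%:E.
pose f3 w := (`|2 * u x| * enorm w `^ (- p))%:E.
have mu1 : measurable_fun setT (fun y : 'rV[R]_n => `|u y|) by exact: measurableT_comp.
have mu2 : measurable_fun setT (fun y : 'rV[R]_n => `|u (- y)|).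
  by apply: (measurableT_comp mu1); apply: measurable_rVN.
have mpw (v : 'rV[R]_n -> R) : measurable_fun setT v ->
    measurable_fun (~` (eball 0 r : set 'rV[R]_n)) (fun w : 'rV[R]_n => (v w * enorm w `^ (- p))%:E).
  move=> mv; apply: measurable_funTS; apply/measurable_EFinP; apply: measurable_funM => //.
  exact: measurable_enorm_powR.
have m1 : measurable_fun (~` (eball 0 r : set 'rV[R]_n)) f1.
  by apply: mpw; apply: (measurableT_comp mu1); apply: measurable_rVD.
have m2 : measurable_fun (~` (eball 0 r : set 'rV[R]_n)) f2.
  by apply: mpw; apply: (measurableT_comp mu2); apply: measurable_rVD.
have m3 : measurable_fun (~` (eball 0 r : set 'rV[R]_n)) f3 by exact: mpw.
have f10 w : (0 <= f1 w)%E by rewrite lee_fin mulr_ge0// powR_ge0.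
have f20 w : (0 <= f2 w)%E by rewrite lee_fin mulr_ge0// powR_ge0.
have f30 w : (0 <= f3 w)%E by rewrite lee_fin mulr_ge0// powR_ge0.
apply: (@le_lt_trans _ _ (\int[leb]_(w in ~` eball 0 r) (f1 w + f2 w + f3 w))%E).
  apply: ge0_le_integral => //.
  - by move=> w _; rewrite lee_fin mulr_ge0// powR_ge0.
  - by apply: mpw; apply: measurableT_comp => //; exact: measurable_second_diff.
  - by apply: emeasurable_funD => //; exact: emeasurable_funD.
  - move=> w _; rewrite -!EFinD lee_fin -!mulrDl ler_wpM2r ?powR_ge0//.
    rewrite opprD opprK /second_diff.
    by apply: le_trans (ler_normB _ _) _; rewrite lerD2r ler_normD.
rewrite ge0_integralD//; last 2 first.
- by move=> w _; rewrite adde_ge0.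
- exact: emeasurable_funD.
rewrite ge0_integralD//.
apply: lte_add_pinfty; first apply: lte_add_pinfty.
- exact: (@outer_integral_fin _ n p n0 np (fun y => `|u y|)).
- apply: (@outer_integral_fin _ n p n0 np (fun y => `|u (- y)|)) => //.
  pose g y : \bar R := (`|u y| / (1 + enorm y `^ p))%:E.
  have mg : measurable_fun setT g.
    by apply/measurable_EFinP; apply: measurable_funM => //; exact: measurable_weight.
  have g0 y : (0 <= g y)%E by rewrite lee_fin divr_ge0// ltW// weight_gt0.
  have gfin : (\int[leb]_y g (- y)%R < +oo)%E by rewrite (ge0_integral_rVN mg g0).
  apply: le_lt_trans gfin; rewrite le_eqVlt; apply/orP; left; apply/eqP.
  by apply: eq_integral => y _; rewrite /g enormN.
- apply: (@outer_integral_fin _ n p n0 np (fun=> `|2 * u x|) x) => //.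
  under eq_integral do rewrite EFinM.
  rewrite ge0_integralZl//.
  + by apply: lte_mul_pinfty => //; exact: integral_weight_fin.
  + apply/measurable_EFinP; exact: measurable_weight.
  + by move=> y _; rewrite lee_fin invr_ge0 ltW// weight_gt0.
Qed.

(** The ball is symmetric about [x], so the values at [x + w] and [x - w] are replaced together, and
    the linear part of the paraboloid cancels. *)
Lemma second_diff_quad_patch u x r c q M w : c = u x -> 0 < r ->
  second_diff (patch u (eball x r) (quad c q M x)) x w =
  if enorm w < r then 2 * M * enorm w ^+ 2 else second_diff u x w.
Proof.
move=> cu r0; rewrite /second_diff /patch.
have -> : (x \in eball x r) = true by rewrite mem_set// /eball/= subrr enorm0.
have -> : (x + w \in eball x r) = (enorm w < r).
  by apply/idP/idP; rewrite inE /eball/= addrAC subrr add0r.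
have -> : (x - w \in eball x r) = (enorm w < r).
  by apply/idP/idP; rewrite inE /eball/= addrAC subrr add0r enormN.
rewrite /quad ![x + _ - x]addrAC subrr !add0r !edot0r mulr0 !addr0 cu.
case: ifP => // _; rewrite -[- w]scaleN1r !(edotZr, edotZl) enorm_sqr; ring.
Qed.

Lemma sym_posdef_inv A : sym_posdef A -> A^T *m invmx A = 1%:M.
Proof.
move=> [symA posA]; have uA : A \in unitmx.
  rewrite unitmxE unitfE; apply/negP => /det0P[v v0 vA].
  by have := posA v v0; rewrite vA mul0mx mxE ltxx.
by rewrite symA mulmxV.
Qed.

Lemma Cns_ge0 : 0 <= Cns n s.
Proof.
have /andP[s0 s1] := s01.
rewrite divr_ge0// !mulr_ge0 ?powR_ge0 ?Gamma_ge0//; exact: ltW.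
Qed.

Section at_point.
Variables (Omega : set 'rV[R]_n) (u : 'rV[R]_n -> R) (eta : R) (x : 'rV[R]_n).
Hypotheses (eta0 : 0 < eta) (uL1 : L1_omega s u).
Hypotheses (uv : viscosity_ge s Omega u eta) (ux : touchable Omega u x).

(** One paraboloid, with a fixed [M], is admissible on all smaller balls; this is what permits the
    radius to tend to 0. *)
Lemma touching_quad : exists q M r1, [/\ 0 <= M, 0 < r1,
  forall r, 0 < r -> r <= r1 -> touches_from_above Omega u x (eball x r) (quad (u x) q M x) &
  forall w, enorm w < r1 -> second_diff u x w <= 2 * M * enorm w ^+ 2].
Proof.
have [Ox [N [psi [[oN NO] Nx C2psi psix upsi]]]] := ux.
have [q [M [r [M0 r0 rN psiq]]]] := C2_quad_bound n0 oN Nx C2psi.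
have uq y : eball x r y -> y != x -> u y < quad (u x) q (M + 1) x y.
  move=> yr yx; apply: lt_le_trans (upsi _ (rN _ yr) yx) _.
  apply: le_trans (psiq _ yr) _; rewrite psix /quad lerD2l ler_wpM2r ?edot_ge0//.
  by rewrite lerDl.
exists q, (M + 1), r; split => //.
- by rewrite addr_ge0.
- move=> r' r'0 r'r; split => //.
  + split; first exact: open_eball.
    by move=> y yr; apply: NO; apply: rN; exact: lt_le_trans r'r.
  + by rewrite /eball/= subrr enorm0.
  + exact: C2_quad.
  + by rewrite /quad subrr !edot0r mulr0 !addr0.
  + by move=> y yr; apply: uq; exact: lt_le_trans r'r.
- move=> w wr; have := @second_diff_quad_patch u x r (u x) q (M + 1) w erefl r0.
  rewrite wr => <-.
  have le_patch y : u y <= patch u (eball x r) (quad (u x) q (M + 1) x) y.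
    rewrite /patch; case: ifPn => //; rewrite inE => yr.
    have [->|yx] := eqVneq y x; last exact/ltW/uq.
    by rewrite /quad subrr !edot0r mulr0 !addr0.
  have -> : second_diff u x w = u (x + w) + u (x - w) - 2 * patch u (eball x r) (quad (u x) q (M + 1) x) x.
    rewrite /patch mem_set; last by rewrite /eball/= subrr enorm0.
    by rewrite /quad subrr !edot0r mulr0 !addr0.
  by rewrite lerD2r lerD.
Qed.

(** Positivity is read off from the viscosity inequality: a zero constant would make [Kop] vanish,
    against [eta > 0]. *)
Lemma Cns_gt0 : 0 < Cns n s.
Proof.
rewrite lt_neqAle Cns_ge0 andbT; apply/negP => /eqP C0.
have [q [M [r [M0 r0 tq _]]]] := touching_quad.
have := uv (proj1 ux) (tq _ r0 (lexx _)).
by rewrite /Kop -C0 mul0r mul0e lee_fin leNgt eta0.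
Qed.

Let e := eta / (Cns n s / 2).

Lemma viscosity_integral A : A2 A ->
  (\int[leb]_y (pos_part (second_diff u x) (y *m A^T) / enorm y `^ p)%:E < +oo)%E /\
  (e%:E + \int[leb]_y (neg_part (second_diff u x) (y *m A^T) / enorm y `^ p)%:E <=
   \int[leb]_y (pos_part (second_diff u x) (y *m A^T) / enorm y `^ p)%:E)%E.
Proof.
move=> AA; have T1 := sym_posdef_inv (proj1 AA).
have C0 : 0 < Cns n s / 2 by rewrite divr_gt0// Cns_gt0.
have [q [M [r1 [M0 r10 tq sq]]]] := touching_quad.
have mF := measurable_second_diff x (proj1 uL1).
have M2 : 0 <= 2 * M by rewrite mulr_ge0.
have e_le r : 0 < r -> r <= r1 -> (e%:E <=
    \int[leb]_y ((if enorm (y *m A^T) < r then 2 * M * enorm (y *m A^T) ^+ 2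
                  else second_diff u x (y *m A^T)) / enorm y `^ p)%:E)%E.
  move=> r0 rr1; have := uv (proj1 ux) (tq _ r0 rr1).
  rewrite /Kop -lee_pdivrMl// -EFinM mulrC -/e => /le_trans; apply.
  apply: ereal_inf_lbound; exists A => //; apply: eq_integral => y _.
  by rewrite second_diff_quad_patch.
split.
  apply: (touching_pos_fin p2 pn2 T1 mF M2 r10 sq) => r r0.
  exact: second_diff_out_fin.
apply: (touching_bound p2 pn2 T1 mF M2 r10 sq _ e_le) => r r0.
exact: second_diff_out_fin.
Qed.

Lemma viscosity_classical : (eta%:E <= Kop s u x)%E.
Proof.
have C0 : 0 < Cns n s / 2 by rewrite divr_gt0// Cns_gt0.
rewrite /Kop -lee_pdivrMl// -EFinM mulrC -/e.
apply: le_ereal_inf_tmp => _ [A AA <-].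
rewrite integral_pos_neg_part; last by move=> y; exact: powR_ge0.
have [pfin en] := viscosity_integral AA.
rewrite leeBrDr//.
rewrite ge0_fin_numE; last by apply: integral_ge0 => y _; rewrite lee_fin divr_ge0 ?powR_ge0 ?neg_part_ge0.
apply: le_lt_trans pfin; apply: le_trans en; rewrite leeDr// lee_fin divr_ge0 ?ltW//.
Qed.

End at_point.
End viscosity.

(** * Averaging the second-difference inequality *)

Lemma ge0_integral_even {R : realType} (f : R -> R) : measurable_fun setT f ->
  (forall r, 0 <= f r) -> (forall r, f (- r) = f r) ->
  (\int[lebesgue_measure]_r (f r)%:E =
   2%:E * \int[lebesgue_measure]_(r in `]0%R, +oo[) (f r)%:E)%E.
Proof.
move=> mf f0 fN; have mE D : measurable_fun D (fun r => (f r)%:E).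
  by apply: measurable_funTS; exact/measurable_EFinP.
rewrite -(setUv (`[0, +oo[ : set R)) ge0_integral_setU//; last 4 first.
- by apply: measurableC; exact: measurable_itv.
- exact: mE.
- by move=> x _; rewrite lee_fin.
- by rewrite disj_set2E setICr.
rewrite (setCitvr (BLeft (0 : R))) [X in (_ + X)%E]integral_itv_bndo_bndc; last exact: measurable_funTS.
rewrite [X in (X + _)%E](ge0_integration_by_substitution0 (mE setT)); last by move=> r; rewrite lee_fin.
under [X in (X + _)%E]eq_integral do rewrite fN.
have -> : (\int[lebesgue_measure]_(r in `]0%R, +oo[) (f r)%:E =
  \int[lebesgue_measure]_(r in `]-oo, 0%R]) (f r)%:E)%E.
  rewrite integral_itv_obnd_cbnd; last exact: measurable_funTS.
  rewrite (ge0_integration_by_substitution0 (mE setT)); last by move=> r; rewrite lee_fin.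
  by under eq_integral do rewrite fN.
by rewrite mule_natl mule2n.
Qed.

(** * Line integrals integrated over balls *)

Section radial.
Context {R : realType} (n : nat) (s : R).
Hypothesis s0 : 0 < s.
Local Notation leb := (@lebesgue_rV R n).
Local Notation mu := (@lebesgue_measure R).
Local Notation p := (n%:R + 2 * s).
Implicit Types (f : 'rV[R]_n -> R) (y z w : 'rV[R]_n).

Let p0 : 0 < p. Proof. by rewrite ltr_wpDl// mulr_gt0. Qed.

Definition line_integral f z : \bar R := \int[mu]_r (f (r *: z) / `|r| `^ (1 + 2 * s))%:E.

Lemma measurable_line f : measurable_fun setT f ->
  measurable_fun setT (fun q : 'rV[R]_n * measurableTypeR R =>
    (f (q.2 *: q.1) / `|q.2| `^ (1 + 2 * s))%:E).
Proof.
move=> mf; apply/measurable_EFinP; apply: measurable_funM.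
  by apply: (measurableT_comp mf); apply: measurable_rVZ; [exact: measurable_snd|exact: measurable_fst].
apply: (@eq_measurable_fun _ _ _ _ setT (fun q : 'rV[R]_n * measurableTypeR R => `|q.2| `^ (- (1 + 2 * s)))).
  by move=> q _; rewrite powRN.
by apply: measurable_powRl; apply: measurableT_comp => //; exact: measurable_snd.
Qed.

Lemma line_integral_ge0 f z : (forall w, 0 <= f w) -> (0 <= line_integral f z)%E.
Proof. by move=> f0; apply: integral_ge0 => r _; rewrite lee_fin divr_ge0// powR_ge0. Qed.

Lemma measurable_line_integral f : measurable_fun setT f -> (forall w, 0 <= f w) ->
  measurable_fun setT (line_integral f).
Proof.
move=> mf f0; apply: (measurable_fun_fubini_tonelli_F (m2 := mu) _ (measurable_line mf)).
by move=> q; rewrite lee_fin divr_ge0// powR_ge0.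
Qed.

Lemma line_integralN f z : (forall w, f (- w) = f w) ->
  line_integral f (- z) = line_integral f z.
Proof. by move=> fN; apply: eq_integral => r _; rewrite scalerN fN. Qed.

Lemma integral_line_integral f rho : measurable_fun setT f -> (forall w, 0 <= f w) ->
  (forall w, f (- w) = f w) -> f 0 = 0 -> 0 < rho ->
  (\int[leb]_(z in cball rho) line_integral f z =
   (rho `^ p * (2 / p))%:E * \int[leb]_w (f w / enorm w `^ p)%:E)%E.
Proof.
move=> mf f0 fN f00 rho0.
(* Evenness restricts to [r > 0]. The substitution [w = r z] then carries [K1] to [K2]: the Jacobian
   [r^(-n)] and the weight [r^(-1-2s)] combine to [r^(-p-1)], and [|z| <= rho] becomes
   [|w| <= rho r]. *)
pose K1 (q : 'rV[R]_n * measurableTypeR R) : \bar R :=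
  if (enorm q.1 <= rho) && (0 < q.2) then (f (q.2 *: q.1) / `|q.2| `^ (1 + 2 * s))%:E else 0%E.
pose K2 (q : 'rV[R]_n * measurableTypeR R) : \bar R :=
  if (enorm q.1 <= rho * q.2) && (0 < q.2) then (f q.1 * q.2 `^ (- p - 1))%:E else 0%E.
have mpos : measurable_fun setT (fun q : 'rV[R]_n * measurableTypeR R => 0 < q.2).
  by apply: measurable_fun_ltr => //; exact: measurable_snd.
have K10 q : (0 <= K1 q)%E.
  by rewrite /K1; case: ifP => // _; rewrite lee_fin divr_ge0// powR_ge0.
have K20 q : (0 <= K2 q)%E.
  by rewrite /K2; case: ifP => // _; rewrite lee_fin mulr_ge0// powR_ge0.
have mK1 : measurable_fun setT K1.
  apply: measurable_fun_ifT => //; last exact: measurable_line.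
  apply: measurable_and => //; apply: measurable_fun_ler => //.
  by apply: measurable_enorm; exact: measurable_fst.
have mK2 : measurable_fun setT K2.
  apply: measurable_fun_ifT => //.
    apply: measurable_and => //; apply: measurable_fun_ler => //.
      by apply: measurable_enorm; exact: measurable_fst.
    by apply: measurable_funM => //; exact: measurable_snd.
  apply/measurable_EFinP; apply: measurable_funM.
    by apply: (measurableT_comp mf); exact: measurable_fst.
  by apply: measurable_powRl; exact: measurable_snd.
have JE z : line_integral f z = (2%:E * \int[mu]_(r in `]0%R, +oo[) (f (r *: z) / `|r| `^ (1 + 2 * s))%:E)%E.
  apply: (@ge0_integral_even R (fun r => f (r *: z) / `|r| `^ (1 + 2 * s))).
  - by have /measurable_EFinP := measurableT_comp (measurable_line mf) (pair1_measurable z).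
  - by move=> r; rewrite divr_ge0// powR_ge0.
  - by move=> r; rewrite scaleNr fN normrN.
have L1 : (\int[leb]_(z in cball rho) line_integral f z = 2%:E * \int[leb]_z \int[mu]_r K1 (z, r))%E.
  rewrite -ge0_integralZl//; last 2 first.
  - by apply: (measurable_fun_fubini_tonelli_F (m2 := mu)).
  - by move=> z _; exact: integral_ge0.
  rewrite [LHS]integral_mkcond; apply: eq_integral => z _.
  rewrite patchE /K1 /=; case: ifPn => zr; last first.
    move: zr; rewrite notin_setE /cball/= => /negP/negbTE ->.
    by rewrite integral0 mule0.
  move: zr; rewrite inE /cball/= => ->; rewrite JE; congr (_ * _)%E.
  rewrite (@integral_if _ (measurableTypeR R) R mu (fun r : R => 0 < r)).
  by congr integral; apply/seteqP; split => r; rewrite /= in_itv/= andbT.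
have step r : (\int[leb]_z K1 (z, r) = \int[leb]_w K2 (w, r))%E.
  have [r0|r0] := ltP 0 r; last first.
    have r0' : (0 < r) = false by rewrite ltNge r0.
    by rewrite !integral0_eq// => w _; rewrite /K1 /K2 /= r0' andbF.
  have mK2r : measurable_fun setT (fun w : 'rV[R]_n => K2 (w, r)).
    exact: (measurableT_comp mK2 (pair2_measurable r)).
  have -> : (\int[leb]_w K2 (w, r) = (r ^+ n)%:E * \int[leb]_z K2 (r *: z, r))%E.
    rewrite (ge0_integral_rVZ mK2r _ r0)// muleA -EFinM -exprMn mulfV ?gt_eqF//.
    by rewrite expr1n mul1e.
  rewrite -ge0_integralZl//; last 2 first.
  - apply: (measurableT_comp mK2r); apply: measurable_rVZ => //.
  - by rewrite lee_fin exprn_ge0// ltW.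
  apply: eq_integral => z _; rewrite /K1 /K2 /= r0 !andbT enormZ (ger0_norm (ltW r0)).
  rewrite (mulrC rho) ler_pM2l//; case: ifP => _; last by rewrite mule0.
  rewrite -EFinM; congr EFin; rewrite mulrCA; congr (_ * _).
  rewrite -powRN -(powR_mulrn _ (ltW r0)) -powRD; last by rewrite (gt_eqF r0) implybT.
  by congr (_ `^ _); ring.
rewrite L1 (fubini_tonelli (m1 := leb) (m2 := mu) K1)//.
under eq_integral do rewrite step.
rewrite -(fubini_tonelli (m1 := leb) (m2 := mu) K2)//.
have inner w : (\int[mu]_r K2 (w, r) = (rho `^ p / p)%:E * (f w / enorm w `^ p)%:E)%E.
  (* At [w = 0] the power would be integrated down to [r = 0] and diverge; the factor [f 0 = 0]
     removes it. *)
  have [->|w0] := eqVneq w 0.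
    rewrite /K2 /= f00 mul0r mule0; under eq_integral do rewrite mul0r.
    by apply: integral0_eq => r _; case: ifP.
  have ew : 0 < enorm w by rewrite enorm_gt0.
  rewrite /K2 /= (@integral_if _ (measurableTypeR R) R mu (fun r : R => (enorm w <= rho * r) && (0 < r))).
  have -> : [set r : R | (enorm w <= rho * r) && (0 < r)] = `[enorm w / rho, +oo[%classic.
    apply/seteqP; split => r; rewrite /= in_itv/= andbT ler_pdivrMr// mulrC; first by case/andP.
    move=> h; rewrite h /=; have := lt_le_trans ew h; by rewrite pmulr_rgt0.
  rewrite integral_cpowR_pinfty// ?divr_gt0// -EFinM; congr EFin.
  have e : enorm w `^ p = (enorm w / rho) `^ p * rho `^ p.
    by rewrite -powRM ?divr_ge0 ?enorm_ge0 ?(ltW rho0)// divfK ?gt_eqF.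
  have h1 : 0 < (enorm w / rho) `^ p by rewrite powR_gt0// divr_gt0.
  have h2 : 0 < rho `^ p by rewrite powR_gt0.
  by rewrite e powRN; field; rewrite !gt_eqF.
under eq_integral do rewrite inner.
rewrite ge0_integralZl//; last 3 first.
- exact: measurable_div_enorm_powR.
- by move=> w _; rewrite lee_fin divr_ge0// powR_ge0.
- by rewrite lee_fin divr_ge0 ?powR_ge0// ltW.
rewrite muleA -EFinM; congr (_%:E * _)%E; ring.
Qed.

End radial.

(* This holds for infinite values, with +oo - +oo = -oo: no almost everywhere
   finiteness of the line integrals is needed to separate positive and negative
   parts. *)
Lemma lee_rearrange {R : realType} (t k : R) (a a' b b' c c' : \bar R) : 0 < t ->
  (0 <= a)%E -> (0 <= a')%E -> (0 <= b)%E -> (0 <= b')%E -> (0 <= c)%E -> (0 <= c')%E ->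
  (t%:E * (a - a') + t%:E * (b - b') - 2%:E * (t%:E * (c - c')) <= k%:E)%E ->
  (t%:E * (a + b) <= k%:E + t%:E * (a' + b') + (2 * t)%:E * c)%E.
Proof.
move=> t0; have t0E : (0 < t%:E)%E by rewrite lte_fin.
have two0 : (0 < 2%:E :> \bar R)%E by rewrite lte_fin.
have tt0 : (0 < (2 * t)%:E :> \bar R)%E by rewrite lte_fin mulr_gt0.
have E := (gt0_muley t0E, gt0_muleNy t0E, gt0_muley two0, gt0_muleNy two0, gt0_muley tt0).
case: a => [a| |]//; case: a' => [a'| |]//; case: b => [b| |]//; case: b' => [b'| |]//;
 case: c => [c| |]//; case: c' => [c'| |]//; rewrite /= ?E /= ?leye_eq ?leey//=; try by rewrite ?E.
rewrite -!(EFinD, EFinM) !lee_fin => _ _ _ _ _ c'0 h.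
have : 0 <= t * c' by rewrite mulr_ge0// ltW.
move: h; rewrite !mulrDr !mulrN; lra.
Qed.

(** The measures of the sections of a null set integrate to 0, so almost every section is null. *)
Lemma ae_prod d1 d2 (T1 : measurableType d1) (T2 : measurableType d2) (R : realType)
  (m1 : {sigma_finite_measure set T1 -> \bar R})
  (m2 : {sigma_finite_measure set T2 -> \bar R}) (P : T1 * T2 -> Prop) :
  {ae (m1 \x m2)%E, forall q, P q} -> {ae m1, forall x, {ae m2, forall y, P (x, y)}}.
Proof.
move=> [A [mA A0 PA]].
have mx := measurable_fun_xsection m2 mA.
have : (\int[m1]_x `|(m2 \o xsection A) x| = 0)%E.
  by rewrite -[RHS]A0; apply: eq_integral => x _; rewrite gee0_abs.
move/(ae_eq_integral_abs m1 measurableT mx); apply: filterS => x /(_ I) /= mx0.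
exists (xsection A x); split => //; first exact: measurable_xsection.
by move=> y Py; rewrite /xsection/= inE; exact: PA.
Qed.

(** * The bound for [P - Q] *)

Section upper.
Context {R : realType} (n : nat) (s : R).
Hypotheses (n0 : (0 < n)%N) (s01 : 0 < s < 1).
Local Notation leb := (@lebesgue_rV R n).
Local Notation mu := (@lebesgue_measure R).
Local Notation p := (n%:R + 2 * s).
Implicit Types (f : 'rV[R]_n -> R) (y z w : 'rV[R]_n).

Let s0 : 0 < s. Proof. by case/andP: s01. Qed.
Let p0 : 0 < p. Proof. by rewrite ltr_wpDl// mulr_gt0. Qed.

(** The averaging formula is applied to the indicator of the complement of the unit ball: its line
    integral is [|z|^(2s) / s], and its weighted integral over the whole space is [n |B| / (2s)]. *)
Lemma integral_enorm_powR_cball :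
  (\int[leb]_(z in cball 1) (enorm z `^ (2 * s))%:E = (n%:R * vball n / p)%:E)%E.
Proof.
pose f w : R := if enorm w < 1 then 0 else 1.
have f0 w : 0 <= f w by rewrite /f; case: ifP.
have mf : measurable_fun setT f.
  by apply: measurable_fun_ifT => //; apply: measurable_fun_ltr => //; exact: measurable_enorm.
have fN w : f (- w) = f w by rewrite /f enormN.
have f00 : f 0 = 0 by rewrite /f enorm0 ltr01.
have lineE z : (line_integral s f z = (enorm z `^ (2 * s) / s)%:E)%E.
  have mz : measurable_fun setT (fun r : R => f (r *: z) / `|r| `^ (1 + 2 * s)).
    by have /measurable_EFinP := measurableT_comp (measurable_line s mf) (pair1_measurable z).
  rewrite /line_integral (ge0_integral_even mz); last 2 first.
  - by move=> r; rewrite divr_ge0// powR_ge0.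
  - by move=> r; rewrite scaleNr fN normrN.
  have [->|z0] := eqVneq z 0.
    rewrite enorm0 powR0 ?gt_eqF ?mulr_gt0// mul0r.
    rewrite integral0_eq ?mule0// => r _; rewrite scaler0 f00 mul0r//.
  have ez : 0 < enorm z by rewrite enorm_gt0.
  have -> : (\int[mu]_(r in `]0%R, +oo[) (f (r *: z) / `|r| `^ (1 + 2 * s))%:E =
     \int[mu]_(r in `[((enorm z)^-1)%R, +oo[) (1 * r `^ (- (2 * s) - 1))%:E)%E.
    rewrite integral_mkcond [RHS]integral_mkcond; apply: eq_integral => r _.
    rewrite !patchE !mem_setE !in_itv/= !andbT; have [r0|r0] := ltP 0 r; last first.
      by rewrite leNgt (le_lt_trans r0) ?invr_gt0.
    rewrite /f enormZ ger0_norm ?(ltW r0)// -ltr_pdivlMr// div1r ltNge.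
    case: leP => _ /=; last by rewrite mul0r.
    by rewrite !mul1r -powRN; congr (_ `^ _)%:E; ring.
  rewrite integral_cpowR_pinfty ?mulr_gt0 ?invr_gt0// -EFinM; congr EFin.
  have -> : (enorm z)^-1 `^ (- (2 * s)) = enorm z `^ (2 * s).
    by rewrite -powR_inv1 ?enorm_ge0// -powRrM mulN1r opprK.
  by field; rewrite gt_eqF.
have : (\int[leb]_(z in cball 1) line_integral s f z = (s^-1)%:E *
    \int[leb]_(z in cball 1) (enorm z `^ (2 * s))%:E)%E.
  rewrite -ge0_integralZl//.
  - by apply: eq_integral => z _; rewrite lineE -EFinM mulrC.
  - exact: measurable_cball.
  - by apply: measurable_funTS; apply/measurable_EFinP; exact: measurable_enorm_powR.
  - by move=> z _; rewrite lee_fin powR_ge0.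
  - by rewrite lee_fin invr_ge0 ltW.
rewrite (integral_line_integral s0 mf f0 fN f00 ltr01) powR1 mul1r.
have -> : (\int[leb]_w (f w / enorm w `^ p)%:E = (vball n * (n%:R / (2 * s)))%:E)%E.
  have np : n%:R < p by rewrite ltrDl mulr_gt0.
  have := integral_enorm_powR_out n0 np; rewrite addrAC subrr add0r => <-.
  rewrite [RHS]integral_mkcond; apply: eq_integral => w _; rewrite patchE /f.
  case: ifPn => w1; case: ifPn => //.
  - by rewrite inE /eball/= subr0.
  - by rewrite mul0r.
  - by rewrite powRN mul1r.
  - by rewrite notin_setE /eball/= subr0 => /contrapT h; rewrite h in w1.
move=> h; have : (s%:E * ((2 / p)%:E * (vball n * (n%:R / (2 * s)))%:E) =
   s%:E * ((s^-1)%:E * \int[leb]_(z in cball 1) (enorm z `^ (2 * s))%:E))%E by rewrite h.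
rewrite [RHS]muleA -[in RHS]EFinM mulfV ?gt_eqF// mul1e => <-.
by rewrite -!EFinM; congr EFin; field; rewrite !gt_eqF.
Qed.

Section inequality.
Variables (F : 'rV[R]_n -> R) (K P Q : R).
Hypotheses (mF : measurable_fun setT F) (FN : forall w, F (- w) = F w) (F0 : F 0 = 0).
Hypothesis K0 : 0 < K.
Hypothesis FP : (\int[leb]_w (pos_part F w / enorm w `^ p)%:E = P%:E)%E.
Hypothesis FQ : (\int[leb]_w (neg_part F w / enorm w `^ p)%:E = Q%:E)%E.
Let J z : \bar R := ((1 - s)%:E * \int[mu]_r (F (r *: z) / `|r| `^ (1 + 2 * s))%:E)%E.
Hypothesis Jle : {ae (leb \x leb)%E, forall q : 'rV[R]_n * 'rV[R]_n,
  (J (q.1 + q.2) + J (q.1 - q.2) - 2%:E * J q.1 <= (2 * K * enorm q.2 `^ (2 * s))%:E)%E}.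

Let fp := pos_part F.
Let fm := neg_part F.
Let fp0 w : 0 <= fp w. Proof. exact: pos_part_ge0. Qed.
Let fm0 w : 0 <= fm w. Proof. exact: neg_part_ge0. Qed.
Let mfp : measurable_fun setT fp. Proof. exact: measurable_pos_part. Qed.
Let mfm : measurable_fun setT fm. Proof. exact: measurable_neg_part. Qed.
Let fpN w : fp (- w) = fp w. Proof. by rewrite /fp /pos_part FN. Qed.
Let fmN w : fm (- w) = fm w. Proof. by rewrite /fm /neg_part FN. Qed.
Let fp00 : fp 0 = 0. Proof. by rewrite /fp /pos_part F0 maxxx. Qed.
Let fm00 : fm 0 = 0. Proof. by rewrite /fm /neg_part F0 oppr0 maxxx. Qed.

Let Jp := line_integral s fp.
Let Jm := line_integral s fm.
Let Jp0 z : (0 <= Jp z)%E. Proof. exact: line_integral_ge0. Qed.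
Let Jm0 z : (0 <= Jm z)%E. Proof. exact: line_integral_ge0. Qed.
Let mJp : measurable_fun setT Jp. Proof. exact: measurable_line_integral. Qed.
Let mJm : measurable_fun setT Jm. Proof. exact: measurable_line_integral. Qed.

Let JE z : J z = ((1 - s)%:E * (Jp z - Jm z))%E.
Proof.
congr (_ * _)%E.
by rewrite (@integral_pos_neg_part _ _ R mu (fun r => F (r *: z)) (fun r => `|r| `^ (1 + 2 * s)))// => r; rewrite powR_ge0.
Qed.

Let v := vball n : R.
Let v0 : 0 < v. Proof. exact: vball_gt0. Qed.
Let t0 : 0 < 1 - s. Proof. by rewrite subr_gt0; case/andP: s01. Qed.

Let Ip rho : 0 < rho -> (\int[leb]_(z in cball rho) Jp z = (rho `^ p * (2 / p) * P)%:E)%E.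
Proof. by move=> r0; rewrite (integral_line_integral s0 mfp)// FP. Qed.

Let Im rho : 0 < rho -> (\int[leb]_(z in cball rho) Jm z = (rho `^ p * (2 / p) * Q)%:E)%E.
Proof. by move=> r0; rewrite (integral_line_integral s0 mfm)// FQ. Qed.

Let shift_le (h : 'rV[R]_n -> \bar R) y eps r r' :
  measurable_fun setT h -> (forall z, 0 <= h z)%E -> enorm y <= eps -> r + eps <= r' ->
  (\int[leb]_(z in cball r) h (z + y)%R <= \int[leb]_(z in cball r') h z)%E.
Proof.
move=> mh h0 ye rr.
have mhy := measurableT_comp mh (measurable_rV_shift y).
pose g z := (h \_ (cball r')) z.
have mg : measurable_fun setT g.
  by apply/(measurable_restrictT _ (measurable_cball r')); exact: measurable_funTS.
have g0 z : (0 <= g z)%E by apply: erestrict_ge0.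
rewrite [leRHS]integral_mkcond -/g -(ge0_integral_rVD mg g0 y).
rewrite integral_mkcond; apply: ge0_le_integral => //.
- by move=> z _; apply: erestrict_ge0.
- by apply/(measurable_restrictT _ (measurable_cball r)); exact: measurable_funTS mhy.
- by apply: (measurableT_comp mg); apply: measurable_rVD.
- move=> z _; rewrite patchE; case: ifPn => // zr.
  rewrite /g patchE mem_set//; move: zr; rewrite inE /cball/= => zr.
  by apply: le_trans (enormD _ _) _; apply: le_trans rr; exact: lerD.
Qed.

Let P0 : 0 <= P.
Proof.
by rewrite -lee_fin -FP; apply: integral_ge0 => w _; rewrite lee_fin divr_ge0 ?powR_ge0 ?fp0.
Qed.

Let mtrans (h : 'rV[R]_n -> \bar R) y D : measurable_fun setT h ->
  measurable_fun D (fun z => h (z + y)%R).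
Proof.
by move=> mh; apply: measurable_funTS; apply: (measurableT_comp mh); apply: measurable_rVD.
Qed.

Let integral_two_sided (h : 'rV[R]_n -> \bar R) y :
  measurable_fun setT h -> (forall z, 0 <= h z)%E ->
  (\int[leb]_(z in cball 1) ((1 - s)%:E * (h (z + y)%R + h (z - y)%R)) =
   (1 - s)%:E * (\int[leb]_(z in cball 1) h (z + y)%R + \int[leb]_(z in cball 1) h (z - y)%R))%E.
Proof.
move=> mh h0; have mB : measurable (cball 1 : set 'rV[R]_n) := measurable_cball 1.
rewrite ge0_integralZl//; last 3 first.
- by apply: emeasurable_funD; exact: mtrans.
- by move=> z _; rewrite adde_ge0.
- by rewrite lee_fin ltW.
by rewrite ge0_integralD//; exact: mtrans.
Qed.

(** The unit ball shifted by [y] or [- y] contains the ball of radius [1 - eps] and lies in that of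
    radius [1 + eps]. The first inclusion bounds the integrals of [Jp] from below, the second those
    of [Jm] from above; the term in [Jp y] is constant in [z]. *)
Let bound_at eps y : 0 < eps < 1 -> enorm y <= eps ->
  {ae leb, forall z, (J (y + z) + J (y - z) - 2%:E * J y <= (2 * K * enorm z `^ (2 * s))%:E)%E} ->
  (((1 - s) * ((1 - eps) `^ p * (2 / p) * P) - K * (n%:R * v / p)
     - (1 - s) * ((1 + eps) `^ p * (2 / p) * Q))%:E <= ((1 - s) * v)%:E * Jp y)%E.
Proof.
move=> /andP[eps0 eps1] ye hy.
have mB : measurable (cball 1 : set 'rV[R]_n) := measurable_cball 1.
have yeN : enorm (- y) <= eps by rewrite enormN.
have le_int : (\int[leb]_(z in cball 1) ((1 - s)%:E * (Jp (z + y)%R + Jp (z - y)%R)) <=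
   \int[leb]_(z in cball 1) ((2 * K * enorm z `^ (2 * s))%:E
      + (1 - s)%:E * (Jm (z + y)%R + Jm (z - y)%R) + (2 * (1 - s))%:E * Jp y))%E.
  have t0E : (0 <= (1 - s)%:E :> \bar R)%E by rewrite lee_fin ltW.
  have K2 z : (0 <= (2 * K * enorm z `^ (2 * s))%:E :> \bar R)%E.
    by rewrite lee_fin !mulr_ge0 ?powR_ge0// ltW.
  have c0 : (0 <= (2 * (1 - s))%:E * Jp y)%E by rewrite mule_ge0// lee_fin mulr_ge0// ltW.
  apply: ae_ge0_le_integral => //.
  - by move=> z _; rewrite mule_ge0// adde_ge0.
  - by apply: measurable_funeM; apply: emeasurable_funD; exact: mtrans.
  - by move=> z _; rewrite !adde_ge0// mule_ge0// adde_ge0.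
  - apply: emeasurable_funD => //; apply: emeasurable_funD.
      apply: measurable_funTS; apply/measurable_EFinP; apply: measurable_funM => //.
      exact: measurable_enorm_powR.
    by apply: measurable_funeM; apply: emeasurable_funD; exact: mtrans.
  - move: hy; apply: filterS => z + _; rewrite !JE => h.
    have := lee_rearrange t0 (Jp0 _) (Jm0 _) (Jp0 _) (Jm0 _) (Jp0 _) (Jm0 _) h.
    have -> : Jp (y - z) = Jp (z - y) by rewrite -(opprB z y) /Jp line_integralN.
    have -> : Jm (y - z) = Jm (z - y) by rewrite -(opprB z y) /Jm line_integralN.
    by rewrite (addrC y).
have lo : ((2 * ((1 - s) * ((1 - eps) `^ p * (2 / p) * P)))%:E <=
    \int[leb]_(z in cball 1) ((1 - s)%:E * (Jp (z + y)%R + Jp (z - y)%R)))%E.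
  rewrite integral_two_sided// (_ : (2 * _)%:E = (1 - s)%:E *
     (((1 - eps) `^ p * (2 / p) * P)%:E + ((1 - eps) `^ p * (2 / p) * P)%:E))%E; last first.
    by rewrite -EFinD -EFinM; congr EFin; ring.
  apply: lee_wpmul2l; first by rewrite lee_fin ltW.
  have eps1' : 0 < 1 - eps by rewrite subr_gt0.
  rewrite -(Ip eps1'); apply: leeD.
    have := @shift_le (fun z => Jp (z + y)%R) (- y) eps (1 - eps) 1 (mtrans y mJp) _ yeN.
    under eq_integral do rewrite subrK.
    by apply => //; rewrite subrK.
  have := @shift_le (fun z => Jp (z - y)%R) y eps (1 - eps) 1 (mtrans (- y) mJp) _ ye.
  under eq_integral do rewrite addrK.
  by apply => //; rewrite subrK.
have up : (\int[leb]_(z in cball 1) ((1 - s)%:E * (Jm (z + y)%R + Jm (z - y)%R)) <=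
    (2 * ((1 - s) * ((1 + eps) `^ p * (2 / p) * Q)))%:E)%E.
  rewrite integral_two_sided// (_ : (2 * _)%:E = (1 - s)%:E *
     (((1 + eps) `^ p * (2 / p) * Q)%:E + ((1 + eps) `^ p * (2 / p) * Q)%:E))%E; last first.
    by rewrite -EFinD -EFinM; congr EFin; ring.
  apply: lee_wpmul2l; first by rewrite lee_fin ltW.
  rewrite -(Im (addr_gt0 ltr01 eps0)); apply: leeD.
    exact: (shift_le mJm Jm0 ye).
  exact: (shift_le mJm Jm0 yeN).
have {le_int} := le_trans lo le_int.
rewrite ge0_integralD//; last 3 first.
- move=> z _; apply: adde_ge0; first by rewrite lee_fin !mulr_ge0 ?powR_ge0// ltW.
  by apply: mule_ge0; [rewrite lee_fin ltW|exact: adde_ge0].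
- apply: emeasurable_funD.
    apply: measurable_funTS; apply/measurable_EFinP; apply: measurable_funM => //.
    exact: measurable_enorm_powR.
  by apply: measurable_funeM; apply: emeasurable_funD; exact: mtrans.
- by move=> z _; rewrite mule_ge0// lee_fin mulr_ge0// ltW.
rewrite ge0_integralD//; last 4 first.
- by move=> z _; rewrite lee_fin !mulr_ge0 ?powR_ge0// ltW.
- apply: measurable_funTS; apply/measurable_EFinP; apply: measurable_funM => //.
  exact: measurable_enorm_powR.
- by move=> z _; apply: mule_ge0; [rewrite lee_fin ltW|exact: adde_ge0].
- by apply: measurable_funeM; apply: emeasurable_funD; exact: mtrans.
have -> : (\int[leb]_(z in cball 1) (2 * K * enorm z `^ (2 * s))%:E = (2 * K * (n%:R * v / p))%:E)%E.
  under eq_integral do rewrite EFinM.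
  rewrite ge0_integralZl//.
  - by rewrite integral_enorm_powR_cball -EFinM.
  - by apply: measurable_funTS; apply/measurable_EFinP; exact: measurable_enorm_powR.
  - by move=> z _; rewrite lee_fin powR_ge0.
  - by rewrite lee_fin mulr_ge0// ltW.
have lebB : leb (cball 1) = v%:E by rewrite lebesgue_rV_cball// expr1n mul1r.
rewrite integral_cst// [X in (_ <= _ + _ * X)%E]lebB => h.
have {h} := le_trans h (leeD (leeD (lexx _) up) (lexx _)).
(* If [Jp y = +oo], so is the right-hand side; otherwise the comparison is between real numbers. *)
rewrite -/v; move: (Jp y) (Jp0 y) => j; case: j => [j| |]// _; last first.
  by move=> _; rewrite gt0_muley ?leey// lte_fin mulr_gt0.
rewrite -!(EFinD, EFinM) !lee_fin => h; lra.
Qed.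

Let bound_eps eps : 0 < eps < 1 ->
  (1 - s) * ((1 - eps) `^ p * P - (1 + eps) `^ p * Q) <=
    K * (n%:R * v / 2) + (1 - s) * (eps `^ (2 * s) * P).
Proof.
move=> eps01; have /andP[eps0 eps1] := eps01.
set c := (1 - s) * ((1 - eps) `^ p * (2 / p) * P) - K * (n%:R * v / p)
     - (1 - s) * ((1 + eps) `^ p * (2 / p) * Q).
suff : c <= (1 - s) * (eps `^ (2 * s) * (2 / p) * P).
  move=> h; have : c * (p / 2) <= (1 - s) * (eps `^ (2 * s) * (2 / p) * P) * (p / 2).
    by rewrite ler_wpM2r// divr_ge0// ltW.
  rewrite (_ : c * (p / 2) = (1 - s) * ((1 - eps) `^ p * P - (1 + eps) `^ p * Q) - K * (n%:R * v / 2)).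
    rewrite (_ : _ * (p / 2) = (1 - s) * (eps `^ (2 * s) * P)); first by lra.
    by field; rewrite gt_eqF.
  by rewrite /c; field; rewrite gt_eqF.
(* For [c <= 0] the claim is a sign statement; for [c > 0] both sides are nonnegative and can be
   integrated over [cball eps]. *)
have [c0|c0] := leP c 0.
  by apply: le_trans c0 _; rewrite !mulr_ge0 ?powR_ge0 ?invr_ge0// ltW.
have mB : measurable (cball eps : set 'rV[R]_n) := measurable_cball eps.
have : (\int[leb]_(y in cball eps) c%:E <= \int[leb]_(y in cball eps) (((1 - s) * v)%:E * Jp y))%E.
  apply: ae_ge0_le_integral => //.
  - by move=> y _; rewrite lee_fin ltW.
  - by move=> y _; rewrite mule_ge0// lee_fin mulr_ge0// ltW.
  - by apply: emeasurable_funM => //; exact: measurable_funTS.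
  - have := ae_prod Jle; apply: filterS => y hy ye.
    exact: (bound_at eps01 ye hy).
rewrite integral_cst// [X in (_ * X <= _)%E]lebesgue_rV_cball// ge0_integralZl//; last 2 first.
- exact: measurable_funTS.
- by rewrite lee_fin mulr_ge0// ltW.
rewrite Ip// -!EFinM lee_fin -/v.
(* The factor [eps^n] cancels with the volume [eps^n |B|] of the ball over which [y] ranges, so only
   [eps^(2s)] survives. *)
have -> : eps `^ p = eps ^+ n * eps `^ (2 * s).
  by rewrite powRD ?powR_mulrn ?(ltW eps0)// (gt_eqF eps0) implybT.
have h0 : 0 < eps ^+ n * v by rewrite mulr_gt0// exprn_gt0.
by move=> h; rewrite -(ler_pM2r h0); apply: le_trans h _; rewrite le_eqVlt; apply/orP; left; apply/eqP; ring.
Qed.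

Lemma pos_neg_part_le : (1 - s) * (P - Q) <= K * (n%:R * v / 2).
Proof.
pose f (eps : R) := (1 - s) * ((1 - eps) `^ p * P - (1 + eps) `^ p * Q)
   - (1 - s) * (eps `^ (2 * s) * P).
have cv : f eps @[eps --> 0^'+] --> (1 - s) * (P - Q).
  rewrite (_ : (1 - s) * (P - Q) = (1 - s) * ((1 - 0) `^ p * P - (1 + 0) `^ p * Q)
     - (1 - s) * (0 * P)); last by rewrite subr0 addr0 powR1; ring.
  have near_powR (g : R -> R) : continuous g -> g 0 = 1 ->
      g eps `^ p @[eps --> 0^'+] --> (g 0) `^ p.
    move=> cg g0; apply: cvg_at_right_filter.
    apply: (@continuous_comp R R R g (fun t => t `^ p)); first exact: cg.
    by apply: continuous_at_powR; rewrite g0.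
  apply: cvgB; apply: cvgMl_tmp.
    apply: cvgB; apply: cvgMr_tmp.
      apply: (near_powR (fun eps => 1 - eps)); last by rewrite subr0.
      by move=> e; apply: (@cvgB R R R (nbhs e) _ (cst 1) id); [exact: cvg_cst|exact: cvg_id].
    apply: (near_powR (fun eps => 1 + eps)); last by rewrite addr0.
    by move=> e; apply: (@cvgD R R R (nbhs e) _ (cst 1) id); [exact: cvg_cst|exact: cvg_id].
  by apply: cvgMr_tmp; apply: powR_cvg0; rewrite mulr_gt0.
apply: (cvgr_to_le cv); near=> eps.
rewrite /f lerBlDr; apply: bound_eps; apply/andP; split; near: eps.
  exact: nbhs_right_gt.
exact: nbhs_right_lt.
Unshelve. all: by end_near. Qed.

End inequality.
End upper.

(** * The scalar matrix and the constants *)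

Section scalar_A2.
Context {R : realType} (n : nat).
Hypothesis n1 : (1 < n)%N.
Let n0 : (0 < n)%N := ltnW n1.
Let nR : 0 < n%:R :> R. Proof. by rewrite ltr0n. Qed.
Let n1R : 0 < n%:R - 1 :> R. Proof. by rewrite subr_gt0 ltr1n. Qed.

Lemma sigma2_cst (c : R) : sigma2 (fun _ : 'I_n => c) = c ^+ 2 * (n%:R * (n%:R - 1) / 2).
Proof.
have h : sigma2 (fun _ : 'I_n => c) *+ 2 = \sum_(i < n) \sum_(j < n | j != i) c * c.
  rewrite mulr2n {2}/sigma2; under [X in _ + X]eq_bigr do rewrite big_mkcond.
  rewrite exchange_big -big_split /=; apply: eq_bigr => i _.
  rewrite -big_mkcond [RHS](bigID (fun j : 'I_n => (i < j)%N)) /=.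
  congr (_ + _); apply: eq_bigl => j; rewrite -(inj_eq val_inj) neq_ltn.
    by case: (ltnP i j) => h; rewrite ?orbT ?andbF.
  by case: (ltngtP j i) => h.
have e (i : 'I_n) : \sum_(j < n | j != i) c * c = (n%:R - 1) * (c * c).
  rewrite sumr_const cardC1 card_ord -[X in X = _]mulr_natl -subn1 natrB//.
have : sigma2 (fun _ : 'I_n => c) * 2 = n%:R * (n%:R - 1) * c ^+ 2.
  by rewrite mulr_natr h (eq_bigr _ (fun i _ => e i)) sumr_const card_ord -[LHS]mulr_natl expr2 mulrA.
by move=> {}h; apply: (@mulIf _ 2); rewrite ?pnatr_eq0// h; field.
Qed.

(* The matrix [scale%:M] corresponds to [zeta = (c, ..., c)] with [sigma2 zeta = 1]. *)
Definition scale : R := Num.sqrt (Num.sqrt (2 * (n%:R - 1) / n%:R)).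

Let X0 : 0 < 2 * (n%:R - 1) / n%:R :> R. Proof. by rewrite divr_gt0// mulr_gt0. Qed.

Lemma scale_gt0 : 0 < scale.
Proof. by rewrite !sqrtr_gt0. Qed.

Lemma sqr_scale : scale ^+ 2 = Num.sqrt (2 * (n%:R - 1) / n%:R).
Proof. by rewrite sqr_sqrtr// sqrtr_ge0. Qed.

(** [m_star] is the trace of [A^2] for the scalar matrix [A] chosen in [A2]; the local bound tests
    with this matrix, and [m_star^s = lambda^(2s) n^s] accounts for the [n^s] in [c_Ks]. *)
Lemma sqr_scaleM : scale ^+ 2 * n%:R = m_star n.
Proof.
rewrite sqr_scale /m_star.
rewrite (_ : 2 * n%:R * (n%:R - 1) = (2 * (n%:R - 1) / n%:R) * n%:R ^+ 2); last first.
  by field; rewrite gt_eqF.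
by rewrite [in RHS]sqrtrM ?(ltW X0)// sqrtr_sqr ger0_norm// ltW.
Qed.

Lemma A2_scale : @A2 R n scale%:M.
Proof.
split.
  split; first by rewrite tr_scalar_mx.
  move=> v v0; rewrite mul_mx_scalar -scalemxAl mxE mulr_gt0 ?scale_gt0//.
  rewrite mxE; under eq_bigr do rewrite mxE -expr2.
  by rewrite -/(edot v v) -enorm_sqr exprn_gt0// enorm_gt0.
exists (fun=> scale); split.
  rewrite /eigenvalues_of char_poly_trig ?scalar_mx_is_trig//.
  by apply: eq_bigr => i _; rewrite mxE eqxx.
(* This solves [c^2 n (n-1) / 2 = 1], that is [sigma2 = 1]; the eigenvalue condition then reads
   [scale^2 = (n-1) c]. *)
pose c : R := Num.sqrt (2 / (n%:R * (n%:R - 1))).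
have c2 : c ^+ 2 = 2 / (n%:R * (n%:R - 1)) by rewrite sqr_sqrtr// divr_ge0// mulr_ge0// ltW.
have c0 : 0 < c by rewrite sqrtr_gt0 divr_gt0// mulr_gt0.
have s2 : sigma2 (fun _ : 'I_n => c) = 1.
  by rewrite sigma2_cst c2; field; rewrite !gt_eqF.
exists (fun=> c); split => //.
  split; last by rewrite s2.
  by rewrite /sigma1 sumr_const card_ord pmulrn_lgt0.
move=> i; rewrite sqr_scale sumr_const cardC1 card_ord -[RHS]mulr_natl -subn1 natrB//.
have h : n%:R - 1 = Num.sqrt ((n%:R - 1) ^+ 2) :> R by rewrite sqrtr_sqr ger0_norm// ltW.
rewrite [X in _ = X * _]h /c -sqrtrM ?sqr_ge0//.
by congr Num.sqrt; field; rewrite !gt_eqF.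
Qed.

End scalar_A2.

(** * The constant in the bound and its limit *)

Section constants.
Context {R : realType} (d : nat).
Local Notation n := d.+2.
Let n1 : (1 < n)%N. Proof. by []. Qed.
Let nR : 0 < n%:R :> R. Proof. by rewrite ltr0n. Qed.
Let n1R : 0 < n%:R - 1 :> R. Proof. by rewrite subr_gt0 ltr1n. Qed.
Let X0 : 0 < 2 * (n%:R - 1) / n%:R :> R. Proof. by rewrite divr_gt0// mulr_gt0. Qed.

Lemma scale_powR (s : R) : scale n `^ (2 * s) = (2 * (n%:R - 1) / n%:R) `^ (s / 2) :> R.
Proof.
have h : scale n = (2 * (n%:R - 1) / n%:R) `^ (4^-1) :> R.
  by rewrite /scale -!powR12_sqrt ?powR_ge0 ?(ltW X0)// -powRrM; congr (_ `^ _); field.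
by rewrite h -powRrM; congr (_ `^ _); field.
Qed.

Lemma bound_constE (K s : R) :
  K * (omega n / 4) * (Cns n s / (1 - s)) * (2 * (n%:R - 1) / n%:R) `^ (s / 2)
  = c_Ks n K s * m_star n `^ s.
Proof.
have -> : m_star n `^ s = (2 * (n%:R - 1) / n%:R) `^ (s / 2) * n%:R `^ s :> R.
  rewrite -sqr_scaleM// powRM ?sqr_ge0 ?ler0n// -scale_powR; congr (_ * _).
  by rewrite -powR_mulrn ?ltW ?scale_gt0// -powRrM.
have h : 0 < n%:R `^ s :> R by rewrite powR_gt0.
rewrite /c_Ks; move: (Cns n s / (1 - s)) (_ `^ (s / 2)) => x y.
by field; rewrite gt_eqF.
Qed.

Lemma continuous_powRr (a : R) : 0 < a -> continuous (fun s : R => a `^ s).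
Proof.
move=> a0 s; rewrite (_ : (fun s => a `^ s) = (fun s => expR (s * ln a))); last first.
  by apply/funext => t; rewrite /powR gt_eqF.
apply: (@continuous_comp R R R (fun s => s * ln a) expR); last exact: continuous_expR.
by apply: cvgMr_tmp; exact: cvg_id.
Qed.

Lemma cvg_bound_const (K : R) :
  c_Ks n K s * m_star n `^ s @[s --> (1 : R)^'-] --> m_star n * K.
Proof.
have m0 : 0 < m_star n :> R by rewrite -sqr_scaleM// mulr_gt0// exprn_gt0// scale_gt0.
(* For [s < 1] this equals the constant, with [(1-s) Gamma(1-s)] replaced by [Gamma(2-s)], and it is
   continuous at 1. There [omega = n |B|] and [|B| Gamma(n/2+1) = pi^(n/2)] reduce it to
   [m_star K]. *)
pose g (s : R) := K * omega n / 4 / pi `^ (n%:R / 2) *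
  ((n%:R `^ s)^-1 * (4 `^ s * s * Gamma ((n%:R + 2 * s) / 2) * (Gamma (2 - s))^-1) * m_star n `^ s).
have v0 : 0 < vball n :> R by exact: vball_gt0.
have g1 : g 1 = m_star n * K.
  rewrite /g !powRr1 ?ltW// omegaE -Gamma_vball//.
  rewrite (_ : (n%:R + 2 * 1) / 2 = n%:R / 2 + 1 :> R); last by field.
  rewrite (_ : 2 - 1 = 1 :> R); last by ring.
  have G0 : Gamma (n%:R / 2 + 1) != 0 :> R.
    apply/eqP => G0; have := @Gamma_vball R n isT.
    by rewrite G0 mulr0 => /eqP; rewrite eq_sym powR_eq0 gt_eqF// pi_gt0.
  by rewrite Gamma1; field; rewrite G0 gt_eqF//= gt_eqF// ltr_wpDr.
rewrite -g1; apply: (@cvg_trans _ (g s @[s --> (1 : R)^'-])).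
  apply: near_eq_cvg; near=> s.
  have s1 : 0 < 1 - s by rewrite subr_gt0; near: s; exact: nbhs_left_lt.
  rewrite /g /c_Ks /Cns /= (_ : 2 - s = (1 - s) + 1); last by ring.
  by rewrite GammaD1// !invfM; ring.
apply: cvg_at_left_filter.
have cG1 : Gamma ((n%:R + 2 * s) / 2) @[s --> (1 : R)] --> Gamma ((n%:R + 2 * 1) / 2 : R).
  apply: (@continuous_comp R R R (fun s => (n%:R + 2 * s) / 2) (@Gamma R)).
    apply: cvgMr_tmp; apply: (@cvgD R R R (nbhs (1 : R)) _ (cst n%:R) (fun s => 2 * s)).
      exact: cvg_cst.
    by apply: cvgMl_tmp; exact: cvg_id.
  by apply: continuous_Gamma; rewrite divr_gt0// addr_gt0.
have cG2 : Gamma (2 - s) @[s --> (1 : R)] --> Gamma (2 - 1 : R).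
  apply: (@continuous_comp R R R (fun s => 2 - s) (@Gamma R)).
    by apply: (@cvgB R R R (nbhs (1 : R)) _ (cst 2) id); [exact: cvg_cst|exact: cvg_id].
  by apply: continuous_Gamma; rewrite subr_gt0 ltr1n.
apply: cvgMl_tmp; apply: cvgM; last exact: continuous_powRr.
apply: cvgM.
  by apply: cvgV; [rewrite gt_eqF// powR_gt0|exact: continuous_powRr].
apply: cvgM; last first.
  apply: cvgV; last exact: cG2.
  by rewrite (_ : 2 - 1 = 1 :> R) ?Gamma1 ?oner_eq0//; ring.
apply: cvgM; last exact: cG1.
apply: cvgM; last exact: cvg_id.
by apply: continuous_powRr.
Unshelve. all: by end_near. Qed.

End constants.

Lemma loewner_diag {R : realType} n (A : 'M[R]_n) K i : loewner_le A K%:M -> A i i <= K.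
Proof.
move=> /(_ (delta_mx ord0 i)); rewrite trmx_delta -!rowE -!colE !mxE eqxx mulr1n.
by [].
Qed.

(** The infimum is tested with [scale%:M]: the trace becomes [scale^2] times that of the Hessian,
    whose diagonal entries are at most [K]. *)
Lemma local_op_le {R : realType} n (w : 'rV[R]_n -> R) x K : (1 < n)%N ->
  loewner_le (hessian w x) K%:M -> (local_op w x <= (m_star n * K)%:E)%E.
Proof.
move=> n1 hK; apply: (@le_trans _ _ (\tr ((scale n)%:M *m hessian w x *m (scale n)%:M))%:E).
  by apply: ereal_inf_lbound; exists (scale n)%:M => //; exact: A2_scale.
rewrite lee_fin mul_mx_scalar mul_scalar_mx !mxtraceZ mulrA -expr2 -sqr_scaleM// -mulrA.
apply: ler_wpM2l; first by rewrite sqr_ge0.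
rewrite /mxtrace -mulr_natl mulr1 -[n in n%:R]card_ord mulr_natl -sumr_const.
by apply: ler_sum => i _; exact: loewner_diag.
Qed.

(** * The upper bound for the nonlocal operator *)

Section Kop_upper.
Context {R : realType} (n : nat) (s K eta : R).
Hypotheses (n1 : (1 < n)%N) (s01 : 0 < s < 1) (K0 : 0 < K) (eta0 : 0 < eta).
Local Notation leb := (@lebesgue_rV R n).
Local Notation p := (n%:R + 2 * s).
Variables (Omega : set 'rV[R]_n) (u : 'rV[R]_n -> R) (x : 'rV[R]_n).
Hypotheses (uL1 : L1_omega s u) (uv : viscosity_ge s Omega u eta).
Hypotheses (ux : touchable Omega u x) (uK : second_diff_ineq s K u x).

Let n0 : (0 < n)%N := ltnW n1.

(** Substituting [w = lambda y] produces [lambda^p] from the weight and [lambda^(-n)] from the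
    volume. *)
Let integral_scale (f : 'rV[R]_n -> R) : measurable_fun setT f -> (forall w, 0 <= f w) ->
  (\int[leb]_y (f (y *m (scale n)%:M^T) / enorm y `^ p)%:E =
   (scale n `^ (2 * s))%:E * \int[leb]_w (f w / enorm w `^ p)%:E)%E.
Proof.
move=> mf f0; have l0 : 0 < scale n :> R by exact: scale_gt0.
pose g w : \bar R := (f w / enorm w `^ p)%:E.
have g0 w : (0 <= g w)%E by rewrite lee_fin divr_ge0// powR_ge0.
have mg : measurable_fun setT g by exact: measurable_div_enorm_powR.
have lp : scale n `^ p = scale n ^+ n * scale n `^ (2 * s) :> R.
  by rewrite powRD ?powR_mulrn ?(ltW l0)// (gt_eqF l0) implybT.
have -> : (\int[leb]_y (f (y *m (scale n)%:M^T) / enorm y `^ p)%:E =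
    \int[leb]_y ((scale n `^ p)%:E * g (scale n *: y)))%E.
  apply: eq_integral => y _; rewrite tr_scalar_mx mul_mx_scalar /g enormZ (ger0_norm (ltW l0)).
  rewrite -EFinM; congr EFin; rewrite powRM ?enorm_ge0 ?(ltW l0)// invfM.
  by rewrite [RHS]mulrCA mulVKf// gt_eqF// powR_gt0.
have mgs : measurable_fun setT (fun y : 'rV[R]_n => g (scale n *: y)).
  by apply: (measurableT_comp mg); apply: measurable_rVZ.
have lp0 : (0 <= (scale n `^ p)%:E :> \bar R)%E by rewrite lee_fin powR_ge0.
rewrite (ge0_integralZl leb measurableT mgs (fun y _ => g0 _) lp0).
rewrite (ge0_integral_rVZ mg g0 l0) muleA -EFinM lp; congr (_%:E * _)%E.
by rewrite mulrAC exprVn mulfV ?mul1r// expf_neq0// gt_eqF.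
Qed.

Lemma Kop_le :
  (Kop s u x <= (K * (n%:R * vball n / 4) * (Cns n s / (1 - s)) * scale n `^ (2 * s))%:E)%E.
Proof.
set F := second_diff u x.
have mF : measurable_fun setT F by exact: measurable_second_diff (proj1 uL1).
have FN w : F (- w) = F w by rewrite /F /second_diff opprK [u _ + _]addrC.
have F0 : F 0 = 0 by rewrite /F /second_diff addr0 subr0; ring.
have l0 : 0 < scale n `^ (2 * s) :> R by rewrite powR_gt0// scale_gt0.
have [] := viscosity_integral n1 s01 eta0 uL1 uv ux (@A2_scale R n n1).
rewrite -/F (integral_scale (measurable_pos_part mF) (pos_part_ge0 F)).
rewrite (integral_scale (measurable_neg_part mF) (neg_part_ge0 F)).
set IP := (\int[leb]_w (pos_part F w / _)%:E)%E; set IQ := (\int[leb]_w (neg_part F w / _)%:E)%E.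
move=> hP hQ.
have IP0 : (0 <= IP)%E.
  by apply: integral_ge0 => y _; rewrite lee_fin divr_ge0 ?powR_ge0 ?pos_part_ge0.
have IQ0 : (0 <= IQ)%E.
  by apply: integral_ge0 => y _; rewrite lee_fin divr_ge0 ?powR_ge0 ?neg_part_ge0.
(* [viscosity_integral], the core of the lower bound, supplies the finiteness of both parts; the
   factor [lambda^(2s) > 0] carries no infinity. *)
have [P PE] : exists P, IP = P%:E.
  case: IP hP IP0 {hQ} => [P| |]//; first by exists P.
  by rewrite gt0_muley ?lte_fin// ltxx.
have [Q QE] : exists Q, IQ = Q%:E.
  case: IQ hQ IQ0 => [Q| |]//; first by exists Q.
  by rewrite gt0_muley ?lte_fin// PE -EFinM addey// leye_eq.
have := pos_neg_part_le n0 s01 mF FN F0 K0 PE QE uK => PQ.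
apply: (@le_trans _ _ ((Cns n s / 2)%:E * ((scale n `^ (2 * s))%:E * IP - (scale n `^ (2 * s))%:E * IQ))%E).
  apply: lee_wpmul2l; first by rewrite lee_fin divr_ge0// Cns_ge0.
  apply: ereal_inf_lbound; exists (scale n)%:M; first exact: A2_scale.
  rewrite (@integral_pos_neg_part _ _ R leb (fun y => F (y *m (scale n)%:M^T)) (fun y => enorm y `^ p)); last first.
    by move=> y; rewrite powR_ge0.
  rewrite -(integral_scale (measurable_pos_part mF) (pos_part_ge0 F)).
  by rewrite -(integral_scale (measurable_neg_part mF) (neg_part_ge0 F)).
rewrite PE QE -(EFinM _ P) -(EFinM _ Q) -EFinB -EFinM lee_fin.
have t0 : 0 < 1 - s by rewrite subr_gt0; case/andP: s01.
have C0 := @Cns_ge0 R n s s01.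
set l := scale n `^ (2 * s) in l0 *; set C := Cns n s in C0 *; set v := vball n in PQ *.
(* The 4 of the final constant is the 2 in the definition of [Kop] times the 2 in the bound for
   [P - Q]. *)
rewrite (_ : C / 2 * (l * P - l * Q) = (C * l / (2 * (1 - s))) * ((1 - s) * (P - Q))); last first.
  by field; rewrite gt_eqF.
rewrite (_ : K * _ * _ * l = (C * l / (2 * (1 - s))) * (K * (n%:R * v / 2))); last first.
  by field; rewrite gt_eqF.
by apply: ler_wpM2l => //; apply: divr_ge0; apply: mulr_ge0 => //; exact: ltW.
Qed.

End Kop_upper.

Theorem lemma2p6 (R : realType) (n : nat) (hn : (3 <= n)%N)
    (Omega : set 'rV[R]_n) (hOmega : domain Omega)
    (eta0 : R) (heta0 : 0 < eta0) (K : R) (hK : 0 < K) :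
  [/\ forall (s : R) (u : 'rV[R]_n -> R),
        0 < s < 1 ->
        continuous u -> L1_omega s u ->
        viscosity_ge s Omega u eta0 ->
        (forall x, touchable Omega u x -> second_diff_ineq s K u x) ->
        forall x, touchable Omega u x ->
        [/\ (eta0%:E <= Kop s u x)%E,
            (Kop s u x <= (K * (omega n / 4) * (Cns n s / (1 - s))
                             * (2 * (n%:R - 1) / n%:R) `^ (s / 2))%:E)%E &
            K * (omega n / 4) * (Cns n s / (1 - s))
              * (2 * (n%:R - 1) / n%:R) `^ (s / 2)
            = c_Ks n K s * m_star n `^ s],
      c_Ks n K s * m_star n `^ s @[s --> (1 : R)^'-] --> m_star n * K &
      forall w : 'rV[R]_n -> R,
        C2_on Omega w ->
        (forall x, Omega x -> loewner_le (hessian w x) K%:M) ->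
        (forall x, Omega x -> (eta0%:E <= local_op w x)%E) ->
        forall x, Omega x ->
        (eta0%:E <= local_op w x)%E /\ (local_op w x <= (m_star n * K)%:E)%E].
Proof.
(* The sphere formula lives in [R^(d+1)] and the constants require dimension at least 2, so both are
   stated in successor form. *)
have [d nE] : exists d, n = d.+2 by exists n.-2; rewrite -[LHS](subnK (ltnW hn)) addn2 -subn2.
have n1 : (1 < n)%N by exact: ltnW.
split.
- move=> s u s01 _ uL1 uv uK x ux; split.
  + exact: (viscosity_classical n1 s01 heta0 uL1 uv ux).
  + apply: le_trans (Kop_le n1 s01 hK heta0 uL1 uv ux (uK x ux)) _.
    by clear -nE; subst n; rewrite -scale_powR omegaE.
  + by clear -nE; subst n; exact: bound_constE.
- by clear -nE; subst n; exact: cvg_bound_const.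
- move=> w _ wK wlo x xO; split; first exact: wlo.
  by apply: local_op_le => //; exact: wK.
Qed.
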